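(* There is a polynomial-time algorithm which, on input a brace $G=(A\cup B,E)$, returns a perfect matching decomposition of $G$ of width $2$ if and only if $\operatorname{pmw}(G)=2$.
   Context: All graphs are finite and simple. A perfect matching of $G$ is a set of pairwise disjoint edges covering every vertex; $\mathcal{M}(G)$ denotes the set of perfect matchings of $G$. $G$ is matching covered if it is connected and every edge lies in some perfect matching. For nonempty $X\subseteq V(G)$, $\partial(X)$ is the set of edges with exactly one endpoint in $X$; $X$ and $V(G)\setminus X$ are its shores. The matching porosity of a cut is $\operatorname{mp}(\partial(X))=\max_{M\in\mathcal{M}(G)}|M\cap\partial(X)|$. A perfect matching decomposition (PM-decomposition) of $G$ is a pair $(T,\delta)$ where $T$ is a cubic tree (every non-leaf vertex has degree $3$) and $\delta$ is a bijection from the set of leaves of $T$ to $V(G)$. For an edge $t_1t_2$ of $T$, let $T_1,T_2$ be the components of $T-t_1t_2$ with $t_i\in T_i$ and $X_i$ the set of images under $\delta$ of the leaves in $T_i$; the edge induces the cut $\partial(t_1t_2):=\partial(X_1)=\partial(X_2)$. The width of $(T,\delta)$ is the maximum of $\operatorname{mp}(\partial(t_1t_2))$ over all edges $t_1t_2$ of $T$, and the perfect matching width $\operatorname{pmw}(G)$ is the minimum width of a PM-decomposition of $G$. A cut $\partial(Z)$ of a matching covered graph is tight if $|M\cap\partial(Z)|=1$ for every $M\in\mathcal{M}(G)$, and nontrivial if both shores have at least two vertices. A brace is a bipartite matching covered graph (with colour classes $A,B$) having no nontrivial tight cut. *)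

(* Defs.v *)
From HB Require Import structures.
From mathcomp Require Import all_boot.

Set Implicit Arguments.
Unset Strict Implicit.
Unset Printing Implicit Defensive.

(** * Graphs and perfect matchings *)

Record sgraph (V : finType) := SGraph {
  adj :> rel V;
  adj_sym : symmetric adj;
  adj_irrefl : irreflexive adj }.

Section Graphs.
Variables (V : finType) (G : sgraph V).

Definition edges : {set {set V}} :=
  [set [set p.1; p.2] | p : V * V & G p.1 p.2].

Definition perfect_matching (M : {set {set V}}) : bool :=
  [&& M \subset edges, trivIset M & cover M == [set: V]].

Definition connected_graph : Prop :=
  0 < #|V| /\ forall x y, connect G x y.

Definition matching_covered : Prop :=
  connected_graph /\
  forall e, e \in edges -> exists2 M, perfect_matching M & e \in M.

Definition cut (X : {set V}) : {set {set V}} :=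
  [set e in edges | #|e :&: X| == 1].

(* The maximum is 0 when there is no perfect matching. *)
Definition matching_porosity (X : {set V}) : nat :=
  \max_(M | perfect_matching M) #|M :&: cut X|.

Definition tight_cut (Z : {set V}) : Prop :=
  forall M, perfect_matching M -> #|M :&: cut Z| = 1.

Definition nontrivial_cut (Z : {set V}) : Prop := 1 < #|Z| /\ 1 < #|~: Z|.

Definition bipartite : Prop :=
  exists A : {set V}, forall x y, G x y -> (x \in A) != (y \in A).

Definition brace : Prop :=
  [/\ bipartite, matching_covered
    & forall Z, nontrivial_cut Z -> ~ tight_cut Z].

Definition degree (x : V) : nat := #|[set y | G x y]|.

Definition leaves : {set V} := [set x | degree x == 1].

Definition acyclic : Prop :=
  forall c : seq V, 2 < size c -> uniq c -> ~~ cycle G c.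

Definition cubic_tree : Prop :=
  [/\ connected_graph, acyclic & forall x, x \notin leaves -> degree x = 3].

Definition del_edge (x y : V) : rel V :=
  [rel u v | G u v && ([set u; v] != [set x; y])].

End Graphs.

(** * Perfect matching decompositions *)

Section Decompositions.
Variables (V : finType) (G : sgraph V).

(* [delta] is a total function on the nodes of the tree; only its values on the
   leaves are meaningful. *)
Definition pm_decomposition (N : finType) (T : sgraph N) (delta : N -> V) :
    Prop :=
  [/\ cubic_tree T, {in leaves T &, injective delta}
    & delta @: leaves T = [set: V]].

(* The set X_1 of images of the leaves in the component of T - t1 t2
   containing t1. *)
Definition shore (N : finType) (T : sgraph N) (delta : N -> V) (t1 t2 : N) :
    {set V} :=
  [set delta l | l in leaves T & connect (del_edge T t1 t2) t1 l].

Definition width (N : finType) (T : sgraph N) (delta : N -> V) : nat :=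
  \max_(t : N * N | T t.1 t.2) matching_porosity G (shore T delta t.1 t.2).

Definition pmw_eq (k : nat) : Prop :=
  (exists (N : finType) (T : sgraph N) (delta : N -> V),
     pm_decomposition T delta /\ width T delta = k) /\
  (forall (N : finType) (T : sgraph N) (delta : N -> V),
     pm_decomposition T delta -> k <= width T delta).

End Decompositions.

(** * Random access machines

   Polynomial time is measured on the unit-cost RAM with addition and truncated
   subtraction.  There is no multiplication, so the numbers occurring in t steps
   have O(t + size of input) bits, and polynomial time is the same as for Turing
   machines.  The registers (of which a program names finitely many) are kept
   apart from the indirectly addressed memory, which initially holds the
   input. *)

Inductive instr :=
| Const (r c : nat)       (* r := c              *)
| Add   (r a b : nat)     (* r := a + b          *)
| Sub   (r a b : nat)     (* r := max(a - b, 0)  *)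
| Read  (r a : nat)       (* r := mem[a]         *)
| Write (a r : nat)       (* mem[a] := r         *)
| Jump  (r l : nat).      (* if r > 0 then goto l *)

Definition program := seq instr.

Record config := Config { pc : nat; reg : nat -> nat; mem : nat -> nat }.

Definition upd (f : nat -> nat) (i v : nat) : nat -> nat :=
  fun j => if j == i then v else f j.

Definition exec (i : instr) (s : config) : config :=
  let: Config p rg m := s in
  match i with
  | Const r c => Config p.+1 (upd rg r c) m
  | Add r a b => Config p.+1 (upd rg r (rg a + rg b)) m
  | Sub r a b => Config p.+1 (upd rg r (rg a - rg b)) m
  | Read r a  => Config p.+1 (upd rg r (m (rg a))) m
  | Write a r => Config p.+1 rg (upd m (rg a) (rg r))
  | Jump r l  => Config (if 0 < rg r then l else p.+1) rg m
  end.

Definition halted (P : program) (s : config) : bool := size P <= pc s.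

Definition step (P : program) (s : config) : config :=
  if onth P (pc s) is Some i then exec i s else s.

(* Register 0 holds the length of the input at the start and the length of the
   output at the end. *)
Definition init (w : seq nat) : config :=
  Config 0 (upd (fun=> 0) 0 (size w)) (nth 0 w).

Definition output (s : config) : seq nat := mkseq (mem s) (reg s 0).

Definition returns_within (P : program) (w : seq nat) (b : nat)
    (out : seq nat) : Prop :=
  exists t, [/\ t <= b, halted P (iter t (step P) (init w))
              & output (iter t (step P) (init w)) = out].

(** * Encodings *)

(* The number of vertices followed by the adjacency matrix, row by row. *)
Definition encode_graph (n : nat) (G : sgraph 'I_n) : seq nat :=
  n :: [seq nat_of_bool (G x y) | x <- enum 'I_n, y <- enum 'I_n].

Definition encode_decomposition (n m : nat) (T : sgraph 'I_m)
    (delta : 'I_m -> 'I_n) : seq nat :=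
  encode_graph T ++ [seq nat_of_ord (delta t) | t <- enum 'I_m].

Definition encodes_decomposition_of_width (n : nat) (G : sgraph 'I_n) (k : nat)
    (out : seq nat) : Prop :=
  exists (m : nat) (T : sgraph 'I_m) (delta : 'I_m -> 'I_n),
    [/\ pm_decomposition T delta, width G T delta = k
      & out = encode_decomposition T delta].

(* Main.v *)
(* Identify perfect matchings with fixed-point free involutions.  In a brace with
   colour classes A and B, a cut of porosity at most 2 with odd shores is tight,
   hence trivial; if its shores are even, then by counting and 2-extendability
   either one shore contains two more vertices of A than of B and all neighbours
   of its vertices in B, or a shore has at most two vertices.  So a decomposition of width 2
   is a caterpillar: starting from two vertices of A it repeatedly adds a vertex
   of B all of whose neighbours but one have been added, together with the
   missing neighbour.  This order can be found greedily, because adding such a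
   vertex never spoils another one.  The algorithm tries all starting pairs and,
   if some greedy order reaches all vertices, outputs the caterpillar of that
   order. *)

Require Import Defs.
From mathcomp Require Import all_boot zify.

Set Implicit Arguments.
Unset Strict Implicit.
Unset Printing Implicit Defensive.

(** * Hall's theorem *)

(** The colour classes are not part of the input, and no decomposition is ever rebuilt into a
    caterpillar. Completeness is proved for the set at which a greedy run stops: if it contains a
    suitable shore with two vertices, its closedness is pushed from shore to shore up the given tree
    until it is everything. Of the tree this uses only that complements of shores and single
    vertices are shores, and that every other shore is a disjoint union of two shores. A separate
    lower bound shows that every decomposition of a brace with at least four vertices has width at
    least 2, so width at most 2 suffices throughout; with fewer vertices the width never exceeds 1.
    Starting pairs of mixed colours could give false positives. They cannot: with more than four
    vertices all degrees are at least 3, and such a run never leaves its start. The machine program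
    is compiled from a small language whose loops all make [n] or [m = 2 n - 2] passes, [m] being
    the number of nodes of a cubic tree with [n] leaves, so polynomial running time can be read off
    the nesting depth. *)

Section Hall.
Variable V : finType.

(* Rado's argument: as long as some [N x] has two elements, one of them can be
   deleted without violating Hall's condition. *)
Lemma hall (D : {set V}) (N : V -> {set V}) :
    (forall S : {set V}, S \subset D -> #|S| <= #|\bigcup_(x in S) N x|) ->
  exists f : V -> V, {in D &, injective f} /\ {in D, forall x, f x \in N x}.
Proof.
have [k] := ubnP (\sum_(x in D) #|N x|).
elim: k N => // k IHk N ltk hN.
have [/exists_inP[x xD gt1]|small] := boolP [exists x in D, 1 < #|N x|].
  have [b1 [b2 [b1N b2N nb]]] : exists b1 b2, [/\ b1 \in N x, b2 \in N x & b1 != b2].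
    by case/card_gt1P: gt1 => b1 [b2] [? ? ?]; exists b1, b2.
  pose Nd b y := if y == x then N x :\ b else N y.
  have sub b y : Nd b y \subset N y.
    by rewrite /Nd; case: eqP => [->|//]; apply: subsetDl.
  have small b : b \in N x -> \sum_(y in D) #|Nd b y| < k.
    move=> bN; apply: leq_trans (ltk : _ <= k).
    rewrite (bigD1 x xD) [X in _ < X](bigD1 x xD) /= /Nd eqxx.
    rewrite (cardsD1 b (N x)) bN add1n addSn ltnS leq_add2l.
    by apply: leq_sum => y _; case: eqP => [->|//]; rewrite subset_leq_card ?subsetDl.
  have red b : b \in N x ->
      (forall S : {set V}, S \subset D -> #|S| <= #|\bigcup_(y in S) Nd b y|) ->
      exists f : V -> V, {in D &, injective f} /\ {in D, forall x, f x \in N x}.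
    move=> bN /(IHk _ (small _ bN)) [f [fi fN]]; exists f; split=> // y yD.
    exact: subsetP (sub b y) _ (fN y yD).
  have viol b : b \in N x ->
      (forall S : {set V}, S \subset D -> #|S| <= #|\bigcup_(y in S) Nd b y|) \/
      exists T : {set V}, [/\ T \subset D, x \notin T
        & #|(\bigcup_(y in T) N y) :|: (N x :\ b)| <= #|T|].
    move=> bN.
    have [/forallP h|/forallPn[S]] :=
      boolP [forall S : {set V}, (S \subset D) ==> (#|S| <= #|\bigcup_(y in S) Nd b y|)].
      by left=> S; apply/implyP.
    rewrite negb_imply -ltnNge => /andP[SD lt]; right.
    have xS : x \in S.
      apply: contraLR lt => xS; rewrite -leqNgt.
      rewrite (eq_bigr N) ?hN // => y yS; rewrite /Nd.
      by case: eqP yS => [->|//]; rewrite (negPf xS).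
    exists (S :\ x); split; rewrite ?setD11 ?(subset_trans _ SD) ?subsetDl //.
    rewrite (cardsD1 x S) xS add1n ltnS in lt.
    apply: leq_trans lt; apply: subset_leq_card; apply/subsetP=> w.
    rewrite (bigD1 x xS) /= {1}/Nd eqxx !inE => /orP[|->//].
    case/bigcupP=> y /setD1P[yx yS] wN; apply/orP; right.
    have /subsetP : N y \subset \bigcup_(z in S | z != x) Nd b z.
      by rewrite (bigcup_max y) ?yS // /Nd (negPf yx).
    by apply.
  case: (viol b1 b1N) => [/(red _ b1N)//|[T1 [T1D xT1 c1]]].
  case: (viol b2 b2N) => [/(red _ b2N)//|[T2 [T2D xT2 c2]]].
  (* Submodularity: [P] and [Q] are the reduced neighbourhoods of the two violating sets. Since [b1]
     and [b2] differ, the union of [P] and [Q] contains all of [N x], so Hall's condition bounds it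
     for [x] and both violators together; the intersection is bounded for their common part. The sum
     contradicts the two violations. *)
  set P := (_ :|: _) in c1; set Q := (_ :|: _) in c2.
  have hU : #|T1 :|: T2|.+1 <= #|P :|: Q|.
    have xU : x \notin T1 :|: T2 by rewrite inE negb_or xT1.
    have := hN (x |: (T1 :|: T2)); rewrite cardsU1 xU add1n => h.
    apply: leq_trans (h _) _; first by rewrite !subUset sub1set xD T1D.
    apply: subset_leq_card; apply/bigcupsP=> y; rewrite !inE.
    case/or3P=> [/eqP->|yT|yT]; apply/subsetP=> w wN; rewrite !inE.
    - rewrite wN !andbT; case: (eqVneq w b1) => [->|_]; last by rewrite orbT.
      by rewrite nb !orbT.
    - by apply/orP; left; apply/orP; left; apply/bigcupP; exists y.
    - by apply/orP; right; apply/orP; left; apply/bigcupP; exists y.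
  have hI : #|T1 :&: T2| <= #|P :&: Q|.
    apply: leq_trans (hN _ _) _; first by rewrite subIset ?T1D.
    apply: subset_leq_card; apply/bigcupsP=> y /setIP[y1 y2].
    apply/subsetP=> w wN; rewrite !inE; apply/andP; split; apply/orP; left;
    by apply/bigcupP; exists y.
  have := cardsUI T1 T2; have := cardsUI P Q; lia.
have one x : x \in D -> exists w, N x = [set w].
  move=> xD; apply/cards1P; rewrite eqn_leq.
  have := hN [set x]; rewrite sub1set xD big_set1 cards1 => -> //.
  rewrite andbT leqNgt; apply: contra small => lt.
  by apply/exists_inP; exists x.
exists (fun x => odflt x [pick w in N x]).
have val x : x \in D -> N x = [set odflt x [pick w in N x]].
  move=> xD; have [w ->] := one x xD.
  by case: pickP => [z /set1P->//|/(_ w)]; rewrite set11.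
split=> [x y xD yD eq|x xD]; last first.
  case: pickP => [//|/= h]; have [w e] := one x xD.
  by have := h w; rewrite e set11.
apply/eqP; apply: contraTT isT => ne.
have := hN [set x; y]; rewrite cards2 ne subUset !sub1set xD yD => /(_ isT).
by rewrite big_setU1 ?inE //= big_set1 (val x xD) (val y yD) eq setUid cards1.
Qed.
End Hall.

(** * Perfect matchings as involutions *)

Section Mates.
Variables (V : finType) (G : sgraph V).

(** Freedom from fixed points is implicit: [G] is irreflexive. *)
Definition mate (f : V -> V) : Prop := (forall x, G x (f x)) /\ involutive f.

(** Represents each matching edge of the cut by its end in [X], which trades sets of edges for sets
    of vertices. *)
Definition crossing (f : V -> V) (X : {set V}) : {set V} :=
  [set x in X | f x \notin X].

Definition matching_of (f : V -> V) : {set {set V}} := [set [set x; f x] | x : V].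

Lemma in_edges x y : G x y -> [set x; y] \in edges G.
Proof. by move=> Gxy; apply/imsetP; exists (x, y); rewrite ?inE. Qed.

Lemma edgesP e : reflect (exists x y, G x y /\ e = [set x; y]) (e \in edges G).
Proof.
apply: (iffP imsetP) => [[[x y]]|[x [y [Gxy ->]]]].
  by rewrite inE => Gxy ->; exists x, y.
by exists (x, y); rewrite ?inE.
Qed.

Lemma adj_neq x y : G x y -> x != y.
Proof. by apply: contraTneq => ->; rewrite (adj_irrefl G). Qed.

Lemma mate_block f x y : mate f -> x \in [set y; f y] -> [set y; f y] = [set x; f x].
Proof. by case=> _ fK /set2P[]-> //; rewrite fK setUC. Qed.

Lemma mate_perfect_matching f : mate f -> perfect_matching G (matching_of f).
Proof.
move=> fm; apply/and3P; split.
- by apply/subsetP=> e /imsetP[x _ ->]; apply/in_edges/(proj1 fm).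
- apply/trivIsetP=> e1 e2 /imsetP[x _ ->] /imsetP[y _ ->]; apply: contraR.
  case/pred0Pn=> z /andP[zx zy]; apply/eqP.
  by rewrite (mate_block fm zx) (mate_block fm zy).
- apply/eqP/setP=> x; rewrite inE; apply/bigcupP.
  by exists [set x; f x]; rewrite ?set21 //; apply/imsetP; exists x.
Qed.

Lemma perfect_matching_mate M :
  perfect_matching G M -> exists2 f, mate f & M = matching_of f.
Proof.
case/and3P=> /subsetP sub tI /eqP cov.
have ex x : exists y, ([set x; y] \in M) && G x y.
  have : x \in cover M by rewrite cov.
  case/bigcupP=> e eM xe; have /edgesP[a [b [Gab E]]] := sub e eM.
  move: xe; rewrite E => /set2P[]->; first by exists b; rewrite -E eM.
  by exists a; rewrite setUC -E eM (adj_sym G).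
pose f x := xchoose (ex x).
have fM x : [set x; f x] \in M by case/andP: (xchooseP (ex x)).
have fG x : G x (f x) by case/andP: (xchooseP (ex x)).
have eq_block x e : e \in M -> x \in e -> e = [set x; f x].
  move=> eM xe; apply/eqP; apply: contraT => ne.
  have := trivIsetP tI _ _ eM (fM x) ne => /pred0P/(_ x) /=.
  by rewrite xe set21.
have fm : mate f.
  split=> // x; have := eq_block (f x) _ (fM x) (set22 _ _).
  move/setP/(_ x); rewrite set21 => /esym/set2P[] // e.
  by have := adj_neq (fG x); rewrite -e eqxx.
exists f => //; apply/setP=> e; apply/idP/imsetP => [eM|[x _ ->]//].
have /edgesP[a [b [_ E]]] := sub e eM.
by exists a => //; apply: eq_block => //; rewrite E set21.
Qed.

Lemma card_matching_of_cut f (X : {set V}) :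
  mate f -> #|matching_of f :&: cut G X| = #|crossing f X|.
Proof.
move=> fm; rewrite -(@card_in_imset _ _ (fun x => [set x; f x])); last first.
  move=> x y; rewrite !inE => /andP[xX fx] /andP[yX fy] /setP/(_ x).
  rewrite set21 => /esym/set2P[]// e.
  by rewrite -e xX in fy.
congr #|pred_of_set _|; apply/setP=> e; rewrite inE.
have cut_pair x : [set x; f x] \in cut G X = ((x \in X) != (f x \in X)).
  rewrite inE in_edges ?(proj1 fm) //= setIUl.
  have neq := adj_neq (proj1 fm x).
  have I1 z : [set z] :&: X = if z \in X then [set z] else set0.
    by apply/setP=> w; rewrite !inE; case: ifP => h; rewrite !inE;
       case: eqP => // ->; rewrite h.
  rewrite !I1; do 2![case: ifP => _]; rewrite ?setU0 ?set0U ?cards1 ?cards0 //.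
  by rewrite cards2 neq.
apply/andP/imsetP => [[/imsetP[x _ ->]]|[x]].
  rewrite cut_pair; case xX: (x \in X); case fX: (f x \in X) => // _.
    by exists x; rewrite // inE xX fX.
  by exists (f x); rewrite ?inE ?(proj2 fm) ?xX ?fX // setUC.
rewrite inE => /andP[xX fX] ->; rewrite cut_pair xX (negPf fX).
by split=> //; apply/imsetP; exists x.
Qed.

Lemma porosity_leP (X : {set V}) k :
  matching_porosity G X <= k <-> (forall f, mate f -> #|crossing f X| <= k).
Proof.
split=> [/bigmax_leqP h f fm|h].
  by rewrite -card_matching_of_cut //; apply: h; apply: mate_perfect_matching.
apply/bigmax_leqP=> M /perfect_matching_mate[f fm ->].
by rewrite card_matching_of_cut ?h.
Qed.

(** The involution itself exchanges the two ends of the crossing edges. *)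
Lemma crossingC f (X : {set V}) : mate f -> #|crossing f (~: X)| = #|crossing f X|.
Proof.
case=> _ fK; rewrite -(card_imset _ (inv_inj fK)); congr #|pred_of_set _|.
apply/setP=> x; rewrite -{1}(fK x) mem_imset; last exact: inv_inj fK.
by rewrite !inE negbK fK andbC.
Qed.

Lemma porosityC (X : {set V}) : matching_porosity G (~: X) = matching_porosity G X.
Proof.
by apply/eqP; rewrite eqn_leq; apply/andP; split; apply/porosity_leP => f fm;
  [rewrite crossingC|rewrite -crossingC] => //; apply/porosity_leP: f fm.
Qed.

End Mates.

(** * Expansion, extendability and cuts of small porosity in braces *)

Section Brace.
Variables (V : finType) (G : sgraph V).
Hypothesis braceG : brace G.

Lemma brace_cover x y : G x y -> exists2 f, mate G f & f x = y.
Proof.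
move=> Gxy; have [_ [_ /(_ _ (in_edges Gxy))[M /perfect_matching_mate[f fm ->] eM]] _] := braceG.
case/imsetP: eM => z _ e; exists f => //.
have xz : x \in [set z; f z] by rewrite -e set21.
move: e; rewrite (mate_block fm xz) => /setP/(_ y); rewrite set22 => /esym/set2P[] // e.
by have := adj_neq Gxy; rewrite e eqxx.
Qed.

Lemma brace_not_tight (Z : {set V}) : 1 < #|Z| -> 1 < #|~: Z| ->
  (forall f, mate G f -> #|crossing f Z| = 1) -> False.
Proof.
move=> Z1 Z2 h; have [_ _ /(_ Z (conj Z1 Z2))] := braceG; apply.
by move=> M /perfect_matching_mate[f fm ->]; rewrite card_matching_of_cut ?h.
Qed.

(** Connectedness provides an edge leaving [X], and some perfect matching contains that edge. *)
Lemma brace_cut_edge (X : {set V}) : X != set0 -> ~: X != set0 ->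
  exists f x, [/\ mate G f, x \in X & f x \notin X].
Proof.
case/set0Pn=> x xX /set0Pn[y]; rewrite inE => yX.
have [_ [[_ conn] _] _] := braceG.
have /existsP[a /existsP[b /and3P[Gab aX bX]]] :
    [exists a, exists b, [&& G a b, a \in X & b \notin X]].
  apply: contraT => /existsPn no.
  case/connectP: (conn x y) => p.
  elim: p x xX => [|z p IH] x xX /=; first by move=> _ e; rewrite e xX in yX.
  case/andP=> Gxz /IH; apply; apply: contraT => zX.
  by have /existsPn/(_ z) := no x; rewrite Gxz xX zX.
by have [f fm fa] := brace_cover Gab; exists f, a; rewrite fa.
Qed.

Definition neighbours (S : {set V}) : {set V} := [set y | [exists x in S, G x y]].

Lemma mem_neighbours (S : {set V}) x y : x \in S -> G x y -> y \in neighbours S.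
Proof. by move=> xS Gxy; rewrite inE; apply/exists_inP; exists x. Qed.

Section Side.
Variable A : {set V}.
Hypothesis bip : forall x y, G x y -> (x \in A) != (y \in A).

Definition plus (X : {set V}) : Prop :=
  #|X :&: A| = #|X :\: A| + 2 /\
  (forall b a, b \in X -> b \notin A -> G b a -> a \in X).

Lemma bip_mate f x : mate G f -> (f x \in A) = (x \notin A).
Proof. by case=> fG _; have := bip (fG x); do 2!case: (_ \in A). Qed.

(** Pairs matched inside [X] use one vertex of each colour, so the colour surplus of [X] is that of
    its crossing vertices. *)
Lemma crossing_balance f (X : {set V}) : mate G f ->
  #|X :&: A| + #|crossing f X :\: A| = #|X :\: A| + #|crossing f X :&: A|.
Proof.
move=> fm; have fi := inv_inj (proj2 fm).
have e : #|[set x in X :&: A | f x \in X]| = #|[set x in X :\: A | f x \in X]|.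
  rewrite -(card_imset _ fi); congr #|pred_of_set _|; apply/setP=> x.
  rewrite -{1}(proj2 fm x) mem_imset // !inE (proj2 fm) bip_mate //.
  by case: (x \in A); case: (x \in X); case: (f x \in X).
rewrite -(cardsID [set x | f x \in X] (X :&: A)).
rewrite -(cardsID [set x | f x \in X] (X :\: A)).
have -> : X :&: A :&: [set x | f x \in X] = [set x in X :&: A | f x \in X].
  by apply/setP=> x; rewrite !inE.
have -> : (X :\: A) :&: [set x | f x \in X] = [set x in X :\: A | f x \in X].
  by apply/setP=> x; rewrite !inE.
have -> : (X :&: A) :\: [set x | f x \in X] = crossing f X :&: A.
  by apply/setP=> x; rewrite !inE; case: (x \in X); case: (x \in A); case: (f x \in X).
have -> : (X :\: A) :\: [set x | f x \in X] = crossing f X :\: A.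
  by apply/setP=> x; rewrite !inE; case: (x \in X); case: (x \in A); case: (f x \in X).
lia.
Qed.

(** No vertex outside [A] can be matched out of [X], so the crossing vertices make up exactly the
    surplus. *)
Lemma plus_crossing X f : plus X -> mate G f -> #|crossing f X| = 2.
Proof.
case=> cX nX fm; have := crossing_balance X fm.
have -> : crossing f X :\: A = set0.
  apply/setP=> b; rewrite !inE; apply/negP=> /and3P[bA bX].
  by rewrite (nX b) // (proj1 fm).
rewrite cards0 addn0 cX => /addnI e.
rewrite -(cardsID A (crossing f X)) -e.
have -> // : crossing f X :\: A = set0.
apply/setP=> b; rewrite !inE; apply/negP=> /and3P[bA bX].
by rewrite (nX b) // (proj1 fm).
by rewrite cards0.
Qed.

Lemma card_sides : 1 < #|V| -> #|A| = #|~: A|.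
Proof.
case/card_gt1P=> x [y [_ _ ne]].
have [||f [z [fm _ _]]] := @brace_cut_edge [set x].
- by apply/set0Pn; exists x; rewrite set11.
- by apply/set0Pn; exists y; rewrite !inE eq_sym.
have := crossing_balance [set: V] fm.
have -> : crossing f [set: V] = set0 by apply/setP=> w; rewrite !inE.
by rewrite setTI setTD set0D set0I cards0 !addn0.
Qed.

Lemma neighbours_side (S : {set V}) : S \subset A -> neighbours S \subset ~: A.
Proof.
move=> /subsetP SA; apply/subsetP=> y; rewrite !inE => /exists_inP[x /SA xA].
by move/bip; rewrite xA.
Qed.

(** Vertices of [S] are matched to neighbours of [S], so only neighbours cross. The number of
    crossing edges is thus the same for all perfect matchings, which turns a surplus of one into a
    tight cut. *)
Lemma crossing_neighbours (S : {set V}) f : S \subset A -> mate G f ->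
  #|S| + #|crossing f (S :|: neighbours S)| = #|neighbours S|.
Proof.
move=> SA fm; have NA := neighbours_side SA.
have ZA : (S :|: neighbours S) :&: A = S.
  apply/setP=> x; rewrite 2!inE; case xS: (x \in S); first by rewrite (subsetP SA).
  by apply/negP=> /andP[/(subsetP NA)]; rewrite inE => /negP.
have ZB : (S :|: neighbours S) :\: A = neighbours S.
  apply/setP=> x; rewrite 2!inE; case xN: (x \in neighbours S).
    by have := subsetP NA _ xN; rewrite inE orbT andbT.
  by rewrite orbF; apply/negP=> /andP[/negP h /(subsetP SA)].
have := crossing_balance (S :|: neighbours S) fm; rewrite ZA ZB.
set C := crossing _ _.
have CA : C :&: A = set0.
  apply/setP=> x; rewrite in_set0; apply/negP; rewrite inE => /andP[xC xA].
  have xS : x \in S.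
    by rewrite -ZA inE xA andbT; move: xC; rewrite inE => /andP[].
  move: xC; rewrite inE => /andP[_]; rewrite inE negb_or => /andP[_ /negP]; apply.
  exact: mem_neighbours xS (proj1 fm x).
by rewrite CA cards0 addn0 -(cardsID A C) CA cards0 add0n.
Qed.

Lemma expand1 (S : {set V}) : S \subset A -> S != set0 -> S != A -> #|S| < #|neighbours S|.
Proof.
move=> SA S0 SnA; have [a aA aS] : exists2 a, a \in A & a \notin S.
  by apply/subsetPn; apply: contra SnA => AS; rewrite eqEsubset SA.
have [||f [x [fm xZ fxZ]]] := @brace_cut_edge (S :|: neighbours S).
- by case/set0Pn: S0 => s sS; apply/set0Pn; exists s; rewrite inE sS.
- apply/set0Pn; exists a; rewrite 2!inE negb_or aS; apply/negP.
  by move/(subsetP (neighbours_side SA)); rewrite inE aA.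
rewrite -(crossing_neighbours SA fm) -addn1 leq_add2l card_gt0.
by apply/set0Pn; exists x; rewrite inE xZ.
Qed.

(** A surplus of exactly one would make the cut around [S] and its neighbours tight. That cut is
    nontrivial, because two vertices of [A] remain outside. *)
Lemma expand2 (S : {set V}) :
  S \subset A -> S != set0 -> #|S| + 2 <= #|A| -> #|S| + 2 <= #|neighbours S|.
Proof.
move=> SA S0 le2; have SnA : S != A by apply: contraTneq le2 => ->; lia.
have lt := expand1 SA S0 SnA; rewrite leqNgt; apply/negP=> lt2.
have e : #|neighbours S| = #|S| + 1 by lia.
apply: (@brace_not_tight (S :|: neighbours S)).
- have /subset_leq_card : neighbours S \subset S :|: neighbours S by apply: subsetUr.
  by move: S0; rewrite -card_gt0; lia.
- have : A :\: S \subset ~: (S :|: neighbours S).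
    apply/subsetP=> a; rewrite in_setD in_setC in_setU => /andP[/negPf-> aA] /=; apply/negP.
    by move/(subsetP (neighbours_side SA)); rewrite inE aA.
  by move/subset_leq_card; rewrite cardsD (setIidPr SA); lia.
- by move=> f fm; have := crossing_neighbours SA fm; lia.
Qed.

Lemma mate_of_injection (g : V -> V) : #|A| = #|~: A| -> {in A &, injective g} ->
  {in A, forall x, G x (g x)} -> exists2 f, mate G f & {in A, f =1 g}.
Proof.
move=> cA gi gG.
have gA : g @: A = ~: A.
  apply/eqP; rewrite eqEcard card_in_imset // cA leqnn andbT.
  by apply/subsetP=> _ /imsetP[x xA ->]; rewrite inE; have := bip (gG x xA); rewrite xA.
have gN x : x \in A -> g x \notin A by move=> xA; rewrite -in_setC -gA imset_f.
pose f x := if x \in A then g x else odflt x [pick a in A | g a == x].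
have fN x : x \notin A -> f x \in A /\ g (f x) = x.
  move=> xA; rewrite /f (negPf xA); case: pickP => [a /andP[? /eqP]//|no].
  have /imsetP[a aA e] : x \in g @: A by rewrite gA inE.
  by have := no a; rewrite aA e eqxx.
exists f => [|x xA]; last by rewrite /f xA.
split=> x; case: (boolP (x \in A)) => xA.
- by rewrite /f xA gG.
- by have [h e] := fN x xA; rewrite (adj_sym G) -{2}e gG.
- have [h e] : f (f x) \in A /\ g (f (f x)) = f x.
    by apply: fN; rewrite /f xA gN.
  by apply: gi => //; rewrite e /f xA.
- by have [h e] := fN x xA; rewrite {1}/f h e.
Qed.

(** Removing [b1] and [b2] costs a set at most two neighbours, which is the surplus given by
    [expand2], so Hall's condition survives for the rest of [A]. *)
Lemma two_extendable a1 a2 b1 b2 : a1 \in A -> a2 \in A -> a1 != a2 -> b1 != b2 ->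
  G a1 b1 -> G a2 b2 -> exists f, [/\ mate G f, f a1 = b1 & f a2 = b2].
Proof.
move=> a1A a2A a12 b12 G1 G2.
have cA : #|A| = #|~: A|.
  by apply: card_sides; apply/card_gt1P; exists a1, a2.
pose D := A :\: [set a1; a2].
have cD : #|D| + 2 = #|A|.
  rewrite cardsD; have /setIidPr -> : [set a1; a2] \subset A.
    by rewrite subUset !sub1set a1A.
  rewrite cards2 a12; have : [set a1; a2] \subset A by rewrite subUset !sub1set a1A.
  by move/subset_leq_card; rewrite cards2 a12; lia.
pose N x := [set y | G x y] :\: [set b1; b2].
have [S SD|g [gi gN]] := @hall _ D N.
  have [->|S0] := eqVneq S set0; first by rewrite cards0.
  have SA : S \subset A by apply: subset_trans SD (subsetDl _ _).
  have := expand2 SA S0; have /subset_leq_card := SD => le; rewrite -cD leq_add2r.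
  move=> /(_ le) le2.
  have : neighbours S \subset [set b1; b2] :|: \bigcup_(x in S) N x.
    apply/subsetP=> y; rewrite inE => /exists_inP[x xS Gxy].
    rewrite in_setU; case yb: (y \in [set b1; b2]) => //=.
    by apply/bigcupP; exists x; rewrite // inE yb inE.
  move/subset_leq_card; have := leq_card_setU [set b1; b2] (\bigcup_(x in S) N x).
  by case=> + _; rewrite cards2 b12; lia.
pose h x := if x == a1 then b1 else if x == a2 then b2 else g x.
have hD x : x \in A -> [\/ x = a1 /\ h x = b1, x = a2 /\ h x = b2
    | [/\ x \in D, h x = g x, h x != b1, h x != b2 & G x (h x)]].
  move=> xA; rewrite /h; case: eqP => [|n1]; first by move=> ->; apply: Or31.
  case: eqP => [|n2]; first by move=> ->; apply: Or32.
  have xD : x \in D by rewrite !inE xA andbT; apply/norP; split; apply/eqP.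
  have /andP[/andP[? ?] ?] : (g x != b1) && (g x != b2) && G x (g x).
    by have := gN x xD; rewrite !inE negb_or.
  by apply: Or33.
have [||f fm fh] := mate_of_injection (g := h) cA.
- move=> x y xA yA.
  case: (hD x xA) => [[-> ->]|[-> ->]|[xD hx n1 n2 _]];
  case: (hD y yA) => [[-> ->]|[-> ->]|[yD hy m1 m2 _]] // e;
  try (by move: b12; rewrite e eqxx); try (by move: m1; rewrite -e eqxx);
  try (by move: m2; rewrite -e eqxx); try (by move: n1; rewrite e eqxx);
  try (by move: n2; rewrite e eqxx).
  by apply: gi => //; rewrite -hx -hy.
- by move=> x /hD[[-> ->]|[-> ->]|[]].
by exists f; rewrite !fh // /h eqxx eq_sym (negPf a12) eqxx.
Qed.

(** A subset of [X :&: A] that misses at most one vertex has, by [expand2] and balance, more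
    neighbours than [X :\: A] can hold. Used twice, this gives two edges leaving [X] with distinct
    ends in [A]; only their outer ends may coincide. *)
Lemma two_crossing_edges (X : {set V}) :
    #|X :&: A| = #|X :\: A| -> 2 < #|X| -> 2 < #|~: X| ->
  exists a1 a2 b1 b2, [/\ a1 \in X :&: A, a2 \in X :&: A, a1 != a2, b1 != b2
    & [/\ b1 \notin X, b2 \notin X, G a1 b1 & G a2 b2]].
Proof.
move=> bal X2 CX2; have V1 : 1 < #|V| by have := max_card X; lia.
have cA := card_sides V1.
have cX := cardsID A X; have cCX := cardsID A (~: X).
have cAX := cardsID X A; have cBX := cardsID X (~: A).
have e1 : ~: X :&: A = A :\: X by apply/setP=> z; rewrite !inE andbC.
have e2 : ~: A :&: X = X :\: A by apply/setP=> z; rewrite !inE andbC.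
have e3 : ~: X :\: A = ~: A :\: X by apply/setP=> z; rewrite !inE andbC.
rewrite e1 e3 in cCX; rewrite e2 in cBX; rewrite [A :&: X]setIC in cAX.
set P := X :&: A in bal cX cAX *.
have PA : P \subset A by apply: subsetIr.
have nbr (S : {set V}) : S \subset P -> S != set0 -> #|P| < #|S| + 2 ->
    exists a b, [/\ a \in S, b \notin X & G a b].
  move=> SP S0 lt; have SA := subset_trans SP PA.
  have le : #|S| + 2 <= #|A| by have := subset_leq_card SP; lia.
  have [b bN bX] : exists2 b, b \in neighbours S & b \notin X :\: A.
    apply/subsetPn/negP=> /subset_leq_card; rewrite -bal.
    by have := expand2 SA S0 le; lia.
  have bX' : b \notin X.
    apply: contra bX; have := subsetP (neighbours_side SA) _ bN.
    by rewrite !inE => -> ->.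
  by move: bN; rewrite inE => /exists_inP[a aS Gab]; exists a, b.
have P0 : P != set0 by rewrite -card_gt0; lia.
have [a1 [b1 [a1P b1X G1]]] : exists a b, [/\ a \in P, b \notin X & G a b].
  by apply: nbr => //; lia.
have [|||a' [b' [a'P b'X G']]] := nbr (P :\ a1).
- exact: subsetDl.
- by rewrite -card_gt0; have := cardsD1 a1 P; rewrite a1P; lia.
- by have := cardsD1 a1 P; rewrite a1P; lia.
case/setD1P: a'P => na' a'P.
have [nb|eb] := eqVneq b1 b'; last first.
  by exists a1, a', b1, b'; split=> //; rewrite eq_sym.
(* Both edges end in [b1]. The whole of [P] has at least two neighbours more than [X :\: A] has
   vertices, hence one outside [X] other than [b1]; its partner in [P] differs from [a1] or from
   [a']. *)
have [b2 [a2 [a2P b2X G2 nb2]]] :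
    exists b2 a2, [/\ a2 \in P, b2 \notin X, G a2 b2 & b1 != b2].
  have le : #|P| + 2 <= #|A| by lia.
  have : ~~ (neighbours P \subset b1 |: (X :\: A)).
    apply/negP=> /subset_leq_card; have := cardsU1 b1 (X :\: A).
    by have := expand2 PA P0 le; case: (_ \notin _); lia.
  case/subsetPn=> b2 b2N; rewrite in_setU1 negb_or => /andP[n2 b2X].
  have b2X' : b2 \notin X.
    apply: contra b2X; have := subsetP (neighbours_side PA) _ b2N.
    by rewrite !inE => -> ->.
  move: b2N; rewrite inE => /exists_inP[a2 a2P G2].
  by exists b2, a2; rewrite eq_sym.
have [e|n] := eqVneq a2 a'.
  by exists a1, a2, b1, b2; split=> //; rewrite e eq_sym.
by exists a', a2, b1, b2; split=> //; rewrite 1?eq_sym // nb.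
Qed.

(** A single perfect matching bounds the surplus by two, and parity leaves 2, -2 and 0. With surplus
    two, an edge leaving from the minority colour extends to a matching with at least four
    crossings. With surplus zero, two disjoint edges leaving from [A] extend to a matching, and
    balance adds two crossings from the other colour. *)
Lemma even_shore (X : {set V}) :
    (forall f, mate G f -> #|crossing f X| <= 2) -> ~~ odd #|X| -> 1 < #|V| ->
  [\/ plus X, plus (~: X)
    | #|X :&: A| = #|X :\: A| /\ (#|X| <= 2 \/ #|~: X| <= 2)].
Proof.
move=> por ev V1; have cA := card_sides V1.
have cX := cardsID A X; have cCX := cardsID A (~: X).
have cAX := cardsID X A; have cBX := cardsID X (~: A).
have e1 : ~: X :&: A = A :\: X by apply/setP=> z; rewrite !inE andbC.
have e2 : ~: A :&: X = X :\: A by apply/setP=> z; rewrite !inE andbC.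
have e3 : ~: X :\: A = ~: A :\: X by apply/setP=> z; rewrite !inE andbC.
rewrite e2 in cBX; rewrite [A :&: X]setIC in cAX.
have out f : mate G f -> [/\ #|crossing f X :&: A| + #|crossing f X :\: A| <= 2
    & #|X :&: A| + #|crossing f X :\: A| = #|X :\: A| + #|crossing f X :&: A|].
  by move=> fm; rewrite cardsID por // crossing_balance.
have [f0 fm0] : exists f, mate G f.
  case/card_gt1P: V1 => x [y [_ _ ne]].
  have [||f [z [fm _ _]]] := @brace_cut_edge [set x]; last by exists f.
  - by apply/set0Pn; exists x; rewrite set11.
  - by apply/set0Pn; exists y; rewrite !inE eq_sym.
have [o1 o2] := out f0 fm0.
have : [\/ #|X :&: A| = #|X :\: A| + 2, #|X :\: A| = #|X :&: A| + 2
         | #|X :&: A| = #|X :\: A|].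
  have [//|] : [\/ #|X :&: A| = #|X :\: A| + 2, #|X :\: A| = #|X :&: A| + 2
         | #|X :&: A| = #|X :\: A|] \/ (#|X :&: A| + 1 = #|X :\: A| \/ #|X :&: A| = #|X :\: A| + 1).
    case: (ltngtP #|X :&: A| #|X :\: A|) => [lt|lt|e].
    - have [e|ne] := eqVneq #|X :\: A| (#|X :&: A| + 2); first by left; apply: Or32.
      by right; left; lia.
    - have [e|ne] := eqVneq #|X :&: A| (#|X :\: A| + 2); first by left; apply: Or31.
      by right; right; lia.
    - by left; apply: Or33.
  by lia.
case=> h.
- apply: Or31; split=> // b a bX bA Gba; apply: contraT => aX.
  have [f fm fb] := brace_cover Gba; have [o3 o4] := out f fm.
  have : 0 < #|crossing f X :\: A|.
    by rewrite card_gt0; apply/set0Pn; exists b; rewrite !inE bX bA fb.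
  by lia.
- apply: Or32; split=> [|b a]; first by rewrite e1 e3; lia.
  rewrite !inE => bX bA Gba; apply/negP=> aX.
  have Gab : G a b by rewrite (adj_sym G).
  have aA : a \in A by have := bip Gab; rewrite (negPf bA); case: (a \in A).
  have [f fm fb] := brace_cover Gab; have [o3 o4] := out f fm.
  have : 0 < #|crossing f X :&: A|.
    by rewrite card_gt0; apply/set0Pn; exists a; rewrite !inE aX aA fb bX.
  by lia.
- apply: Or33; split=> //.
  case: (leqP #|X| 2) => [|X2]; [by left | case: (leqP #|~: X| 2) => [|CX2]; [by right|]].
  have [a1 [a2 [b1 [b2 [/setIP[a1X a1A] /setIP[a2X a2A] na nb [b1X b2X G1 G2]]]]]] :=
    two_crossing_edges h X2 CX2.
  have [f [fm f1 f2]] := two_extendable a1A a2A na nb G1 G2.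
  have [o3 o4] := out f fm.
  have : [set a1; a2] \subset crossing f X :&: A.
    by rewrite subUset !sub1set !inE a1X a2X a1A a2A f1 f2 b1X b2X.
  by move/subset_leq_card; rewrite cards2 na; lia.
Qed.

End Side.

Lemma odd_crossing (X : {set V}) f : mate G f -> odd #|crossing f X| = odd #|X|.
Proof.
have [[A bip] _ _] := braceG => fm; have := crossing_balance bip X fm.
have := cardsID A X; have := cardsID A (crossing f X); lia.
Qed.

Lemma odd_shore (X : {set V}) :
    (forall f, mate G f -> #|crossing f X| <= 2) -> odd #|X| ->
  #|X| <= 1 \/ #|~: X| <= 1.
Proof.
move=> por oX; case: (leqP #|X| 1) => [|X1]; [by left|right].
rewrite leqNgt; apply/negP=> CX1; apply: (brace_not_tight X1 CX1) => f fm.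
by have := por f fm; have := odd_crossing X fm; rewrite oX; case: #|_| => [|[|[|]]].
Qed.

(** By parity, porosity at most one means that all matchings cross once, a tight cut, or that none
    crosses at all. This is the source of the lower bound on the width. *)
Lemma porosity_ge2 (X : {set V}) :
  1 < #|X| -> 1 < #|~: X| -> 1 < matching_porosity G X.
Proof.
move=> X1 CX1; rewrite ltnNge; apply/negP=> /porosity_leP por.
have [||f [x [fm xX fx]]] := @brace_cut_edge X.
- by rewrite -card_gt0; lia.
- by rewrite -card_gt0; lia.
have : 0 < #|crossing f X|.
  by rewrite card_gt0; apply/set0Pn; exists x; rewrite inE xX.
case oX: (odd #|X|); last by have := odd_crossing X fm; have := por f fm; rewrite oX; lia.
move=> _; apply: (brace_not_tight X1 CX1) => g gm.
by have := odd_crossing X gm; have := por g gm; rewrite oX; lia.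
Qed.

End Brace.

(** * Shores of tree edges *)

Section Tree.
Variables (N : finType) (T : sgraph N).
Hypotheses (Tconn : connected_graph T) (Tacyc : acyclic T).

Definition branch (s t : N) : {set N} := [set l | connect (del_edge T s t) s l].

Lemma del_edge_sym s t : symmetric (del_edge T s t).
Proof. by move=> u v; rewrite /del_edge /= (adj_sym T) [[set u; v]]setUC. Qed.

Lemma connect_del_sym s t : connect_sym (del_edge T s t).
Proof. exact: sym_connect_sym (@del_edge_sym s t). Qed.

Lemma connect_del_edgeC s t : connect (del_edge T t s) =2 connect (del_edge T s t).
Proof. by apply: eq_connect => u v; rewrite /del_edge /= [[set t; s]]setUC. Qed.

Lemma mem_branch s t : s \in branch s t.
Proof. by rewrite inE connect0. Qed.

(** Every edge of an acyclic graph is a bridge: a simple detour closes up with the edge to a cycle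
    with at least three nodes. *)
Lemma no_bypass s t : T s t -> ~~ connect (del_edge T s t) s t.
Proof.
move=> Tst; apply/negP=> /connectP[p0 /shortenP[p pp up _] e].
have sub : path T s p by apply: sub_path pp => u v /andP[].
case: p pp up e sub => [|z [|w p]] pp up /= e sub.
- by have := adj_neq Tst; rewrite e eqxx.
- by move: pp; rewrite e /= /del_edge /= eqxx andbF.
have /negP := Tacyc (c := [:: s, z, w & p]) isT up; apply.
by rewrite /cycle rcons_path /= -e (adj_sym T t) Tst; case/and3P: sub => -> -> ->.
Qed.

Lemma branch_disjoint s t l : T s t -> l \in branch s t -> l \notin branch t s.
Proof.
move=> Tst; rewrite !inE (connect_del_edgeC s t) => sl; apply/negP=> tl.
move/negP: (no_bypass Tst); apply; apply: connect_trans sl _.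
by rewrite connect_del_sym.
Qed.

Lemma branchC s t : T s t -> branch t s = ~: branch s t.
Proof.
move=> Tst; apply/setP=> l; rewrite in_setC; apply/idP/idP.
  by rewrite (adj_sym T) in Tst; apply: branch_disjoint.
suff : l \in branch s t :|: branch t s by rewrite inE => /orP[->|].
have sB : s \in branch s t :|: branch t s by rewrite inE mem_branch.
suff walk p u : u \in branch s t :|: branch t s -> path T u p ->
    last u p \in branch s t :|: branch t s.
  by case: Tconn => _ /(_ s l) /connectP[p pp ->]; apply: walk.
elim: p u => [|v p IH] u uB //= /andP[Tuv]; apply: IH.
have [e|ne] := eqVneq [set u; v] [set s; t].
  have : v \in [set s; t] by rewrite -e set22.
  by case/set2P=> ->; rewrite inE mem_branch ?orbT.
have uv : del_edge T s t u v by rewrite /del_edge /= Tuv.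
case/setUP: uB; rewrite !inE !(connect_del_edgeC s t) => h.
  by rewrite (connect_trans h (connect1 uv)).
by rewrite (connect_trans h (connect1 uv)) orbT.
Qed.

(** A walk in the branch of [p] never meets [t], since [p t] is a bridge, so it avoids the edge
    [t s] as well. *)
Lemma sub_branch s t p : T s t -> T p t -> p != s -> branch p t \subset branch t s.
Proof.
move=> Tst Tpt ps; apply/subsetP=> l; rewrite !inE.
case/connectP=> q pq ->; apply: (@connect_trans _ _ p).
  apply: connect1; rewrite /del_edge /= (adj_sym T) Tpt /=.
  apply: contraNneq ps => e; have : p \in [set t; s] by rewrite -e set22.
  by case/set2P=> [pt|->//]; have := adj_neq Tpt; rewrite pt eqxx.
have av u : u \in branch p t -> u != t.
  by apply: contraTneq => ->; rewrite inE no_bypass.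
suff walk u : u \in branch p t -> path (del_edge T p t) u q ->
    connect (del_edge T t s) u (last u q).
  by apply: walk pq; apply: mem_branch.
elim: q u {pq} => [|v q IH] u uB //= /andP[uv pq].
have vB : v \in branch p t.
  by move: uB; rewrite !inE => h; apply: connect_trans h (connect1 uv).
apply: connect_trans (IH v vB pq); apply: connect1.
case/andP: uv => Tuv _; rewrite /del_edge /= Tuv /=.
apply: contraTneq (set21 t s) => <-; rewrite !inE negb_or.
by rewrite ![t == _]eq_sym !av.
Qed.

Lemma branch_split s t l : T s t -> l \in branch t s -> l != t ->
  exists p, [/\ T p t, p != s & l \in branch p t].
Proof.
move=> Tst; rewrite inE => /connectP[q0 /shortenP[q pq uq _] ->].
case: q pq uq => [|p q] /=; first by rewrite eqxx.
case/andP=> /andP[Ttp ne] pq /and3P[tq _ _] _.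
exists p; split; first by rewrite (adj_sym T).
  by apply: contraNneq ne => ->.
rewrite inE; apply/connectP; exists q => //.
apply: (@sub_in_path _ (predC1 t) (del_edge T t s)) pq.
  move=> u v ut vt /andP[Tuv _]; rewrite /del_edge /= Tuv /=.
  apply: contraTneq (set22 p t) => <-; rewrite !inE negb_or.
  by rewrite ![t == _]eq_sym; apply/andP.
by apply/allP=> u up; apply: contraNneq tq => <-.
Qed.

Lemma branch_leaf s t : T s t -> t \in leaves T -> branch t s = [set t].
Proof.
move=> Tst; rewrite inE => /cards1P[u eu].
apply/setP=> l; rewrite inE; have [->|nl] := eqVneq l t; first by rewrite mem_branch.
apply/negP=> lB; have [p [Tpt ps _]] := branch_split Tst lB nl.
have : p \in [set y | T t y] by rewrite inE (adj_sym T).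
have : s \in [set y | T t y] by rewrite inE (adj_sym T).
by rewrite eu !inE => /eqP es /eqP ep; rewrite es ep eqxx in ps.
Qed.

Lemma branch_node s t p q : [set y | T t y] = [set s; p; q] -> uniq [:: s; p; q] ->
  branch t s = t |: (branch p t :|: branch q t) /\ [disjoint branch p t & branch q t].
Proof.
move=> e; rewrite /= !inE !andbT negb_or => /andP[/andP[sp sq] pq].
have nb y : T y t = (y \in [set s; p; q]) by rewrite -e inE (adj_sym T).
have Ts : T s t by rewrite nb !inE eqxx.
have Tp : T p t by rewrite nb !inE eqxx orbT.
have Tq : T q t by rewrite nb !inE eqxx orbT.
split.
  apply/setP=> l; rewrite in_setU1 in_setU; apply/idP/idP.
    move=> lB; have [//|nl] := eqVneq l t.
    have [y []] := branch_split Ts lB nl; rewrite nb !inE.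
    by case/orP=> [/orP[]|] /eqP-> //=; rewrite ?eqxx // => _ ->; rewrite ?orbT.
  case/or3P=> [/eqP->|h|h]; first exact: mem_branch.
  - by apply: subsetP h; apply: sub_branch; rewrite // eq_sym.
  - by apply: subsetP h; apply: sub_branch; rewrite // eq_sym.
rewrite disjoint_subset; apply/subsetP=> l lp; rewrite inE; apply/negP=> lq.
have := branch_disjoint Tp lp; rewrite (subsetP (sub_branch Tp Tq _)) //.
by rewrite eq_sym.
Qed.

End Tree.

(** * Shores of a decomposition, moved from nodes to vertices *)

Section Shores.
Variables (V N : finType) (T : sgraph N) (delta : N -> V).
Hypothesis dec : pm_decomposition T delta.

Let Tconn : connected_graph T. Proof. by case: dec => -[]. Qed.
Let Tacyc : acyclic T. Proof. by case: dec => -[]. Qed.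

Lemma shoreE s t : shore T delta s t = delta @: (leaves T :&: branch T s t).
Proof.
by apply/setP=> v; apply/imsetP/imsetP => -[l lB ->]; exists l => //; move: lB; rewrite !inE.
Qed.

Lemma mem_shore s t l : l \in leaves T ->
  (delta l \in shore T delta s t) = (l \in branch T s t).
Proof.
move=> lL; case: dec => _ di _; rewrite shoreE; apply/imsetP/idP.
  by case=> l' /setIP[l'L l'B] /(di _ _ lL l'L)->.
by move=> lB; exists l => //; rewrite inE lL.
Qed.

Lemma delta_surj v : exists2 l, l \in leaves T & v = delta l.
Proof. by case: dec => _ _ /setP/(_ v); rewrite inE => /imsetP[l]; exists l. Qed.

Lemma shoreC s t : T s t -> shore T delta t s = ~: shore T delta s t.
Proof.
move=> Tst; apply/setP=> v; have [l lL ->] := delta_surj v.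
by rewrite inE !mem_shore // branchC // inE.
Qed.

Lemma shore_leaf s t : T s t -> t \in leaves T -> shore T delta t s = [set delta t].
Proof.
move=> Tst tL; rewrite shoreE branch_leaf //.
have -> : leaves T :&: [set t] = [set t].
  by apply/setP=> x; rewrite in_setI in_set1; case: eqP => [->|_]; rewrite ?tL ?andbF.
by rewrite imset_set1.
Qed.

Lemma shore_node s t p q : [set y | T t y] = [set s; p; q] -> uniq [:: s; p; q] ->
  shore T delta t s = shore T delta p t :|: shore T delta q t /\
  [disjoint shore T delta p t & shore T delta q t].
Proof.
move=> e un; have [B D] := branch_node Tacyc e un.
have tL : t \notin leaves T.
  move: un; rewrite /= !inE !andbT negb_or => /andP[/andP[sp sq] pq].
  have : #|[set s; p; q]| = 3.
    by rewrite -setUA cardsU1 !inE negb_or sp sq cards2 pq.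
  by move=> c3; rewrite /degree e c3.
split.
  apply/setP=> v; have [l lL ->] := delta_surj v.
  rewrite in_setU !mem_shore // B in_setU1 in_setU.
  by case: eqP => // el; rewrite -el lL in tL.
rewrite disjoint_subset; apply/subsetP=> v; have [l lL ->] := delta_surj v.
rewrite inE /= !mem_shore // => lp; apply/negP=> lq.
by move/pred0P/(_ l): D; rewrite /= lp lq.
Qed.

Lemma three_neighbours s t : T s t -> t \notin leaves T ->
  exists p q, [set y | T t y] = [set s; p; q] /\ uniq [:: s; p; q].
Proof.
move=> Tst tL; have [[_ _ /(_ t tL) d3] _ _] := dec.
have sN : s \in [set y | T t y] by rewrite inE (adj_sym T).
have /cards2P[p [q [pq e]]] : #|[set y | T t y] :\ s| == 2.
  by have := cardsD1 s [set y | T t y]; rewrite sN -/(degree T t) d3; lia.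
exists p, q; split; first by rewrite -(setD1K sN) e setUA.
have pN : p \in [set y | T t y] :\ s by rewrite e set21.
have qN : q \in [set y | T t y] :\ s by rewrite e set22.
case/setD1P: pN => ps _; case/setD1P: qN => qs _.
by rewrite /= !inE !andbT negb_or eq_sym ps eq_sym qs.
Qed.

(** Descends into a branch behind [t], which is smaller because it misses [t], until a leaf is
    reached. *)
Lemma shore_neq0 s t : T s t -> shore T delta t s != set0.
Proof.
have [k] := ubnP #|branch T t s|; elim: k s t => // k IH s t lt Tst.
have [tL|tL] := boolP (t \in leaves T).
  by rewrite shore_leaf //; apply/set0Pn; exists (delta t); rewrite set11.
have [p [q [e un]]] := three_neighbours Tst tL.
have [-> _] := shore_node e un; have [B _] := branch_node Tacyc e un.
have Ttp : T t p by have /setP/(_ p) := e; rewrite !inE eqxx orbT.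
have /set0Pn[v vp] : shore T delta p t != set0.
  apply: IH => //; rewrite ltnS in lt; apply: leq_trans lt; apply: proper_card.
  rewrite properE B subsetU ?subsetUl ?orbT //=; apply/subsetPn; exists t.
    by rewrite in_setU1 eqxx.
  by rewrite (adj_sym T) in Ttp; rewrite inE no_bypass.
by apply/set0Pn; exists v; rewrite inE vp.
Qed.

(** Forgets the tree edge, so that later arguments can move through the tree by set operations
    alone. *)
Definition is_shore (X : {set V}) : Prop := exists s t, T s t /\ X = shore T delta t s.

Lemma is_shoreC X : is_shore X -> is_shore (~: X).
Proof.
case=> s [t [Tst ->]]; exists t, s; rewrite (adj_sym T) Tst; split=> //.
by rewrite [in RHS]shoreC ?setCK // (adj_sym T).
Qed.

(** Behind a leaf there is one vertex, behind an inner node there are two further branches. Every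
    descent or climb through the tree is a step of this kind. *)
Lemma is_shore_split X : is_shore X ->
  (exists v, X = [set v]) \/
  exists Y Z, [/\ is_shore Y, is_shore Z, X = Y :|: Z, #|X| = #|Y| + #|Z|
                & 0 < #|Y| /\ 0 < #|Z|].
Proof.
case=> s [t [Tst ->]]; have [tL|tL] := boolP (t \in leaves T).
  by left; exists (delta t); apply: shore_leaf.
right; have [p [q [e un]]] := three_neighbours Tst tL.
have [-> D] := shore_node e un.
have Ttp : T t p by have /setP/(_ p) := e; rewrite !inE eqxx orbT.
have Ttq : T t q by have /setP/(_ q) := e; rewrite !inE eqxx orbT.
exists (shore T delta p t), (shore T delta q t); split=> //.
- by exists t, p.
- by exists t, q.
- by rewrite -cardsUI; move: D; rewrite -setI_eq0 => /eqP->; rewrite cards0 addn0.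
- by rewrite !card_gt0 !shore_neq0.
Qed.

Lemma is_shore_set1 v : is_shore [set v].
Proof.
have [l lL ->] := delta_surj v; move: (lL); rewrite inE => /cards1P[s e].
have Tsl : T s l by have /setP/(_ s) := e; rewrite !inE eqxx (adj_sym T).
by exists s, l; rewrite shore_leaf.
Qed.

Lemma width_leP (G : sgraph V) k :
  width G T delta <= k <-> (forall X, is_shore X -> matching_porosity G X <= k).
Proof.
split=> [/bigmax_leqP h X [s [t [Tst ->]]]|h].
  by apply: (h (t, s)); rewrite /= (adj_sym T).
by apply/bigmax_leqP=> -[s t] /= Tst; apply: h; exists t, s; rewrite (adj_sym T).
Qed.

(** The complement of a vertex splits into two shores, one of which has at least two vertices; the
    other one and the removed vertex lie in its complement, so the cut is nontrivial. *)
Lemma width_ge2 (G : sgraph V) : brace G -> 3 < #|V| -> 1 < width G T delta.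
Proof.
move=> bG V4.
have [v _] : exists v : V, true.
  by case/card_gt0P: (leq_ltn_trans (leq0n 3) V4) => v; exists v.
suff [X [sX X1 CX1]] : exists X, [/\ is_shore X, 1 < #|X| & 1 < #|~: X|].
  apply: leq_trans (porosity_ge2 bG X1 CX1) _.
  by have [/(_ (leqnn _)) h _] := width_leP G (width G T delta); apply: h.
have sv := is_shoreC (is_shore_set1 v).
have cv : #|~: [set v]| = #|V| - 1 by rewrite cardsCs setCK cards1.
case: (is_shore_split sv) => [[w e]|[Y [Z [sY sZ e eYZ [Y0 Z0]]]]].
  by move: cv; rewrite e cards1; lia.
case: (ltnP 1 #|Y|) => Y1.
  by exists Y; split=> //; have := cardsC Y; lia.
by exists Z; split=> //; [lia|]; have := cardsC Z; lia.
Qed.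

End Shores.

(** * Elimination orders *)

Section Order.
Variables (V : finType) (G : sgraph V).
Hypothesis braceG : brace G.

Lemma card_setCI (X S : {set V}) : #|X :&: S| + #|~: X :&: S| = #|S|.
Proof. by rewrite -(cardsID X S) setIC setDE [S :&: ~: X]setIC. Qed.

Lemma card_split_setI (X Y Z S : {set V}) : X = Y :|: Z -> #|X| = #|Y| + #|Z| ->
  #|X :&: S| = #|Y :&: S| + #|Z :&: S|.
Proof.
move=> ->; have := cardsUI Y Z => h1 h2.
have /eqP : #|Y :&: Z| = 0 by lia.
rewrite cards_eq0 => /eqP YZ; have := cardsUI (Y :&: S) (Z :&: S).
by rewrite -setIUl setIACA YZ set0I cards0 addn0.
Qed.

Lemma bipC (A : {set V}) : (forall x y, G x y -> (x \in A) != (y \in A)) ->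
  forall x y, G x y -> (x \in ~: A) != (y \in ~: A).
Proof. by move=> h x y /h; rewrite !inE; do 2!case: (_ \in A). Qed.

Section Side.
Variable A : {set V}.
Hypotheses (bip : forall x y, G x y -> (x \in A) != (y \in A)) (V4 : 3 < #|V|).

Let V1 : 1 < #|V|. Proof. by lia. Qed.
Let cA : #|A| = #|~: A|. Proof. exact: card_sides braceG _ bip V1. Qed.

(** Together with [b], the vertices of [X] outside [A] have all their neighbours in [X :&: A], which
    has just one vertex more. Expansion by two forbids this unless [X] exhausts [A]. *)
Lemma plus_full (X : {set V}) b : plus G A X -> b \notin X -> b \notin A ->
  (forall a, G b a -> a \in X) -> A \subset X.
Proof.
case=> cX nX bX bA Nb; pose S := b |: (X :\: A).
have SA : S \subset ~: A by rewrite subUset sub1set inE bA subsetDr.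
have S0 : S != set0 by apply/set0Pn; exists b; rewrite setU11.
have cS : #|S| = #|X :\: A| + 1 by rewrite cardsU1 !inE (negPf bX) andbF addnC.
have NS : neighbours G S \subset X :&: A.
  apply/subsetP=> a; rewrite inE => /exists_inP[s sS Gsa].
  have aA : a \in A.
    by have := bip Gsa; have := subsetP SA _ sS; rewrite inE => /negPf->; case: (a \in A).
  rewrite inE aA andbT; case/setU1P: sS Gsa => [->|/setDP[sX sA]]; first exact: Nb.
  exact: nX.
have := subset_leq_card NS; have := expand2 braceG (bipC bip) SA S0.
rewrite cS cX -cA => h1 h2; apply/setIidPl/eqP; rewrite eqEcard subsetIl.
by rewrite [A :&: X]setIC cX; case: leqP h1 => // h /(_ _); lia.
Qed.

End Side.

Lemma side_of u : exists A : {set V},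
  (forall x y, G x y -> (x \in A) != (y \in A)) /\ u \in A.
Proof.
have [[A bip] _ _] := braceG; case uA: (u \in A); first by exists A.
by exists (~: A); split; [apply: bipC | rewrite inE uA].
Qed.

Lemma neighbours1 u : neighbours G [set u] = [set w | G u w].
Proof.
apply/setP=> w; rewrite !inE; apply/exists_inP/idP => [[x /set1P->]//|].
by exists u; rewrite ?set11.
Qed.

Lemma min_degree u : 3 < #|V| -> 1 < #|[set w | G u w]|.
Proof.
move=> V4; have [A [bip uA]] := side_of u.
have cA := card_sides braceG bip (ltnW (ltnW V4)).
have := @expand1 _ _ braceG _ bip [set u]; rewrite sub1set uA cards1 neighbours1.
apply=> //; first by apply/set0Pn; exists u; rewrite set11.
by apply/eqP=> e; have := cardsC A; rewrite -cA -e cards1; lia.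
Qed.

Lemma min_degree3 u : 4 < #|V| -> 2 < #|[set w | G u w]|.
Proof.
move=> V5; have [A [bip uA]] := side_of u.
have cA := card_sides braceG bip (ltnW (ltnW (ltnW V5))).
have := @expand2 _ _ braceG _ bip [set u]; rewrite sub1set uA cards1 neighbours1.
apply=> //; first by apply/set0Pn; exists u; rewrite set11.
by have := cardsC A; rewrite -cA; lia.
Qed.


Variables (N : finType) (T : sgraph N) (delta : N -> V).
Hypotheses (dec : pm_decomposition T delta) (w2 : width G T delta <= 2).
Hypothesis V4 : 3 < #|V|.

(** * Moving through the shores of a decomposition of width at most 2 *)

Section Climb.
Variable A : {set V}.
Hypothesis bip : forall x y, G x y -> (x \in A) != (y \in A).

Let V1 : 1 < #|V|. Proof. by lia. Qed.
Let cA : #|A| = #|~: A|. Proof. exact: card_sides braceG _ bip V1. Qed.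
Notation shore := (is_shore T delta).
Notation plus := (plus G A).

Let por X : shore X -> forall f, mate G f -> #|crossing f X| <= 2.
Proof. by move=> sX; apply/porosity_leP; exact: (proj1 (width_leP T delta G 2) w2). Qed.

Let diff_even X : shore X -> ~~ odd #|X| -> [\/ plus X, plus (~: X)
    | #|X :&: A| = #|X :\: A| /\ (#|X| <= 2 \/ #|~: X| <= 2)].
Proof. by move=> sX eX; apply: (even_shore braceG bip (por sX) eX V1). Qed.

Let diff_odd X : shore X -> odd #|X| -> #|X| <= 1 \/ #|~: X| <= 1.
Proof. by move=> sX; apply: (odd_shore braceG (por sX)). Qed.

(** Descends from the complement of a vertex while at most two vertices are missing. When this
    stops, at least five vertices are divided into two parts which each miss more than two; one part
    has more than two vertices, is not among the small exceptions, and so is [plus] or has a [plus]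
    complement. *)
Lemma exists_plus_shore : 6 < #|V| -> exists2 X, shore X & plus X.
Proof.
move=> V7; suff step k (X : {set V}) : #|X| <= k -> shore X -> #|V| <= #|X| + 2 ->
    exists2 X, shore X & plus X.
  have [v _] : exists v : V, true.
    by case/card_gt0P: (leq_ltn_trans (leq0n 3) V4) => v; exists v.
  apply: (step #|~: [set v]| (~: [set v])) => //.
    exact/is_shoreC/is_shore_set1.
  by rewrite cardsCs setCK cards1; lia.
elim: k X => [|k IH] X le sX ge; first by lia.
case: (is_shore_split dec sX) => [[w e]|[Y [Z [sY sZ e eYZ [Y0 Z0]]]]].
  by move: ge; rewrite e cards1; lia.
have mid W : shore W -> 2 < #|W| -> #|W| + 2 < #|V| -> exists2 X, shore X & plus X.
  move=> sW W2 W3; have cW := cardsC W.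
  case oW: (odd #|W|); first by case: (diff_odd sW oW); lia.
  case: (diff_even sW (negbT oW)) => [pW|pW|[_ []]]; try lia.
    by exists W.
  by exists (~: W) => //; apply: is_shoreC.
case: (leqP #|V| (#|Y| + 2)) => hY; first by apply: (IH Y) => //; lia.
case: (leqP #|V| (#|Z| + 2)) => hZ; first by apply: (IH Z) => //; lia.
case: (ltnP 2 #|Y|) => Y2; first exact: (mid Y).
by apply: (mid Z) => //; lia.
Qed.

Lemma plus_card X : plus X -> [/\ #|X| = (#|X :\: A|).*2 + 2 & 1 < #|~: X|].
Proof.
case=> e _; have := cardsID A X; have := card_setCI X A; have := card_setCI X (~: A).
have := cardsID A (~: X); rewrite -!setDE => *; split; lia.
Qed.

(** The surplus of two is shared by the two parts. Odd parts are single vertices, and the pair is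
    found; even parts have surplus 2, -2 or 0, so one of them is [plus] again. *)
Lemma exists_plus_pair X : shore X -> plus X ->
  exists2 Y, shore Y & plus Y /\ #|Y| = 2.
Proof.
have [k] := ubnP #|X|; elim: k X => // k IH X lt sX pX.
have [cX CX] := plus_card pX; have c := cardsC X.
case: (is_shore_split dec sX) => [[w e]|[Y [Z [sY sZ e eYZ [Y0 Z0]]]]].
  by move: cX; rewrite e cards1; lia.
have cY := cardsC Y; have cZ := cardsC Z.
case oY: (odd #|Y|).
  have oZ : odd #|Z| by lia.
  exists X => //; split=> //.
  by case: (diff_odd sY oY); case: (diff_odd sZ oZ); lia.
have oZ : ~~ odd #|Z| by lia.
have eA := card_split_setI A e eYZ; have eB := card_split_setI (~: A) e eYZ.
rewrite -!setDE in eB.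
have co W : plus (~: W) -> #|W :\: A| = #|W :&: A| + 2.
  by case=> h _; have := card_setCI W A; have := card_setCI W (~: A); rewrite -!setDE; lia.
case: (diff_even sY (negbT oY)) => [pY|/co pY|[pY _]]; first by apply: (IH Y) => //; lia.
  case: (diff_even sZ oZ) => [pZ|/co pZ|[pZ _]]; first by apply: (IH Z) => //; lia.
    by case: pX; lia.
  by case: pX; lia.
case: (diff_even sZ oZ) => [pZ|/co pZ|[pZ _]]; first by apply: (IH Z) => //; lia.
  by case: pX; lia.
by case: pX; lia.
Qed.

(** [U] abstracts the set of used vertices at which a greedy search is stuck. *)
Variable U : {set V}.
Hypothesis Ucl : forall b a, b \in U -> b \notin A -> G b a -> a \in U.
Hypothesis Uno : forall u, u \notin U -> 1 < #|[set w | G u w & w \notin U]|.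

(** The greedy step hidden in the tree: the neighbours of [b] lie in [X] or equal [a], so at most
    one is outside [U] and [b] must be in [U]. Then [a] follows if it is adjacent to [b]; otherwise
    [plus_full] puts all of [A] into [X]. *)
Lemma climb_pair (X Y : {set V}) : X \subset U -> plus X -> plus (X :|: Y) ->
  #|X :|: Y| = #|X| + #|Y| -> #|Y :&: A| = 1 -> #|Y :\: A| = 1 -> X :|: Y \subset U.
Proof.
move=> XU pX pXY cXY /eqP/cards1P[a Ya] /eqP/cards1P[b Yb].
have YE : Y = [set a; b] by rewrite -(setID Y A) Ya Yb.
have /setIP[aY aA] : a \in Y :&: A by rewrite Ya set11.
have /setDP[bY bA] : b \in Y :\: A by rewrite Yb set11.
have dis : X :&: Y = set0.
  by apply/eqP; rewrite -cards_eq0; have := cardsUI X Y; lia.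
have nX z : z \in Y -> z \notin X.
  move=> zY; apply/negP=> zX; have : z \in X :&: Y by rewrite inE zX.
  by rewrite dis inE.
have Nb z : G b z -> z \in X \/ z = a.
  move=> Gbz; have /setUP[zX|] : z \in X :|: Y.
    by apply: (proj2 pXY b z) => //; rewrite inE bY orbT.
  by left.
  rewrite YE => /set2P[->|zb]; first by right.
  by have := adj_neq Gbz; rewrite zb eqxx.
have bU : b \in U.
  apply: contraT => /Uno; rewrite ltnNge; case/negP.
  rewrite -(cards1 a); apply: subset_leq_card; apply/subsetP=> z.
  rewrite !inE => /andP[/Nb[zX|->//]]; by rewrite (subsetP XU).
have aU : a \in U.
  case Gba: (G b a); first exact: Ucl Gba.
  have /subsetP/(_ a aA) : A \subset X.
    apply: (@plus_full A bip V4 X b) => //; first exact: nX.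
    by move=> z Gbz; case: (Nb z Gbz) => // e; rewrite -e Gbz in Gba.
  by apply: subsetP.
by rewrite YE subUset XU subUset !sub1set aU.
Qed.

(** The complement of [X] has surplus -2. If it splits into even parts, one is a balanced pair and
    the complement of the other is a larger [plus] shore, reached by [climb_pair]. If the parts are
    odd, only two vertices remain, both outside [A]; then [U] contains [A], and a vertex outside [U]
    would have no neighbour outside [U]. *)
Lemma climb X : shore X -> plus X -> X \subset U -> U = [set: V].
Proof.
have [k] := ubnP #|~: X|; elim: k X => // k IH X lt sX pX XU.
have [cX CX] := plus_card pX; have c := cardsC X.
case: (is_shore_split dec (is_shoreC dec sX)) => [[w e]|[Y [Z [sY sZ e eYZ [Y0 Z0]]]]].
  by move: CX; rewrite e cards1.
have cY := cardsC Y; have cZ := cardsC Z; have cAA := cardsC A.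
have eA := card_split_setI A e eYZ; have eB := card_split_setI (~: A) e eYZ.
have fA := card_setCI X A; have fB := card_setCI X (~: A).
rewrite -!setDE in eB fB.
case oY: (odd #|Y|).
  have oZ : odd #|Z| by lia.
  have CX2 : #|~: X| = 2 by case: (diff_odd sY oY); case: (diff_odd sZ oZ); lia.
  have /subsetP AX : A \subset X.
    apply/setIidPl/eqP; rewrite eqEcard subsetIl [A :&: X]setIC.
    by case: pX; lia.
  apply/setP=> v; rewrite inE; apply: contraT => vU.
  have := Uno vU; rewrite (_ : [set _ | _ & _] = set0) ?cards0 //.
  apply/setP=> w; rewrite !inE; apply/negP=> /andP[/bip].
  have -> : v \in A = false by apply: contraNF vU => /AX; apply: subsetP.
  by case wA: (w \in A) => // _; rewrite (subsetP XU) // AX.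
have oZ : ~~ odd #|Z| by lia.
have co W : plus (~: W) -> #|W :\: A| = #|W :&: A| + 2.
  by case=> h _; have := card_setCI W A; have := card_setCI W (~: A); rewrite -!setDE; lia.
have up Y' Z' : shore Z' -> ~: X = Y' :|: Z' -> #|~: X| = #|Y'| + #|Z'| -> 0 < #|Y'| ->
    #|Y' :&: A| = #|Y' :\: A| -> #|Y'| <= 2 -> plus (~: Z') -> U = [set: V].
  move=> sZ' e' c' Y'0 bal le2 pZ'; have cY' := cardsID A Y'.
  have XY : ~: Z' = X :|: Y'.
    apply/setP=> v; have /setP/(_ v) := e'; rewrite !inE.
    have : #|Y' :&: Z'| = 0 by have := cardsUI Y' Z'; rewrite -e' c'; lia.
    move/eqP; rewrite cards_eq0 => /eqP/setP/(_ v); rewrite !inE.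
    by case: (v \in X); case: (v \in Y'); case: (v \in Z').
  have cXY : #|X :|: Y'| = #|X| + #|Y'| by rewrite -XY; have := cardsC Z'; lia.
  apply: (IH (~: Z')) => //.
  - by rewrite setCK; lia.
  - exact: is_shoreC.
  - by rewrite XY; apply: climb_pair => //; rewrite -?XY //; lia.
have pX' := proj1 pX.
case: (diff_even sY (negbT oY)) => [[pY _]|pY|[pY hY]].
- by case: (diff_even sZ oZ) => [[pZ _]|/co pZ|[pZ _]]; lia.
- case: (diff_even sZ oZ) => [[pZ _]|/co pZ|[pZ hZ]].
  + by have := co _ pY; lia.
  + by have := co _ pY; lia.
  apply: (up Z Y) => //; first by rewrite setUC.
    by lia.
  by case: hZ => //; lia.
case: (diff_even sZ oZ) => [[pZ _]|pZ|[pZ _]]; try by lia.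
by apply: (up Y Z) => //; case: hY => //; lia.
Qed.

End Climb.
End Order.

(** * The greedy search *)

Section Search.
Variables (V : finType) (G : sgraph V).
Hypothesis braceG : brace G.

(* A stamping [p] records an order of elimination: [p v] is the position of
   [v], counted from 1, and 0 if [v] has not been eliminated yet. *)
Definition used (p : V -> nat) i : {set V} := [set v | 0 < p v <= i].

Definition fresh (p : V -> nat) u : {set V} := [set w | G u w & p w == 0].

(** Having no fresh neighbour is allowed as well: from a start in one colour class, the last two
    vertices both lie in the other class and are picked up singly. *)
Definition candidate (p : V -> nat) u : bool := (p u == 0) && (#|fresh p u| <= 1).

(** A relation rather than a function, so that it can speak of the stamps found in the memory of the
    program. *)
Definition visits u (p : V -> nat) c (p' : V -> nat) c' : Prop :=
  if candidate p u then
    [/\ c' = c + 1 + #|fresh p u|, p' u = c.+1, {in fresh p u, forall w, p' w = c.+2}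
      & forall v, v != u -> v \notin fresh p u -> p' v = p v]
  else c' = c /\ p' =1 p.

Definition stamping x y (p : V -> nat) c : Prop :=
  [/\ x != y, used p 2 = [set x; y], (forall v w, 0 < p v -> p v = p w -> v = w),
      (forall v, p v <= c) & c = #|[set v | 0 < p v]|].

(** Nothing is claimed once fewer than two vertices are left, because the last two are stamped one
    at a time. *)
Definition plus_prefixes (A : {set V}) (p : V -> nat) c : Prop :=
  (c + 2 <= #|V| -> ~~ odd c) /\
  (forall i, ~~ odd i -> 2 <= i -> i <= c -> i + 2 <= #|V| -> plus G A (used p i)).

Definition bipartition (A : {set V}) : Prop :=
  forall x y, G x y -> (x \in A) != (y \in A).

(** All bipartitions are considered because the search is blind to colours. With four vertices a
    mixed start may succeed, but then only prefixes of two vertices matter. *)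
Definition search_inv x y (p : V -> nat) c : Prop :=
  [/\ stamping x y p c,
      (forall A, bipartition A -> x \in A -> y \in A -> plus_prefixes A p c)
    & (4 < #|V| -> forall A, bipartition A -> x \in A -> y \notin A -> c = 2)].

Lemma used_all x y p c : stamping x y p c -> used p c = [set v | 0 < p v].
Proof. by case=> _ _ _ h _; apply/setP=> v; rewrite !inE h andbT. Qed.

Lemma stamping_ge2 x y p c : stamping x y p c -> 2 <= c.
Proof.
move=> s; have e := used_all s; case: s => ne u2 _ _ ->.
have -> : 2 = #|[set x; y]| by rewrite cards2 ne.
by rewrite -u2; apply: subset_leq_card; apply/subsetP=> v; rewrite !inE => /andP[].
Qed.

Lemma stamping_full x y p : stamping x y p #|V| ->
  injective p /\ forall v, 0 < p v <= #|V|.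
Proof.
case=> _ _ inj pc card.
have pos v : 0 < p v.
  have : v \in [set v | 0 < p v]; last by rewrite inE.
  have /eqP -> // : [set v | 0 < p v] == [set: V].
  by rewrite eqEcard subsetT -card cardsT leqnn.
by split=> [v w|v]; [apply: inj | rewrite pos pc].
Qed.

Lemma fresh_irrefl p u : u \notin fresh p u.
Proof. by rewrite inE (adj_irrefl G). Qed.

Lemma fresh_case p u : candidate p u ->
  fresh p u = set0 \/ exists2 w, w != u & fresh p u = [set w].
Proof.
case/andP=> _; rewrite leq_eqVlt => /orP[/cards1P[w e]|]; last first.
  by rewrite ltnS leqn0 cards_eq0 => /eqP; left.
right; exists w => //; have := fresh_irrefl p u.
by rewrite e inE eq_sym.
Qed.

Lemma visits_case u p c p' c' v : visits u p c p' c' -> candidate p u ->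
  [\/ v = u /\ p' v = c.+1, [/\ v \in fresh p u, p v = 0 & p' v = c.+2]
    | [/\ v != u, v \notin fresh p u & p' v = p v]].
Proof.
rewrite /visits => + cand; rewrite cand => -[_ pu pf ps].
have [->|nu] := eqVneq v u; first by apply: Or31.
case vf: (v \in fresh p u); last by apply: Or33; rewrite ps ?vf.
by apply: Or32; rewrite pf //; move: vf; rewrite inE => /andP[_ /eqP].
Qed.

Lemma used_visits u p c p' c' i : (forall v, p v <= c) -> visits u p c p' c' -> i <= c ->
  used p' i = used p i.
Proof.
move=> pc vis ic; have [cand|nc] := boolP (candidate p u); last first.
  by move: vis; rewrite /visits (negPf nc) => -[_ e]; apply/setP=> v; rewrite !inE e.
apply/setP=> v; rewrite !inE; have /andP[/eqP pu _] := cand.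
case: (visits_case v vis cand) => [[-> ->]|[_ -> ->]|[_ _ ->]] //; rewrite ?pu; lia.
Qed.

Lemma stamping_visits x y u p c p' c' :
  stamping x y p c -> visits u p c p' c' -> stamping x y p' c'.
Proof.
move=> st vis; have c2 := stamping_ge2 st; case: st => ne u2 inj pc card.
have [cand|nc] := boolP (candidate p u); last first.
  move: vis; rewrite /visits (negPf nc) => -[-> e]; split=> //.
  - by rewrite -u2; apply/setP=> v; rewrite !inE e.
  - by move=> v w; rewrite !e; apply: inj.
  - by move=> v; rewrite e.
  - by rewrite card; apply: eq_card => v; rewrite !inE e.
have uv := used_visits pc vis c2.
have vc v := visits_case v vis cand.
have [c'E _ _ _] : [/\ c' = c + 1 + #|fresh p u|, p' u = c.+1,
    {in fresh p u, forall w, p' w = c.+2}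
      & forall v, v != u -> v \notin fresh p u -> p' v = p v].
  by move: vis; rewrite /visits cand.
have /andP[/eqP pu f1] := cand.
have fu := fresh_irrefl p u.
have funiq v w : v \in fresh p u -> w \in fresh p u -> v = w.
  by case: (fresh_case cand) => [->|[z _ ->]]; rewrite !inE // => /eqP-> /eqP->.
split=> //; first by rewrite uv.
- move=> v w; have := pc w; have := pc v.
  case: (vc v) => [[-> ->]|[vf pv ->]|[vu vf ->]];
  case: (vc w) => [[-> ->]|[wf pw ->]|[wu wf ->]] //; try lia.
  + by move=> *; apply: funiq.
  + by move=> _ _; apply: inj.
- move=> v; case: (vc v) => [[-> ->]|[vf pv ->]|[vu vf ->]].
  + by lia.
  + have : 0 < #|fresh p u| by rewrite card_gt0; apply/set0Pn; exists v.
    by lia.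
  + by have := pc v; lia.
- have -> : [set v | 0 < p' v] = [set v | 0 < p v] :|: (u |: fresh p u).
    apply/setP=> v; rewrite in_setU in_setU1 inE [v \in [set _ | _]]inE.
    case: (vc v) => [[-> ->]|[vf pv ->]|[vu vf ->]].
    * by rewrite eqxx orbT.
    * by rewrite vf !orbT.
    * by rewrite (negPf vu) (negPf vf) !orbF.
  rewrite cardsU -card (_ : _ :&: _ = set0) ?cards0.
    by rewrite cardsU1 fu; lia.
  apply/setP=> v; rewrite !inE; apply/negP=> /andP[pv /orP[/eqP e|/andP[_ /eqP]]].
    by rewrite e pu in pv.
  by lia.
Qed.

Lemma plus_prefixes_visits A x y u p c p' c' : 3 < #|V| -> bipartition A ->
    stamping x y p c -> plus_prefixes A p c -> visits u p c p' c' ->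
  plus_prefixes A p' c'.
Proof.
move=> V4 bip st [evc pl] vis; have c2 := stamping_ge2 st; have uall := used_all st.
have cA := card_sides braceG bip (ltnW (ltnW V4)); have cAV := cardsC A.
case: (st) => _ _ _ pc card.
have old i : i <= c -> used p' i = used p i by apply: used_visits pc vis.
have [cand|nc] := boolP (candidate p u); last first.
  move: vis old; rewrite /visits (negPf nc) => -[-> e] old; split=> // i oi i2 ic iV.
  by rewrite old //; apply: pl.
have vc v := visits_case v vis cand.
have c'E : c' = c + 1 + #|fresh p u| by move: vis; rewrite /visits cand => -[].
have /andP[/eqP pu f1] := cand.
have keep i : ~~ odd i -> 2 <= i -> i <= c -> i + 2 <= #|V| -> plus G A (used p' i).
  by move=> oi i2 ic iV; rewrite old //; apply: pl.
case: (leqP (c + 2) #|V|) => cV; last by split=> [|i oi i2 ic iV]; [lia|apply: keep => //; lia].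
have ec := evc cV.
have pU : plus G A (used p c) by apply: pl.
have inU v : (v \in used p c) = (0 < p v) by rewrite uall inE.
have uU : u \notin used p c by rewrite inU pu.
have uA : u \notin A.
  apply/negP=> uA; have : 1 < #|fresh p u|; last by lia.
  rewrite (_ : fresh p u = [set w | G u w]); first exact: min_degree.
  apply/setP=> w; rewrite !inE; case Guw: (G u w) => //=.
  rewrite eqn0Ngt -inU; apply/negP=> wU.
  have wA : w \notin A by have := bip _ _ Guw; rewrite uA; case: (w \in A).
  by move: uU; rewrite (proj2 pU w u) // (adj_sym G).
have nu w : G u w -> w \in used p c \/ w \in fresh p u.
  by move=> Guw; rewrite inU inE Guw /=; case: (p w); [right|left].
case: (fresh_case cand) => [f0|[w wu fw]].
  have AU : A \subset used p c.
    apply: (plus_full braceG bip V4 pU uU uA) => a /nu[//|].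
    by rewrite f0 inE.
  have : c + 2 = #|V|.
    have := cardsID A (used p c); rewrite uall -card -{1}uall setIC (setIidPl AU).
    by have := proj1 pU; rewrite setIC (setIidPl AU) uall; lia.
  by rewrite f0 cards0 in c'E; split=> [|i oi i2 ic iV]; [lia|apply: keep => //; lia].
rewrite fw cards1 in c'E; split=> [_|i oi i2 ic iV]; first by lia.
have [ic'|ic'] := leqP i c; first exact: keep.
have iE : i = c.+2 by lia.
have Guw : G u w by have : w \in fresh p u; [rewrite fw set11|rewrite inE => /andP[]].
have wA : w \in A by have := bip _ _ Guw; rewrite (negPf uA); case: (w \in A).
have wU : w \notin used p c.
  rewrite inU; have : w \in fresh p u by rewrite fw set11.
  by rewrite inE => /andP[_ /eqP->].
have E : used p' i = u |: (w |: used p c).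
  apply/setP=> v; rewrite in_setU1 in_setU1 inU inE iE.
  case: (vc v) => [[-> ->]|[vf pv ->]|[vu vf ->]].
  - by rewrite eqxx /=; lia.
  - by move: vf; rewrite fw inE => /eqP->; rewrite eqxx orbT; lia.
  - rewrite (negPf vu); move: vf; rewrite fw inE => /negPf->.
    by rewrite (leq_trans (pc v)) ?andbT // -addn2 leq_addr.
have [pU1 pU2] := pU; rewrite E; split.
  have -> : (u |: (w |: used p c)) :&: A = w |: (used p c :&: A).
    apply/setP=> v; rewrite !inE; have [->|_] := eqVneq v u.
      by rewrite (negPf uA) !andbF orbF; apply/esym/negbTE; rewrite eq_sym.
    by have [->|_] := eqVneq v w; rewrite ?wA.
  have -> : (u |: (w |: used p c)) :\: A = u |: (used p c :\: A).
    apply/setP=> v; rewrite !inE; have [->|_] := eqVneq v u; first by rewrite uA.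
    by have [->|_] := eqVneq v w; rewrite ?wA.
  by rewrite !cardsU1 !in_setI !in_setD (negPf wU) (negPf uU) andbF pU1; lia.
move=> b a bX bA Gba; rewrite !in_setU1.
case/setU1P: bX Gba => [->|/setU1P[e|bX]] Gba.
- by case: (nu a Gba) => [->|]; rewrite ?orbT // fw inE => ->; rewrite orbT.
- by rewrite e wA in bA.
- by rewrite (pU2 b a) ?orbT.
Qed.

Lemma search_inv_visits x y u p c p' c' : 3 < #|V| ->
  search_inv x y p c -> visits u p c p' c' -> search_inv x y p' c'.
Proof.
move=> V4 [st pl mix] vis; split; first exact: stamping_visits vis.
  by move=> A bip xA yA; apply: plus_prefixes_visits vis => //; [apply: st|apply: pl].
move=> V5 A bip xA yA; have c2 := mix V5 A bip xA yA.
move: vis; rewrite /visits; case: ifP => [cand|_ [-> _]//].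
case/andP: cand => _; rewrite leqNgt => /negP[].
have uall := used_all st.
have E v : (p v == 0) = (v \notin [set x; y]).
  by case: st => _ <- _ _ _; rewrite -c2 uall inE; case: (p v).
(* The only starting vertex that can be adjacent to [u]. All other neighbours of [u] are fresh, and
   there are at least two of them. *)
pose z := if u \in A then y else x.
have sub : [set w | G u w] \subset z |: fresh p u.
  apply/subsetP=> w; rewrite in_setU1 !inE => Guw; rewrite Guw E !inE /=.
  have := bip _ _ Guw; rewrite /z; case uA: (u \in A) => wA.
    have -> : w == x = false by apply: contraNF wA => /eqP->; rewrite xA.
    by rewrite orbN.
  have -> : w == y = false by apply: contraNF wA => /eqP->; rewrite (negPf yA).
  by rewrite orbF orbN.
have := subset_leq_card sub; have := min_degree3 braceG u V5; rewrite cardsU1; lia.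
Qed.

Lemma search_inv_start x y p : x != y -> 3 < #|V| -> p x = 1 -> p y = 2 ->
  (forall v, v != x -> v != y -> p v = 0) -> search_inv x y p 2.
Proof.
move=> ne V4 px py p0.
have pv v : [\/ v = x /\ p v = 1, v = y /\ p v = 2 | [/\ v != x, v != y & p v = 0]].
  have [->|nx] := eqVneq v x; first by apply: Or31.
  have [->|ny] := eqVneq v y; first by apply: Or32.
  by apply: Or33; rewrite p0.
have u2 : used p 2 = [set x; y].
  apply/setP=> v; rewrite !inE; case: (pv v) => [[-> ->]|[-> ->]|[/negPf-> /negPf-> ->]] //.
    by rewrite eqxx.
  by rewrite eqxx orbT.
have st : stamping x y p 2.
  split=> //.
  - move=> v w; case: (pv v) => [[-> ->]|[-> ->]|[_ _ ->]] //;
    by case: (pv w) => [[-> ->]|[-> ->]|[_ _ ->]].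
  - by move=> v; case: (pv v) => [[_ ->]|[_ ->]|[_ _ ->]].
  - have -> : [set v | 0 < p v] = [set x; y]; last by rewrite cards2 ne.
    apply/setP=> v; rewrite !inE; case: (pv v) => [[-> ->]|[-> ->]|[/negPf-> /negPf-> ->]] //.
      by rewrite eqxx.
    by rewrite eqxx orbT.
split=> // A bip xA yA; split=> // i oi i2 i2'.
have -> : i = 2 by lia.
rewrite u2; split.
  have -> : [set x; y] :&: A = [set x; y].
    by apply/setIidPl; rewrite subUset !sub1set xA.
  have -> : [set x; y] :\: A = set0.
    by apply/eqP; rewrite setD_eq0 subUset !sub1set xA.
  by rewrite cards2 ne cards0.
by move=> b a /set2P[]-> ; rewrite ?xA ?yA.
Qed.

(** A prefix of two vertices is harmless for any start. A longer one leaves at least six vertices in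
    all, where a mixed start is excluded and the prefix is [plus]. *)
Lemma search_inv_porosity x y p c i : 3 < #|V| -> search_inv x y p c -> c = #|V| ->
  ~~ odd i -> 2 <= i -> i + 2 <= #|V| -> matching_porosity G (used p i) <= 2.
Proof.
move=> V4 [st pl mix] cV oi i2 iV; apply/porosity_leP => f fm.
have [->|ne] := eqVneq i 2.
  case: (st) => ne -> _ _ _; apply: leq_trans (_ : #|[set x; y]| <= 2).
    by apply: subset_leq_card; apply/subsetP=> v; rewrite inE => /andP[].
  by rewrite cards2 ne.
have [A [bip xA]] := side_of braceG x; have [yA|yA] := boolP (y \in A); last first.
  by have := mix _ A bip xA yA; lia.
have [_ /(_ i oi i2 _ iV) h] := pl A bip xA yA.
by rewrite (plus_crossing bip _ fm) //; apply: h; lia.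
Qed.

Lemma search_complete (N : finType) (T : sgraph N) (delta : N -> V) :
    pm_decomposition T delta -> width G T delta <= 2 -> 3 < #|V| ->
  exists x y, x != y /\ forall p c, (search_inv x y p c \/ search_inv y x p c) ->
    (forall u, ~~ candidate p u) -> c = #|V|.
Proof.
move=> dec w2 V4; have [[A bip] _ _] := braceG.
have cA := card_sides braceG bip (ltnW (ltnW V4)); have cAV := cardsC A.
suff [x [y [ne xA yA h]]] : exists x y, [/\ x != y, x \in A, y \in A
    & forall U : {set V}, plus G A U -> x \in U -> y \in U ->
      (forall u, u \notin U -> 1 < #|[set w | G u w & w \notin U]|) -> False].
  exists x, y; split=> // p c inv closed.
  have [st pl] : stamping x y p c /\ plus_prefixes A p c.
    case: inv => [[st pl _]|[st pl _]]; split=> //; try exact: pl.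
    by case: st => ? ? ? ? ?; split=> //; rewrite 1?eq_sym // setUC.
  have uall := used_all st; have c2 := stamping_ge2 st.
  case: (st) => _ u2 _ pc card.
  have cle : c <= #|V| by rewrite card max_card.
  have cU : #|used p c| = c by rewrite uall -card.
  apply/eqP; apply: contraT => nc.
  have uU u : (p u == 0) = (u \notin used p c) by rewrite uall inE; case: (p u).
  have fE u : fresh p u = [set w | G u w & w \notin used p c].
    by apply/setP=> w; rewrite !inE pc; case: (p w).
  (* With two vertices left, the used set is [plus] and closed, against [h]. A single leftover
     vertex has no fresh neighbour and is itself a candidate. *)
  case: (leqP (c + 2) #|V|) => cV.
    have ec := proj1 pl cV; have pU := proj2 pl c ec c2 (leqnn _) cV.
    have xyU : [set x; y] \subset used p c.
      by rewrite -u2; apply/subsetP=> v; rewrite !inE pc andbT => /andP[].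
    case: (h _ pU); [by apply: (subsetP xyU); rewrite set21
      |by apply: (subsetP xyU); rewrite set22|].
    move=> u nu; rewrite -fE ltnNge; apply/negP=> le.
    by have := closed u; rewrite /candidate uU nu le.
  have : #|~: used p c| == 1 by have := cardsC (used p c); lia.
  case/cards1P=> u eu.
  have nu : u \notin used p c by rewrite -in_setC eu set11.
  have := closed u; rewrite /candidate uU nu /=; case/negP.
  rewrite fE; apply: leq_trans (_ : #|[set u]| <= 1); last by rewrite cards1.
  by rewrite -eu; apply: subset_leq_card; apply/subsetP=> w; rewrite !inE => /andP[].
case: (ltnP 6 #|V|) => V6.
  have [X sX pX] := exists_plus_shore braceG dec w2 V4 bip V6.
  have [Y sY [pY cY]] := exists_plus_pair braceG dec w2 V4 bip sX pX.
  have YA : Y :\: A = set0.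
    apply/eqP; rewrite -cards_eq0; have [+ _] := plus_card braceG w2 V4 bip pY; lia.
  move/eqP: cY => /cards2P[x [y [ne eY]]].
  have sub : Y \subset A by rewrite -setD_eq0 YA.
  exists x, y; split=> //; try by apply: (subsetP sub); rewrite eY ?set21 ?set22.
  move=> U pU xU yU no; have [_ Ucl] := pU.
  have UT : U = [set: V].
    apply: (climb braceG dec w2 V4 bip Ucl no sY pY).
    by rewrite eY subUset !sub1set xU.
  (* The whole vertex set is not [plus], as the colour classes have equal size. *)
  by case: pU => + _; rewrite UT setTI setTD; lia.
have /card_gt1P[x [y [xA yA ne]]] : 1 < #|A| by lia.
exists x, y; split=> // U [cU _] xU yU no.
have c2 : 2 <= #|U :&: A|.
  have -> : 2 = #|[set x; y]| by rewrite cards2 ne.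
  by apply: subset_leq_card; rewrite subUset !sub1set !inE xU yU xA.
have [b] : exists b, b \in ~: A :\: U.
  apply/set0Pn; rewrite -card_gt0; have := cardsID U (~: A).
  rewrite [~: A :&: U]setIC -setDE; have := subset_leq_card (subsetIr U A); lia.
rewrite !inE => /andP[bU bA]; have := no b bU; rewrite ltnNge; case/negP.
apply: leq_trans (_ : #|A :\: U| <= 1).
  apply: subset_leq_card; apply/subsetP=> w; rewrite !inE => /andP[Gbw ->] /=.
  by have := bip _ _ Gbw; rewrite (negPf bA); case: (w \in A).
by have := cardsID U A; rewrite setIC; lia.
Qed.

End Search.

(** * The caterpillar of an elimination order *)

Section ParentTree.
Variables (M : nat) (par : nat -> nat).
Hypotheses (par_gt : forall x, x < M -> x < par x <= M) (par_root : par M = M).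

(** The root is its own parent, so the loop has to be removed explicitly. *)
Definition parent_adj : rel 'I_M.+1 :=
  fun x y => (x != y) && ((nat_of_ord y == par x) || (nat_of_ord x == par y)).

Lemma parent_adj_sym : symmetric parent_adj.
Proof. by move=> x y; rewrite /parent_adj eq_sym orbC. Qed.

Lemma parent_adj_irrefl : irreflexive parent_adj.
Proof. by move=> x; rewrite /parent_adj eqxx. Qed.

Definition parent_tree : sgraph 'I_M.+1 := SGraph parent_adj_sym parent_adj_irrefl.

Lemma par_range x : x <= M -> x <= par x <= M.
Proof.
by rewrite leq_eqVlt => /orP[/eqP->|/par_gt]; [rewrite par_root leqnn | lia].
Qed.

Lemma parent_adjP (x y : 'I_M.+1) : x < y -> parent_tree x y = (nat_of_ord y == par x).
Proof.
move=> lt; have := @par_range y; have := ltn_ord y; rewrite /= /parent_adj -val_eqE /=.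
by lia.
Qed.

Lemma parent_tree_connected : connected_graph parent_tree.
Proof.
split; first by rewrite card_ord.
have root (x : 'I_M.+1) : connect parent_tree x ord_max.
  have [k] := ubnP (M - x); elim: k x => // k IH x lt.
  have [e|ne] := eqVneq (nat_of_ord x) M.
    by rewrite (_ : x = ord_max) ?connect0 //; apply: val_inj.
  have xM : x < M by have := ltn_ord x; lia.
  have := par_gt xM => /andP[gt le].
  have lt' : par x < M.+1 by [].
  apply: (@connect_trans _ _ (Ordinal lt')); last by apply: IH => /=; lia.
  by apply: connect1; rewrite parent_adjP.
move=> x y; apply: connect_trans (root x) _.
by rewrite (sym_connect_sym parent_adj_sym).
Qed.

(* The smallest node of a cycle would have two parents. *)
Lemma parent_tree_acyclic : acyclic parent_tree.
Proof.
move=> c c3 uc; apply/negP=> cyc.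
have [x xc xmin] : exists2 x, x \in c & forall y, y \in c -> x <= y.
  case: c c3 {uc cyc} => // x0 s _.
  have := @arg_minnP _ x0 (mem (x0 :: s)) (@nat_of_ord M.+1) (mem_head _ _).
  by case=> x xc h; exists x.
have [i s e] := rot_to xc.
have cy : cycle parent_tree (x :: s) by rewrite -e rot_cycle.
have us : uniq (x :: s) by rewrite -e rot_uniq.
have ss : 1 < size s by rewrite -ltnS -[(size s).+1]/(size (x :: s)) -e size_rot.
have gt z : z \in s -> x < z.
  move=> zs; have zc : z \in c by rewrite -(mem_rot i) e inE zs orbT.
  have := xmin z zc; rewrite leq_eqVlt => /orP[/eqP h|//].
  by move: us; rewrite /= (val_inj h) zs.
case: s {e} cy us ss gt => [|y s] //= cy us ss gt.
move: cy; rewrite rcons_path => /andP[xy /andP[_ zx]].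
set z := last y s in zx.
have zs : z \in s by rewrite /z; case: (s) ss => // w s' _; rewrite /= mem_last.
have Txz : parent_tree x z by rewrite (adj_sym parent_tree).
have gy : x < y by rewrite gt ?mem_head.
have gz : x < z by rewrite gt // inE zs orbT.
have ey : nat_of_ord y == par x by rewrite -(parent_adjP gy); apply: xy.
have ez : nat_of_ord z == par x by rewrite -(parent_adjP gz); apply: Txz.
have h : z = y by apply: val_inj; rewrite /= (eqP ey) (eqP ez).
by move: us; rewrite -h zs /= andbF.
Qed.

End ParentTree.

(* Node [4 j + 2] is the spine node below which the leaves of positions
   [1, ..., 2 j + 2] hang, and node [4 j + 1] (for [0 < j]) joins the leaves
   [4 j - 1] and [4 j] of positions [2 j + 1] and [2 j + 2]. *)
Definition caterpillar_parent (M x : nat) : nat :=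
  minn (x + (1 + (1 - x) + 3 * (1 < x %% 4) - 2 * (2 < x %% 4))) M.

(** The value 1 belongs to leaf 1. Inner nodes share it as a dummy, which must still be a position
    in use because the output lists a vertex for every node. *)
Definition position (x : nat) : nat :=
  if x %% 4 == 0 then 2 * (x %/ 4) + 2
  else if x %% 4 == 3 then 2 * (x %/ 4) + 3 else 1.

Definition is_leaf (x : nat) : bool := [|| x <= 1, x %% 4 == 0 | x %% 4 == 3].

Lemma position0 i : position (4 * i) = 2 * i + 2.
Proof. by rewrite /position mulKn // modnMr. Qed.

Lemma position3 i : position (4 * i + 3) = 2 * i + 3.
Proof. by rewrite /position (_ : (4 * i + 3) %% 4 = 3) /=; lia. Qed.

(** * The caterpillar with [2 k] leaves and [4 k - 2] nodes *)

Section Caterpillar.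
Variables (k M : nat).
Hypotheses (k2 : 1 < k) (ME : M = 4 * k - 3).

Lemma caterpillar_parent_gt x : x < M -> x < caterpillar_parent M x <= M.
Proof. by rewrite /caterpillar_parent; lia. Qed.

Lemma caterpillar_parent_root : caterpillar_parent M M = M.
Proof. by rewrite /caterpillar_parent; lia. Qed.

Definition caterpillar : sgraph 'I_M.+1 := parent_tree M (caterpillar_parent M).

Lemma caterpillarE (x y : 'I_M.+1) : caterpillar x y =
  (nat_of_ord x != y) && ((nat_of_ord y == caterpillar_parent M x)
    || (nat_of_ord x == caterpillar_parent M y)).
Proof. by []. Qed.

Lemma eq_inord (y : 'I_M.+1) a : a <= M -> (y == inord a) = (nat_of_ord y == a).
Proof. by move=> aM; rewrite -val_eqE /= inordK. Qed.

(** Turns the formula for parents into linear cases. The residues 0, 1, 2, 3 modulo 4 have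
    increments 1, 1, 4, 2. Exceptions: [1 - x] sends leaf 0 past leaf 1 to node 2, and the minimum
    with [M] hangs the last spine node below the last pair node [4 k - 3], which is the root. *)
Variant parent_spec (x : nat) : nat -> Prop :=
| ParentFirst of x = 0 : parent_spec x 2
| ParentLeaf i of 0 < i & x = 4 * i : parent_spec x (4 * i + 1)
| ParentPair i of i + 1 < k & x = 4 * i + 1 : parent_spec x (4 * i + 2)
| ParentRoot of x = 4 * k - 3 : parent_spec x (4 * k - 3)
| ParentSpine i of i + 2 < k & x = 4 * i + 2 : parent_spec x (4 * i + 6)
| ParentLast of x = 4 * k - 6 : parent_spec x (4 * k - 3)
| ParentLeaf' i of x = 4 * i + 3 : parent_spec x (4 * i + 5).

Lemma parentP x : x <= M -> parent_spec x (caterpillar_parent M x).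
Proof.
move=> xM; rewrite /caterpillar_parent; have := divn_eq x 4; rewrite mulnC.
set i := x %/ 4; have : x %% 4 < 4 by rewrite ltn_mod.
case: (x %% 4) => [|[|[|[|]]]] //= _ e; rewrite ?addn0 in e.
- case: (posnP i) => i0; first by rewrite e i0 (_ : minn _ _ = 2); [constructor | lia].
  by rewrite (_ : minn _ _ = 4 * i + 1); [apply: ParentLeaf | lia].
- case: (ltnP (i + 1) k) => h.
    by rewrite (_ : minn _ _ = 4 * i + 2); [apply: ParentPair | lia].
  by rewrite (_ : minn _ _ = 4 * k - 3); [apply: ParentRoot; lia | lia].
- case: (ltnP (i + 2) k) => h.
    by rewrite (_ : minn _ _ = 4 * i + 6); [apply: ParentSpine | lia].
  by rewrite (_ : minn _ _ = 4 * k - 3); [apply: ParentLast; lia | lia].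
- by rewrite (_ : minn _ _ = 4 * i + 5); [apply: ParentLeaf' | lia].
Qed.

Lemma leaf_neighbours (x : 'I_M.+1) : is_leaf x ->
  [set y | caterpillar x y] = [set inord (caterpillar_parent M x)].
Proof.
rewrite /is_leaf => lx; have xM := ltn_ord x; rewrite ltnS in xM.
have pM : caterpillar_parent M x <= M by rewrite geq_minr.
apply/setP=> y; rewrite !inE eq_inord // caterpillarE.
have yM := ltn_ord y; rewrite ltnS in yM.
case: (parentP xM) => *;
case: (parentP yM) => *;
lia.
Qed.

Lemma pair_adj i y : y <= M -> 0 < i -> i + 1 < k ->
  (4 * i + 1 != y) && ((y == 4 * i + 2) || (4 * i + 1 == caterpillar_parent M y))
  = [|| y == 4 * i + 2, y == 4 * i - 1 | y == 4 * i].
Proof. by move=> yM i0 ik; case: (parentP yM) => *; lia. Qed.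

Lemma root_adj y : y <= M ->
  (4 * k - 3 != y) && ((y == 4 * k - 3) || (4 * k - 3 == caterpillar_parent M y))
  = [|| y == 4 * k - 6, y == 4 * k - 5 | y == 4 * k - 4].
Proof. by move=> yM; case: (parentP yM) => *; lia. Qed.

Lemma first_adj q y : y <= M -> 2 < q ->
  (2 != y) && ((y == q) || (2 == caterpillar_parent M y)) = [|| y == q, y == 0 | y == 1].
Proof. by move=> yM q2; case: (parentP yM) => *; lia. Qed.

Lemma spine_adj i q y : y <= M -> 0 < i -> i + 1 < k -> 4 * i + 2 < q ->
  (4 * i + 2 != y) && ((y == q) || (4 * i + 2 == caterpillar_parent M y))
  = [|| y == q, y == 4 * i - 2 | y == 4 * i + 1].
Proof. by move=> yM i0 ik iq; case: (parentP yM) => *; lia. Qed.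

(** Except at the root, the first neighbour listed is the parent, so that the other two carry the
    part of the tree below the node. *)
Variant node_spec (x : nat) : nat -> nat -> nat -> Prop :=
| NodePair i of 0 < i & i + 1 < k & x = 4 * i + 1 :
    node_spec x (4 * i + 2) (4 * i - 1) (4 * i)
| NodeRoot of x = 4 * k - 3 : node_spec x (4 * k - 6) (4 * k - 5) (4 * k - 4)
| NodeFirst of x = 2 : node_spec x (caterpillar_parent M 2) 0 1
| NodeSpine i of 0 < i & i + 1 < k & x = 4 * i + 2 :
    node_spec x (caterpillar_parent M (4 * i + 2)) (4 * i - 2) (4 * i + 1).

Lemma node_neighbours (x : 'I_M.+1) : ~~ is_leaf x -> exists a b c,
  [/\ node_spec x a b c, [set y | caterpillar x y] = [set inord a; inord b; inord c],
    uniq [:: a; b; c] & [/\ a <= M, b <= M & c <= M]].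
Proof.
move=> lx; have xM := ltn_ord x; rewrite ltnS in xM.
have nx y : y <= M -> caterpillar x (inord y) = (nat_of_ord x != y)
    && ((y == caterpillar_parent M x) || (nat_of_ord x == caterpillar_parent M y)).
  by move=> yM; rewrite caterpillarE inordK.
have sets a b c : a <= M -> b <= M -> c <= M ->
    (forall y, y <= M -> caterpillar x (inord y) = [|| y == a, y == b | y == c]) ->
    [set y | caterpillar x y] = [set inord a; inord b; inord c].
  move=> aM bM cM h; apply/setP=> y; have yM := ltn_ord y; rewrite ltnS in yM.
  by rewrite !inE !eq_inord // -orbA -h // inord_val.
move: lx nx sets; rewrite /is_leaf; set S := [set y | _].
move: (caterpillar x) @S => adj_x S.
case: (parentP xM) => [xE|i i0 xE|i ik xE|xE|i ik xE|xE|i xE]; rewrite xE => lx nx sets.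
- by lia.
- by lia.
- have i0 : 0 < i by clear -lx; lia.
  clear lx; exists (4 * i + 2), (4 * i - 1), (4 * i); split.
  + exact: NodePair.
  + by apply: sets => [|||y yM]; [lia|lia|lia|rewrite nx // pair_adj].
  + by rewrite /= !inE; lia.
  + by split; lia.
- clear lx; exists (4 * k - 6), (4 * k - 5), (4 * k - 4); split.
  + exact: NodeRoot.
  + by apply: sets => [|||y yM]; [lia|lia|lia|rewrite nx // root_adj].
  + by rewrite /= !inE; lia.
  + by split; lia.
- have qE : caterpillar_parent M (4 * i + 2) = 4 * i + 6.
    by rewrite /caterpillar_parent; lia.
  clear lx; case: (posnP i) => i0.
    have nE : 4 * i + 2 = 2 by lia.
    exists (4 * i + 6), 0, 1; split.
    + by rewrite -qE nE; apply: NodeFirst.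
    + by apply: sets => [|||y yM]; [lia|lia|lia|rewrite nx // nE first_adj //; lia].
    + by rewrite /= !inE; lia.
    + by split; lia.
  exists (4 * i + 6), (4 * i - 2), (4 * i + 1); split.
  + by rewrite -qE; apply: NodeSpine => //; lia.
  + by apply: sets => [|||y yM]; [lia|lia|lia|rewrite nx // spine_adj //; lia].
  + by rewrite /= !inE; lia.
  + by split; lia.
- have [i iE] : exists i, k = i + 2 by exists (k - 2); lia.
  have xi : 4 * k - 6 = 4 * i + 2 by lia.
  have qE : caterpillar_parent M (4 * i + 2) = 4 * k - 3.
    by rewrite /caterpillar_parent; lia.
  clear lx; rewrite xi in nx *; case: (posnP i) => i0.
    have nE : 4 * i + 2 = 2 by lia.
    exists (4 * k - 3), 0, 1; split.
    + by rewrite -qE nE; apply: NodeFirst.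
    + by apply: sets => [|||y yM]; [lia|lia|lia|rewrite nx // nE first_adj //; lia].
    + by rewrite /= !inE; lia.
    + by split; lia.
  exists (4 * k - 3), (4 * i - 2), (4 * i + 1); split.
  + by rewrite -qE; apply: NodeSpine => //; lia.
  + by apply: sets => [|||y yM]; [lia|lia|lia|rewrite nx // spine_adj //; lia].
  + by rewrite /= !inE; lia.
  + by split; lia.
- by lia.
Qed.

Lemma leaves_caterpillar (x : 'I_M.+1) : (x \in leaves caterpillar) = is_leaf x.
Proof.
rewrite inE /degree; have [lx|lx] := boolP (is_leaf x).
  by rewrite leaf_neighbours // cards1.
have [a [b [c [_ -> /= /and3P[+ + _] [aM bM cM]]]]] := node_neighbours lx.
rewrite !inE negb_or => /andP[ab ac] bc.
have inj u v : u <= M -> v <= M -> u != v -> inord u != inord v :> 'I_M.+1.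
  by move=> uM vM; rewrite -val_eqE /= !inordK.
by rewrite -setUA cardsU1 !inE negb_or !inj // cards2 inj.
Qed.

Lemma caterpillar_cubic : cubic_tree caterpillar.
Proof.
split.
- exact: parent_tree_connected caterpillar_parent_gt caterpillar_parent_root.
- exact: parent_tree_acyclic caterpillar_parent_gt caterpillar_parent_root.
move=> x; rewrite leaves_caterpillar => lx; rewrite /degree.
have [a [b [c [_ -> /= /and3P[+ + _] [aM bM cM]]]]] := node_neighbours lx.
rewrite !inE negb_or => /andP[ab ac] bc.
have inj u v : u <= M -> v <= M -> u != v -> inord u != inord v :> 'I_M.+1.
  by move=> uM vM; rewrite -val_eqE /= !inordK.
by rewrite -setUA cardsU1 !inE negb_or !inj // cards2 inj.
Qed.

(** * Shores and width of the caterpillar *)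

Section Decomposition.
Variables (V : finType) (G : sgraph V) (x0 y0 : V) (p : V -> nat) (delta : 'I_M.+1 -> V).
Hypotheses (braceG : brace G) (cV : #|V| = 2 * k).
Hypothesis inv : search_inv G x0 y0 p #|V|.
Hypothesis p_delta : forall x, p (delta x) = position x.

Let p_inj : injective p.
Proof. by case: inv => /stamping_full[]. Qed.

Let p_range v : 0 < p v <= 2 * k.
Proof. by case: inv => /stamping_full[_ /(_ v)]; rewrite cV. Qed.

(** On the leaves, [position] is a bijection onto the numbers from 1 to [2 k], and so is [p] on the
    vertices. *)
Lemma caterpillar_decomposition : pm_decomposition caterpillar delta.
Proof.
split; first exact: caterpillar_cubic.
  move=> x y; rewrite !leaves_caterpillar => lx ly /(congr1 p); rewrite !p_delta => e.
  apply: val_inj => /=; move: lx ly e; rewrite /is_leaf /position.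
  by do 4?[case: eqP => ?]; lia.
apply/setP=> v; rewrite inE; apply/imsetP.
have pv := p_range v.
have [x [xM lx px]] : exists x, [/\ x <= M, is_leaf x & position x = p v].
  case o: (odd (p v)).
    have [->|n1] := eqVneq (p v) 1; first by exists 1; split=> //; lia.
    have [i e] : exists i, p v = 2 * i + 3 by exists ((p v - 3) %/ 2); lia.
    by exists (4 * i + 3); rewrite position3 /is_leaf; split; lia.
  have [i e] : exists i, p v = 2 * i + 2 by exists ((p v - 2) %/ 2); lia.
  by exists (4 * i); rewrite position0 /is_leaf; split; lia.
exists (inord x); first by rewrite leaves_caterpillar inordK.
by apply: p_inj; rewrite p_delta inordK.
Qed.

Notation node := (inord : nat -> 'I_M.+1).
Notation shore := (shore caterpillar delta).

Let deltaE x v : x <= M -> (v == delta (node x)) = (p v == position x).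
Proof.
move=> xM; apply/eqP/eqP => [->|e]; first by rewrite p_delta inordK.
by apply: p_inj; rewrite p_delta inordK.
Qed.

Let shore_leafE x y : x <= M -> is_leaf x -> caterpillar (node y) (node x) ->
  shore (node x) (node y) = [set v | p v == position x].
Proof.
move=> xM lx Tyx; rewrite (shore_leaf delta Tyx).
  by apply/setP=> v; rewrite !inE deltaE.
by rewrite leaves_caterpillar inordK.
Qed.

Let node_split x a b c : x <= M -> ~~ is_leaf x -> 
  (forall a' b' c', node_spec x a' b' c' -> [/\ a' = a, b' = b & c' = c]) ->
  [/\ caterpillar (node a) (node x), caterpillar (node x) (node b),
      caterpillar (node x) (node c)
    & shore (node x) (node a) = shore (node b) (node x) :|: shore (node c) (node x)].
Proof.
move=> xM lx h; have lx' : ~~ is_leaf (node x) by rewrite inordK.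
have [a' [b' [c' [sp nb un [aM bM cM]]]]] := node_neighbours lx'.
rewrite inordK // in sp; have [? ? ?] := h _ _ _ sp; subst a' b' c'.
have inj u v : u <= M -> v <= M -> u != v -> inord u != inord v :> 'I_M.+1.
  by move=> uM vM; rewrite -val_eqE /= !inordK.
have un' : uniq [:: node a; node b; node c].
  move: un; rewrite /= !inE !negb_or !andbT => /andP[/andP[ab ac] bc].
  by rewrite !inj.
have nbE y : caterpillar (node x) y = (y \in [set node a; node b; node c]).
  by rewrite -nb inE.
have [-> _] := shore_node caterpillar_decomposition nb un'.
by rewrite (adj_sym caterpillar) !nbE !inE !eqxx !orbT.
Qed.

Let pair_shore i : 0 < i -> i + 1 < k ->
  shore (node (4 * i + 1)) (node (4 * i + 2)) = [set v | 2 * i < p v <= 2 * i + 2].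
Proof.
move=> i0 ik; have [||| _ T1 T2 ->] := @node_split (4 * i + 1) (4 * i + 2) (4 * i - 1) (4 * i).
- by lia.
- by rewrite /is_leaf; lia.
- move=> a b c; case=> [j j0 jk e|e|e|j j0 jk e]; last by clear -e; lia.
  + by have -> : j = i by clear -e; lia.
  + by clear -e ik; lia.
  + by clear -e; lia.
have p1 : position (4 * i - 1) = 2 * i + 1.
  by rewrite (_ : 4 * i - 1 = 4 * (i - 1) + 3) ?position3; lia.
have p2 := position0 i.
rewrite !shore_leafE ?p1 ?p2 //; try (by rewrite /is_leaf; lia); try lia.
by apply/setP=> v; rewrite !inE; lia.
Qed.

(** The first spine node carries positions 1 and 2, and each further one adds the two positions of
    its pair node to the previous prefix. *)
Let spine_shore i : i + 1 < k ->
  shore (node (4 * i + 2)) (node (caterpillar_parent M (4 * i + 2))) = used p (2 * i + 2).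
Proof.
elim: i => [|i IH] ik.
  have [||| _ T1 T2 ->] := @node_split 2 (caterpillar_parent M 2) 0 1.
  - by lia.
  - by [].
  - by move=> a b c; case=> *; try (exfalso; lia); split.
  rewrite !shore_leafE //; try lia.
  by apply/setP=> v; rewrite !inE /position /=; lia.
set q := caterpillar_parent M _.
have [||| _ T1 T2 ->] := @node_split (4 * i.+1 + 2) q (4 * i.+1 - 2) (4 * i.+1 + 1).
- by lia.
- by rewrite /is_leaf; lia.
- rewrite /q => a b c.
  case=> [j j0 jk e|e|e|j j0 jk e]; first by clear -e; lia.
  + by clear -e k2; lia.
  + by clear -e; lia.
  by have -> : j = i.+1 by clear -e; lia.
rewrite pair_shore //.
have e : 4 * i.+1 - 2 = 4 * i + 2 by lia.
have qE : caterpillar_parent M (4 * i + 2) = 4 * i.+1 + 2.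
  by rewrite /caterpillar_parent; lia.
rewrite e -{1}qE IH; last by lia.
by apply/setP=> v; rewrite !inE; lia.
Qed.

(** Complementation leaves the edges from a node to its parent. Below a leaf or a pair node there
    are at most two vertices, below a spine node there is an even prefix of the search. *)
Lemma caterpillar_width : width G caterpillar delta <= 2.
Proof.
have V4 : 3 < #|V| by lia.
suff up x : x < M -> matching_porosity G
    (shore (node x) (node (caterpillar_parent M x))) <= 2.
  apply/bigmax_leqP=> -[s t] Tst; rewrite [_.1]/= [_.2]/=.
  have {}Tst : caterpillar s t by [].
  wlog lt : s t Tst / s < t.
    move=> h; case: (ltngtP s t) => [lt|lt|e]; first exact: h.
      have Tts : caterpillar t s by rewrite (adj_sym caterpillar).
      by rewrite (shoreC caterpillar_decomposition Tts) porosityC h.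
    by move: Tst; rewrite (val_inj e) (adj_irrefl caterpillar).
  have sM : s < M by have := ltn_ord t; lia.
  have /eqP tE : nat_of_ord t == caterpillar_parent M s.
    by rewrite -(parent_adjP caterpillar_parent_gt caterpillar_parent_root lt).
  by have := up s sM; rewrite -tE !inord_val.
move=> xM.
have pM : x < caterpillar_parent M x <= M by apply: caterpillar_parent_gt.
have Tx : caterpillar (node (caterpillar_parent M x)) (node x).
  by rewrite caterpillarE !inordK ?eqxx ?orbT ?andbT; lia.
have small (X : {set V}) : #|X| <= 2 -> matching_porosity G X <= 2.
  move=> X2; apply/porosity_leP=> f fm; apply: leq_trans X2.
  by apply: subset_leq_card; apply/subsetP=> v; rewrite inE => /andP[].
have [lx|lx] := boolP (is_leaf x).
  rewrite (shore_leaf delta Tx) ?small ?cards1 //.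
  by rewrite leaves_caterpillar inordK // ltnW.
have [[i xi]|[i xi]] : (exists i, x = 4 * i + 1) \/ (exists i, x = 4 * i + 2).
  move: lx; rewrite /is_leaf => lx; have := divn_eq x 4.
  case: (x %% 4) lx (ltn_pmod x (isT : 0 < 4)) => [|[|[|[|]]]] //=; rewrite ?orbT // => _ _ e;
  [left|right]; exists (x %/ 4); lia.
- have i0 : 0 < i by move: lx; rewrite /is_leaf; lia.
  have qE : caterpillar_parent M x = 4 * i + 2 by rewrite /caterpillar_parent; lia.
  rewrite qE xi pair_shore //; last by lia.
  have T1 : 4 * i <= M by lia.
  have T2 : 4 * i - 1 <= M by lia.
  apply: small; apply: leq_trans (_ : #|[set delta (node (4 * i)); delta (node (4 * i - 1))]| <= 2).
    apply: subset_leq_card; apply/subsetP=> v; rewrite !inE !deltaE // position0.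
    by rewrite (_ : 4 * i - 1 = 4 * (i - 1) + 3) ?position3; lia.
  by rewrite cards2; case: (_ != _).
rewrite xi spine_shore; last by lia.
by apply: (search_inv_porosity braceG V4 inv) => //; lia.
Qed.

End Decomposition.
End Caterpillar.

(** * Structured programs *)

Definition state : Type := (nat -> nat) * (nat -> nat).

Definition effect (i : instr) (s : state) : state :=
  match i with
  | Const r c => (upd s.1 r c, s.2)
  | Add r a b => (upd s.1 r (s.1 a + s.1 b), s.2)
  | Defs.Sub r a b => (upd s.1 r (s.1 a - s.1 b), s.2)
  | Read r a  => (upd s.1 r (s.2 (s.1 a)), s.2)
  | Write a r => (s.1, upd s.2 (s.1 a) (s.1 r))
  | Jump _ _  => s
  end.

(* [For r b c] runs [c] with register [r] counting down from the content of
   register [b] to 1. *)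
Inductive cmd :=
| Blk of seq instr
| Seq of cmd & cmd
| IfP of nat & cmd
| For of nat & nat & cmd.

Fixpoint run (c : cmd) (s : state) : state :=
  match c with
  | Blk l => foldl (fun s i => effect i s) s l
  | Seq c1 c2 => run c2 (run c1 s)
  | IfP r c => if 0 < s.1 r then run c s else s
  | For r b c => iter (s.1 b) (fun s => effect (Defs.Sub r r 1) (run c s))
                   (effect (Add r r b) (effect (Const r 0) s))
  end.

Fixpoint len (c : cmd) : nat :=
  match c with
  | Blk l => size l
  | Seq c1 c2 => len c1 + len c2
  | IfP _ c => 2 + len c
  | For _ _ c => 4 + len c + 2
  end.

(* Register 1 always holds 1, so that [Jump 1] is an unconditional jump. *)
Fixpoint code (c : cmd) (p : nat) : program :=
  match c with
  | Blk l => l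
  | Seq c1 c2 => code c1 p ++ code c2 (p + len c1)
  | IfP r c => [:: Jump r (p + 2); Jump 1 (p + 2 + len c)] ++ code c (p + 2)
  | For r b c =>
      [:: Const r 0; Add r r b; Jump r (p + 4); Jump 1 (p + 4 + len c + 2)]
      ++ code c (p + 4) ++ [:: Defs.Sub r r 1; Jump 1 (p + 2)]
  end.

Definition target (i : instr) : seq nat :=
  match i with
  | Const r _ | Add r _ _ | Defs.Sub r _ _ | Read r _ => [:: r]
  | Write _ _ | Jump _ _ => [::]
  end.

Fixpoint writes (c : cmd) : seq nat :=
  match c with
  | Blk l => flatten (map target l)
  | Seq c1 c2 => writes c1 ++ writes c2
  | IfP _ c => writes c
  | For r _ c => r :: writes c
  end.

Definition is_jump (i : instr) : bool := if i is Jump _ _ then true else false.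

(** Only registers 2 and 3 may bound a loop. They are never written by a command satisfying
    [keeps_constants], so the number of passes is bounded independently of the state. *)
Fixpoint well_formed (c : cmd) : bool :=
  match c with
  | Blk l => all (predC is_jump) l
  | Seq c1 c2 => well_formed c1 && well_formed c2
  | IfP _ c => well_formed c
  | For r b c => [&& b \in [:: 2; 3], r \notin writes c & well_formed c]
  end.

Definition keeps_constants (c : cmd) : bool := ~~ has (mem [:: 1; 2; 3]) (writes c).

(** A pass adds three instructions to the body: test, decrement and jump back. The remaining four
    set the counter and leave the loop. *)
Fixpoint cost (B : nat) (c : cmd) : nat :=
  match c with
  | Blk l => size l
  | Seq c1 c2 => cost B c1 + cost B c2
  | IfP _ c => 2 + cost B c
  | For _ _ c => 4 + B * (cost B c + 3)
  end.

Fixpoint cost_factor (c : cmd) : nat :=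
  match c with
  | Blk l => size l
  | Seq c1 c2 => cost_factor c1 + cost_factor c2
  | IfP _ c => 2 + cost_factor c
  | For _ _ c => 7 + cost_factor c
  end.

Fixpoint depth (c : cmd) : nat :=
  match c with
  | Blk l => 0
  | Seq c1 c2 => maxn (depth c1) (depth c2)
  | IfP _ c => depth c
  | For _ _ c => (depth c).+1
  end.

Lemma cost_poly B c : cost B c <= cost_factor c * B.+1 ^ depth c.
Proof.
elim: c => [l|c1 IH1 c2 IH2|r c IH|r b c IH] /=.
- by rewrite expn0 muln1.
- rewrite mulnDl leq_add //.
    by apply: leq_trans IH1 _; rewrite leq_mul2l leq_pexp2l ?leq_maxl ?orbT.
  by apply: leq_trans IH2 _; rewrite leq_mul2l leq_pexp2l ?leq_maxr ?orbT.
- by have := expn_gt0 B.+1 (depth c); nia.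
- rewrite expnS; have : 0 < B.+1 ^ depth c by rewrite expn_gt0.
  move: IH; set X := _ ^ _; set K := cost_factor c; set C := cost B c => h X0.
  by nia.
Qed.

Lemma size_code c p : size (code c p) = len c.
Proof.
elim: c p => [l|c1 IH1 c2 IH2|r c IH|r b c IH] p //=; rewrite ?size_cat ?IH1 ?IH2 ?IH //=.
Qed.

Lemma run_frame c s q : q \notin writes c -> (run c s).1 q = s.1 q.
Proof.
elim: c s => [l|c1 IH1 c2 IH2|r c IH|r b c IH] s /=.
- elim: l s => //= i l IHl s; rewrite mem_cat negb_or => /andP[qi /IHl->].
  by case: i qi => [r ?|r ? ?|r ? ?|r ?|? ?|? ?] //=; rewrite inE /upd => /negPf->.
- by rewrite mem_cat negb_or => /andP[h1 h2]; rewrite IH2 ?IH1.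
- by case: ifP => // _; apply: IH.
- rewrite inE negb_or => /andP[/negPf qr qc].
  by elim: (s.1 b) => [|k IHk]; rewrite /= /upd ?qr ?IH.
Qed.

(** * Correctness of the compilation *)

Definition at_pos (P : program) (p : nat) (l : program) : Prop :=
  exists pre post, P = pre ++ l ++ post /\ size pre = p.

Lemma at_pos_cat P p l1 l2 : at_pos P p (l1 ++ l2) ->
  at_pos P p l1 /\ at_pos P (p + size l1) l2.
Proof.
case=> pre [post [-> <-]]; split; first by exists pre, (l2 ++ post); rewrite -!catA.
by exists (pre ++ l1), post; rewrite size_cat -!catA.
Qed.

Lemma at_pos_cons P p i l : at_pos P p (i :: l) -> onth P p = Some i /\ at_pos P p.+1 l.
Proof.
case=> pre [post [-> <-]]; split.
  by elim: pre => //= a pre ->.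
by exists (rcons pre i), post; rewrite size_rcons cat_rcons.
Qed.

Definition at_state (p : nat) (s : state) : config := Config p s.1 s.2.

Lemma step_effect P p i s : onth P p = Some i -> ~~ is_jump i ->
  step P (at_state p s) = at_state p.+1 (effect i s).
Proof. by rewrite /step /= => ->; case: i. Qed.

Lemma step_jump P p r l s : onth P p = Some (Jump r l) ->
  step P (at_state p s) = at_state (if 0 < s.1 r then l else p.+1) s.
Proof. by rewrite /step /= => ->. Qed.

Lemma reach_trans P a b c t1 t2 : iter t1 (step P) a = b -> iter t2 (step P) b = c ->
  iter (t1 + t2) (step P) a = c.
Proof. by move=> <- <-; rewrite addnC iterD. Qed.

Lemma blk_correct P l p s : at_pos P p l -> all (predC is_jump) l ->
  iter (size l) (step P) (at_state p s) = at_state (p + size l) (run (Blk l) s).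
Proof.
elim: l p s => [|i l IH] p s /=; first by rewrite addn0.
case/at_pos_cons=> e a /andP[ji jl].
by rewrite -iterS iterSr (step_effect _ e ji) IH // addSnnS.
Qed.

Lemma compile_correct B P c p s : at_pos P p (code c p) -> well_formed c ->
    keeps_constants c -> s.1 1 = 1 -> s.1 2 <= B -> s.1 3 <= B ->
  exists2 t, t <= cost B c &
    iter t (step P) (at_state p s) = at_state (p + len c) (run c s).
Proof.
rewrite /keeps_constants.
elim: c p s => [l|c1 IH1 c2 IH2|r c IH|r b c IH] p s /=.
- by move=> a w _ _ _ _; exists (size l) => //; apply: blk_correct.
- case/at_pos_cat=> a1 a2 /andP[w1 w2]; rewrite has_cat negb_or => /andP[k1 k2] s1 s2 s3.
  have kc q : q \in [:: 1; 2; 3] -> (run c1 s).1 q = s.1 q.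
    by move=> hq; apply: run_frame; apply: contra k1 => h; apply/hasP; exists q.
  have [t1 le1 e1] := IH1 _ _ a1 w1 k1 s1 s2 s3.
  rewrite size_code in a2.
  have [||| t2 le2 e2] := IH2 _ (run c1 s) a2 w2 k2; rewrite ?kc ?inE //.
  by exists (t1 + t2); [lia | rewrite (reach_trans e1 e2) addnA].
- case/at_pos_cons=> e1 /at_pos_cons[e2 a] w k s1 s2 s3.
  case: ifP => [h|h].
    have [|t le e] := IH (p + 2) s _ w k s1 s2 s3; first by rewrite {1}addn2.
    exists (1 + t); first by lia.
    apply: reach_trans (_ : iter 1 _ _ = at_state (p + 2) s) _.
      by rewrite /= (step_jump _ e1) h.
    by rewrite e addnA.
  exists 2; first by lia.
  by rewrite /= (step_jump _ e1) h (step_jump _ e2) s1 addnA.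
- rewrite -[Const r 0 :: _]/([:: Const r 0; Add r r b; Jump r (p + 4);
    Jump 1 (p + 4 + len c + 2)] ++ _) => a.
  have [a1 a2] := at_pos_cat a; have {a2} [a2 a3] := at_pos_cat a2.
  rewrite /= size_code in a2 a3.
  have [e1 b1] := at_pos_cons a1; have [e2 b2] := at_pos_cons b1.
  have [e3 b3] := at_pos_cons b2; have [e4 _] := at_pos_cons b3.
  have [e5 b5] := at_pos_cons a3; have [e6 _] := at_pos_cons b5.
  case/and3P=> bin rc w; rewrite negb_or => /andP[r123 k] s1 s2 s3.
  have kc q s' : q \in [:: 1; 2; 3] -> (run c s').1 q = s'.1 q.
    by move=> hq; apply: run_frame; apply: contra k => h; apply/hasP; exists q.
  have rq q : q \in [:: 1; 2; 3] -> (q == r) = false.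
    by move=> hq; apply: contraNF r123 => /eqP<-.
  set s0 := effect (Add r r b) (effect (Const r 0) s).
  have sb : s.1 b <= B by move: bin; rewrite !inE => /orP[] /eqP->.
  have br : (b == r) = false by apply: rq; move: bin; rewrite !inE => /orP[] ->; rewrite ?orbT.
  have s0r : s0.1 r = s.1 b by rewrite /s0 /= /upd !eqxx br.
  have s0q q : q \in [:: 1; 2; 3] -> s0.1 q = s.1 q.
    by move=> hq; rewrite /s0 /= /upd !rq.
  (* The claim starts at the test, after the counter has been set, so that induction on the counter
     applies. *)
  suff loop n s' : s'.1 r = n -> s'.1 1 = 1 -> s'.1 2 <= B -> s'.1 3 <= B ->
      exists2 t, t <= 2 + n * (cost B c + 3) & iter t (step P) (at_state (p + 2) s') =
      at_state (p + 4 + len c + 2) (iter n (fun s => effect (Defs.Sub r r 1) (run c s)) s').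
    have [|||| t le e] := loop (s.1 b) s0; rewrite ?(s0q 1) ?(s0q 2) ?(s0q 3) //.
    exists (2 + t).
      have := leq_mul2r (cost B c + 3) (s.1 b) B; rewrite sb orbT => h; lia.
    apply: reach_trans (_ : iter 2 _ _ = at_state (p + 2) s0) _.
      by rewrite /= (step_effect _ e1) // (step_effect _ e2) // addn2.
    by rewrite e !addnA.
  elim: n s' => [|n IHn] s' rn s'1 s'2 s'3.
    exists 2 => //=; rewrite addn2 (step_jump _ e3) rn /= (step_jump _ e4) s'1.
    by rewrite !addn2 !addn4.
  have [|t le e] := IH (p + 4) s' _ w k s'1 s'2 s'3; first exact: a2.
  set s2' := effect (Defs.Sub r r 1) (run c s').
  have q2 q : q \in [:: 1; 2; 3] -> s2'.1 q = s'.1 q.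
    by move=> hq; rewrite /s2' /= /upd rq // kc.
  have [|||| t' le' e'] := IHn s2'; rewrite ?(q2 1) ?(q2 2) ?(q2 3) //.
    by rewrite /s2' /= /upd eqxx run_frame // rn kc // s'1 subn1.
  exists (1 + (t + (2 + t'))); first by lia.
  apply: reach_trans (_ : iter 1 _ _ = at_state (p + 4) s') _.
    by rewrite /= addn2 (step_jump _ e3) rn.
  apply: reach_trans e _; apply: reach_trans (_ : iter 2 _ _ = at_state (p + 2) s2') _.
    rewrite /= (step_effect _ e5) // (step_jump _ e6) -/s2' q2 // s'1.
    done.
  by rewrite e' iterSr.
Qed.

(* The state [s'] that a loop reaches before an iteration agrees with the
   initial state on all registers that the loop does not write. *)
Lemma for_ind (I : nat -> state -> Prop) r b c s :
    s.1 1 = 1 -> 1 \notin r :: writes c -> b != r -> r \notin writes c ->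
    I (s.1 b) (upd (upd s.1 r 0) r (s.1 b), s.2) ->
    (forall k s', k < s.1 b -> s'.1 r = k.+1 ->
      (forall q, q \notin r :: writes c -> s'.1 q = s.1 q) -> I k.+1 s' ->
      I k (upd (run c s').1 r k, (run c s').2)) ->
  I 0 (run (For r b c) s).
Proof.
move=> s1 n1 br rc I0 IS; rewrite /=.
set s0 := (_, _); set F := fun s => _.
have br' : (b == r) = false by apply: negbTE.
have s0E : s0 = (upd (upd s.1 r 0) r (s.1 b), s.2).
  by rewrite /s0 /=; congr (upd _ _ _, _); rewrite /upd eqxx br'.
rewrite s0E {s0E}; clear s0; set s0 := (upd _ _ _, _) in I0 *.
suff H j : j <= s.1 b -> [/\ (iter j F s0).1 r = s.1 b - j,
    (forall q, q \notin r :: writes c -> (iter j F s0).1 q = s.1 q)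
    & I (s.1 b - j) (iter j F s0)].
  by have [_ _] := H (s.1 b) (leqnn _); rewrite subnn.
elim: j => [|j IHj] jb.
  rewrite subn0; split=> //; first by rewrite /s0 /= /upd eqxx.
  by move=> q; rewrite inE negb_or /s0 /= /upd => /andP[/negPf-> _].
have [e fr Ij] := IHj (ltnW jb); rewrite iterS; set s' := iter j F s0 in e fr Ij *.
have FE : F s' = (upd (run c s').1 r (s.1 b - j.+1), (run c s').2).
  rewrite /F /=; congr (upd _ _ _, _).
  rewrite run_frame // e run_frame; last by move: n1; rewrite inE negb_or => /andP[].
  by rewrite fr // s1 subn1 subnS.
rewrite FE; split.
- by rewrite /= /upd eqxx.
- move=> q hq; rewrite /= /upd; move: (hq); rewrite inE negb_or => /andP[/negPf-> qc].
  by rewrite run_frame // fr.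
- apply: IS => //; first by lia.
    by rewrite e; lia.
  by rewrite (_ : (s.1 b - j.+1).+1 = s.1 b - j) //; lia.
Qed.

(** * The search program *)

(* Registers: 2 holds n, 3 holds 2 n - 2, 4 holds the base F of the stamps (the
   stamp of vertex v is stored at F + v + 1), 5 and 6 the starting pair, 8 the
   visited vertex, 9 a second vertex and 10 the number of used vertices.  All
   vertices held in registers are shifted by one. *)

(** Offset of a matrix row by repeated addition. Adding a second vertex, shifted by one, then also
    skips the input cell that holds [n]. *)
Definition row_cmd : cmd :=
  Seq (Blk [:: Const 11 0])
    (Seq (For 12 2 (Blk [:: Add 11 11 8])) (Blk [:: Defs.Sub 11 11 2])).

(** The truncated difference of adjacency bit and stamp is 1 exactly for a fresh neighbour. *)
Definition count_cmd : cmd :=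
  For 9 2 (Blk [:: Add 12 11 9; Read 13 12; Add 12 4 9; Read 12 12;
                   Defs.Sub 13 13 12; Add 14 14 13]).

Definition stamp_cmd : cmd :=
  For 9 2 (Seq (Blk [:: Add 12 11 9; Read 13 12; Add 12 4 9; Read 15 12; Defs.Sub 13 13 15])
             (IfP 13 (Blk [:: Add 10 10 1; Write 12 10]))).

Definition visit_cmd : cmd :=
  Seq (Blk [:: Add 12 4 8; Read 12 12; Defs.Sub 12 1 12])
    (IfP 12
       (Seq row_cmd
          (Seq (Blk [:: Const 14 0])
             (Seq count_cmd
                (Seq (Blk [:: Const 15 2; Defs.Sub 15 15 14])
                   (IfP 15
                      (Seq (Blk [:: Add 10 10 1; Add 12 4 8; Write 12 10])
                         stamp_cmd))))))).

Definition round_cmd : cmd := For 8 2 visit_cmd.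

Definition try_cmd : cmd :=
  Seq (For 9 2 (Blk [:: Add 12 4 9; Const 13 0; Write 12 13]))
    (Seq (Blk [:: Add 12 4 5; Write 12 1; Const 10 2; Add 12 4 6; Write 12 10])
       (For 7 2 round_cmd)).

(** Once register 10 has reached [n], the remaining passes attempt no pair, so the stamps of the
    successful pair survive. Each unordered pair is tried only with the larger vertex in register
    5. *)
Definition search_cmd : cmd :=
  For 5 2 (For 6 2
    (Seq (Blk [:: Defs.Sub 12 2 10])
       (IfP 12 (Seq (Blk [:: Defs.Sub 12 5 6]) (IfP 12 try_cmd))))).

(** Loops count down, so their invariants count the vertices from the current one upwards. *)
Lemma card_ge_step n (S : {set 'I_n}) (v : 'I_n) :
  #|[set w in S | v <= w]| = (v \in S) + #|[set w in S | v < w]|.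
Proof.
rewrite (cardsD1 v) !inE leqnn andbT; congr (_ + _); apply: eq_card => w.
by rewrite !inE ltn_neqAle -val_eqE /= eq_sym; case: (w \in S); rewrite ?andbF ?andbT.
Qed.

Lemma card_ge0 n (S : {set 'I_n}) : #|[set w in S | 0 <= w]| = #|S|.
Proof. by apply: eq_card => w; rewrite !inE andbT. Qed.

Lemma card_gen n (S : {set 'I_n}) : #|[set w in S | n <= w]| = 0.
Proof. by apply: eq_card0 => w; rewrite !inE leqNgt ltn_ord andbF. Qed.

Section SearchProgram.
Variables (n : nat) (G : sgraph 'I_n) (F : nat).
Hypothesis nF : n * n < F.

Definition env (s : state) : Prop :=
  [/\ s.1 1 = 1, s.1 2 = n, s.1 4 = F
    & forall u v : 'I_n, s.2 (1 + u * n + v) = G u v].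

Definition stamps (s : state) (v : 'I_n) : nat := s.2 (F + v.+1).

(** Protects the adjacency matrix, which lies below the stamps. *)
Definition same_low (s s' : state) : Prop := forall a, a <= F -> s'.2 a = s.2 a.

Lemma adj_addr (u v : 'I_n) : 1 + u * n + v <= F.
Proof. by have := ltn_ord u; have := ltn_ord v; nia. Qed.

Lemma env_frame c s : env s -> same_low s (run c s) ->
  ~~ has (mem [:: 1; 2; 4]) (writes c) -> env (run c s).
Proof.
case=> s1 s2 s4 sG low w.
have fr q : q \in [:: 1; 2; 4] -> (run c s).1 q = s.1 q.
  by move=> hq; apply: run_frame; apply: contra w => h; apply/hasP; exists q.
split; rewrite ?fr ?inE //.
by move=> u v; rewrite low ?adj_addr.
Qed.

Lemma run_row s : s.1 1 = 1 -> s.1 2 = n ->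
  (run row_cmd s).1 11 = n * s.1 8 - n /\ (run row_cmd s).2 = s.2.
Proof.
move=> s1 s2; rewrite /row_cmd; set L := For _ _ _.
set s0 := run (Blk [:: Const 11 0]) s.
pose I k (s' : state) := s'.1 11 + k * s.1 8 = n * s.1 8 /\ s'.2 = s.2.
have [e1 e2] : I 0 (run L s0).
  apply: (@for_ind I) => //.
    by rewrite /I /= /upd /= s2.
  move=> k s' kn _ fr [e1 e2]; rewrite /I /= /upd /=; split=> //.
  by rewrite (fr 8) //= /upd /=; lia.
rewrite -[run _ s]/(run (Blk [:: Defs.Sub 11 11 2]) (run L s0)).
have e3 : (run L s0).1 2 = n by rewrite run_frame.
by move: (run L s0) e1 e2 e3 => s3 e1 e2 e3; rewrite /= /upd /= e3; split; [lia|].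
Qed.

Lemma run_count s (u : 'I_n) : env s -> s.1 11 = n * u.+1 - n -> s.1 14 = 0 ->
  (run count_cmd s).1 14 = #|fresh G (stamps s) u| /\ (run count_cmd s).2 = s.2.
Proof.
case=> s1 s2 s4 sG s11 s14.
pose I k (s' : state) := s'.1 14 = #|[set w in fresh G (stamps s) u | k <= w]|
  /\ s'.2 = s.2.
have [e1 e2] : I 0 (run count_cmd s).
  apply: (@for_ind I) => //; first by rewrite /I; rewrite /= /upd /= s2 card_gen.
  move=> k s' kn e fr [e1 e2]; rewrite s2 in kn; rewrite /I /= /upd /= e2; split=> //.
  rewrite (fr 11) // (fr 4) // s11 s4 e e1.
  have -> : n * u.+1 - n + k.+1 = 1 + u * n + Ordinal kn by rewrite /=; lia.
  rewrite sG (card_ge_step _ (Ordinal kn)) inE /stamps /= addnC.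
  by case: (G _ _); case: (s.2 _).
by rewrite e1 card_ge0.
Qed.

Lemma run_stamp s (u : 'I_n) p c : env s -> s.1 11 = n * u.+1 - n ->
    #|fresh G p u| <= 1 -> s.1 10 = c.+1 -> p u = 0 ->
    (forall v, stamps s v = if v == u then c.+1 else p v) ->
  [/\ (run stamp_cmd s).1 10 = c.+1 + #|fresh G p u|,
      (forall v, stamps (run stamp_cmd s) v =
         if v == u then c.+1 else if v \in fresh G p u then c.+2 else p v)
    & same_low s (run stamp_cmd s)].
Proof.
case=> s1 s2 s4 sG s11 f1 s10 pu sp.
pose I k (s' : state) := [/\ s'.1 10 = c.+1 + #|[set w in fresh G p u | k <= w]|,
    (forall v, stamps s' v = if v == u then c.+1
       else if (v \in fresh G p u) && (k <= v) then c.+2 else p v)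
    & same_low s s'].
have [e1 e2 e3] : I 0 (run stamp_cmd s).
  apply: (@for_ind I) => //.
    split; rewrite /= ?/upd /= ?s2 ?card_gen ?s10 ?addn0 // => v.
    by rewrite [n <= v]leqNgt ltn_ord andbF -sp.
  move=> k s' kn e fr [e1 e2 e3]; rewrite s2 in kn; set v := Ordinal kn.
  set b := Blk _; set s2' := run b s'.
  have E13 : s2'.1 13 = (v \in fresh G p u).
    rewrite /s2' /b /= /upd /= (fr 11) // (fr 4) // s11 s4 e.
    have -> : n * u.+1 - n + k.+1 = 1 + u * n + v by rewrite /=; lia.
    rewrite e3 ?adj_addr // sG -[s'.2 (F + k.+1)]/(stamps s' v) e2 /= inE /=.
    (* The stamp of [u] itself has already changed, but [u] is not its own neighbour. *)
    have [->|vu] := eqVneq v u; first by rewrite (adj_irrefl G).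
    rewrite ltnn andbF; case: (G u v); last by [].
    by case: (p v).
  have E12 : s2'.1 12 = F + v.+1 by rewrite /s2' /b /= /upd /= (fr 4) // s4 e.
  have E10 : s2'.1 10 = s'.1 10 by [].
  have E2 : s2'.2 = s'.2 by [].
  have E1 : s2'.1 1 = 1 by rewrite /s2' /b /= /upd /= fr.
  rewrite -[run (Seq b _) s']/(run (IfP 13 (Blk [:: Add 10 10 1; Write 12 10])) s2').
  clearbody s2'; rewrite /= E13; have st := card_ge_step (fresh G p u) v.
  rewrite /= in st; case vf: (v \in fresh G p u) => /=; last first.
    rewrite vf in st; split.
    - by rewrite /= /upd /= E10 e1 st.
    - move=> w; rewrite /stamps /= E2 -/(stamps s' w) e2; case: eqP => // _.
      case wf: (w \in fresh G p u) => //=; rewrite [k <= w]leq_eqVlt.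
      case: eqP => // kw; have e4 : v = w by apply: val_inj.
      by rewrite e4 wf in vf.
    - by move=> a aF; rewrite /= E2 e3.
  (* There is at most one fresh vertex, so the counter is still [c.+1] when it is met. *)
  have c0 : #|[set w in fresh G p u | k < w]| = 0.
    have le : #|[set w in fresh G p u | k <= w]| <= #|fresh G p u|.
      by apply: subset_leq_card; apply/subsetP=> w; rewrite inE => /andP[].
    by move: (leq_trans le f1); rewrite st vf add1n ltnS leqn0 => /eqP.
  have others w : w \in fresh G p u -> w = v.
    by move=> wf; move: f1 => /card_le1P/(_ v vf w); rewrite wf => /esym/eqP.
  have vu : v != u by apply: contraTneq vf => ->; apply: fresh_irrefl.
  split.
  - by rewrite /= /upd /= E10 E1 e1 c0 st vf c0; lia.
  - move=> w; rewrite /stamps /= /upd E12 E10 E1 E2 e1 c0 /= addn0 addn1.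
    rewrite eqn_add2l eqSS; have [->|nw] := eqVneq w v.
      by rewrite eqxx (negPf vu) vf leqnn.
    have -> : (nat_of_ord w == k) = false by apply/negbTE; apply: contra nw.
    rewrite -/(stamps s' w) e2; case: eqP => // _.
    by case wf: (w \in fresh G p u) => //; rewrite (others w wf) eqxx in nw.
  - by move=> a aF; rewrite /= /upd E12 E2 ltn_eqF ?e3 // addnS ltnS (leq_trans aF (leq_addr _ _)).
split=> //; first by rewrite e1 card_ge0.
by move=> v; rewrite e2 andbT.
Qed.

Lemma run_visit s (u : 'I_n) : env s -> s.1 8 = u.+1 ->
  visits G u (stamps s) (s.1 10) (stamps (run visit_cmd s)) ((run visit_cmd s).1 10)
  /\ same_low s (run visit_cmd s).
Proof.
move=> es s8; have [s1 s2 s4 sG] := es.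
rewrite /visit_cmd; set b := Blk _; set rest := Seq row_cmd _.
rewrite -[run _ s]/(run (IfP 12 rest) (run b s)); set s0 := run b s.
have E12 : s0.1 12 = 1 - stamps s u.
  by rewrite /s0 /b /= /upd /= s1 s4 s8.
have E2 : s0.2 = s.2 by [].
have E10 : s0.1 10 = s.1 10 by [].
have E8 : s0.1 8 = u.+1 by [].
have es0 : env s0 by split.
have st0 : stamps s0 =1 stamps s by [].
clearbody s0; rewrite /visits /candidate.
have -> : run (IfP 12 rest) s0 = if 0 < s0.1 12 then run rest s0 else s0 by [].
rewrite E12.
case: (posnP (stamps s u)) => pu; last first.
  have -> : 1 - stamps s u = 0 by lia.
  by rewrite ltnn; split=> [|a _]; [split | rewrite E2].
have [z1 z2 z4 zG] := es0; rewrite pu subn0 [0 < 1]/= /rest.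
set q := run row_cmd s0.
have [q11 q2] : q.1 11 = n * u.+1 - n /\ q.2 = s.2.
  by have [] := run_row z1 z2; rewrite E8 -E2.
have q10 : q.1 10 = s.1 10 by rewrite /q run_frame.
have q8 : q.1 8 = u.+1 by rewrite /q run_frame.
have eq : env q by apply: env_frame => // a _; rewrite -/q q2 E2.
rewrite -[run _ s0]/(run (Seq count_cmd (Seq (Blk [:: Const 15 2; Defs.Sub 15 15 14])
  (IfP 15 (Seq (Blk [:: Add 10 10 1; Add 12 4 8; Write 12 10]) stamp_cmd))))
  (run (Blk [:: Const 14 0]) q)).
set q' := run _ q.
have eq' : env q' by apply: env_frame.
have [||r14 r2] := run_count (s := q') (u := u) eq'; [by []|by []|].
have r11 : (run count_cmd q').1 11 = n * u.+1 - n by rewrite run_frame.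
have r10 : (run count_cmd q').1 10 = s.1 10 by rewrite run_frame.
have r8 : (run count_cmd q').1 8 = u.+1 by rewrite run_frame.
have er : env (run count_cmd q') by apply: env_frame => // a _; rewrite r2.
rewrite -[run _ q']/(run (Seq (Blk [:: Const 15 2; Defs.Sub 15 15 14])
  (IfP 15 (Seq (Blk [:: Add 10 10 1; Add 12 4 8; Write 12 10]) stamp_cmd)))
  (run count_cmd q')).
have fE : fresh G (stamps q') u = fresh G (stamps s) u.
  by apply/setP=> v; rewrite !inE /stamps -[q'.2]/q.2 q2.
have r2' : (run count_cmd q').2 = s.2 by rewrite r2 -[q'.2]/q.2 q2.
rewrite fE in r14.
move: (run count_cmd q') r14 r2' r11 r10 r8 er => r r14 {}r2 r11 r10 r8 er.
rewrite -[run _ r]/(run (IfP 15 (Seq (Blk [:: Add 10 10 1; Add 12 4 8; Write 12 10]) stamp_cmd))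
  (run (Blk [:: Const 15 2; Defs.Sub 15 15 14]) r)).
set t := run _ r.
have t15 : t.1 15 = 2 - #|fresh G (stamps s) u| by rewrite -r14.
have et : env t by apply: env_frame.
have t10 : t.1 10 = s.1 10 by rewrite -r10.
have t11 : t.1 11 = n * u.+1 - n by rewrite -r11.
have t8 : t.1 8 = u.+1 by rewrite -r8.
have t2 : t.2 = s.2 by rewrite -r2.
clearbody t; clear r r14 r2 r11 r10 r8 er.
set S := fresh G (stamps s) u in t15 *; 
have -> : run (IfP 15 (Seq (Blk [:: Add 10 10 1; Add 12 4 8; Write 12 10]) stamp_cmd)) t =
   if 0 < t.1 15 then run stamp_cmd (run (Blk [:: Add 10 10 1; Add 12 4 8; Write 12 10]) t)
   else t by [].
rewrite t15; case: (leqP #|S| 1) => S1; last first.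
  have -> : (0 < 2 - #|S|) = false by lia.
  by split=> [|a _]; [split=> // v; rewrite /stamps t2 | rewrite t2].
have -> : (0 < 2 - #|S|) = true by lia.
set w := run (Blk _) t.
have [w1 w2 w4 wG] := et.
have wE2 : w.2 = upd s.2 (F + u.+1) (s.1 10).+1.
  by rewrite /w /= /upd /= w1 w4 t8 t10 t2 addn1.
have ew : env w.
  apply: env_frame => // a aF; rewrite -/w wE2 t2 /upd ltn_eqF //.
  by rewrite addnS ltnS (leq_trans aF (leq_addr _ _)).
have w11 : w.1 11 = n * u.+1 - n by rewrite -t11.
have w10 : w.1 10 = (s.1 10).+1 by rewrite /w /= /upd /= w1 t10 addn1.
have wst v : stamps w v = if v == u then (s.1 10).+1 else stamps s v.
  by rewrite /stamps wE2 /upd eqn_add2l eqSS.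
have [v10 vst vlow] := run_stamp ew w11 S1 w10 pu wst.
split; last first.
  by move=> a aF; rewrite vlow // wE2 /upd ltn_eqF // addnS ltnS (leq_trans aF (leq_addr _ _)).
split.
- by rewrite v10 addn1.
- by rewrite vst eqxx.
- move=> v vS; rewrite vst vS; case: eqP => // e.
  by move: vS; rewrite e (negPf (fresh_irrefl _ _ _)).
- by move=> v vu vS; rewrite vst (negPf vu) (negPf vS).
Qed.

Lemma env_low s s' : env s -> same_low s s' ->
  (forall q, q \in [:: 1; 2; 4] -> s'.1 q = s.1 q) -> env s'.
Proof.
by case=> s1 s2 s4 sG low fr; split; rewrite ?fr // => u v; rewrite low ?adj_addr.
Qed.

Lemma same_low_trans s1 s2 s3 : same_low s1 s2 -> same_low s2 s3 -> same_low s1 s3.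
Proof. by move=> h1 h2 a aF; rewrite h2 // h1. Qed.

Lemma eq_candidate (p p' : 'I_n -> nat) u : p =1 p' -> candidate G p u = candidate G p' u.
Proof.
move=> e; rewrite /candidate e; congr (_ && (_ <= _)).
by apply: eq_card => w; rewrite !inE e.
Qed.

Hypotheses (braceG : brace G) (n4 : 3 < n).
Let V4 : 3 < #|'I_n|. Proof. by rewrite card_ord. Qed.

Definition closed_stamps (p : 'I_n -> nat) : Prop := forall u, ~~ candidate G p u.

Lemma run_round s x y : env s -> search_inv G x y (stamps s) (s.1 10) ->
  let s' := run round_cmd s in
  [/\ same_low s s', search_inv G x y (stamps s') (s'.1 10),
      closed_stamps (stamps s) -> closed_stamps (stamps s')
    & s.1 10 < s'.1 10 \/ closed_stamps (stamps s')].
Proof.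
move=> es inv; pose I k (s' : state) := [/\ same_low s s',
  search_inv G x y (stamps s') (s'.1 10),
  closed_stamps (stamps s) -> stamps s' =1 stamps s
  & s.1 10 < s'.1 10 \/ [/\ stamps s' =1 stamps s, s'.1 10 = s.1 10
      & forall u : 'I_n, k <= u -> ~~ candidate G (stamps s) u]].
have [s1 s2 s4 sG] := es.
have [low inv' cl prog] : I 0 (run round_cmd s).
  apply: (@for_ind I) => //.
    split=> //; right; split=> // u; rewrite s2 => nu.
    by have := ltn_ord u; rewrite ltnNge nu.
  move=> k s' kn e8 fr [low inv' cl prog]; rewrite s2 in kn.
  have es' : env s'.
    apply: env_low es low _ => q hq; apply: fr.
    by move: hq; rewrite !inE => /or3P[] /eqP->.
  have [vis low'] := run_visit (u := Ordinal kn) es' e8.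
  set s2' := (_, _); rewrite -[stamps (run _ _)]/(stamps s2') in vis.
  rewrite -[(run _ _).1 10]/(s2'.1 10) in vis.
  split.
  - exact: same_low_trans low low'.
  - exact: search_inv_visits inv' vis.
  - move=> c v; move: vis; rewrite /visits (eq_candidate _ (cl c)) (negPf (c _)).
    by case=> _ ->; apply: cl.
  - have mono : s'.1 10 <= s2'.1 10.
      by move: vis; rewrite /visits; case: ifP => _ [-> *]; lia.
    case: prog => [lt|[st c10 nc]]; first by left; apply: leq_trans mono.
    move: vis; rewrite /visits; case: ifP => [_ [-> *]|ncand [-> st']].
      by left; rewrite c10; lia.
    right; split=> // [v|u]; first by rewrite st' st.
    rewrite leq_eqVlt => /orP[/eqP e|]; last exact: nc.
    by rewrite -(eq_candidate _ st) (_ : u = Ordinal kn) ?ncand //; apply: val_inj.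
split=> //; first by move=> c u; rewrite (eq_candidate _ (cl c)); apply: c.
case: prog => [|[st _ nc]]; [by left|right=> u].
by rewrite (eq_candidate _ st) nc.
Qed.

Lemma search_inv_le x y (p : 'I_n -> nat) c : search_inv G x y p c -> c <= n.
Proof. by case=> -[_ _ _ _ ->] _ _; rewrite -[X in _ <= X]card_ord max_card. Qed.

(** The count starts at two, never exceeds [n] and grows in every round until the stamps are closed,
    so [n] rounds are enough. *)
Lemma run_rounds s x y : env s -> search_inv G x y (stamps s) (s.1 10) ->
  let s' := run (For 7 2 round_cmd) s in
  [/\ same_low s s', search_inv G x y (stamps s') (s'.1 10)
    & closed_stamps (stamps s')].
Proof.
move=> es inv; pose I k (s' : state) := [/\ same_low s s',
  search_inv G x y (stamps s') (s'.1 10)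
  & n < s'.1 10 + k \/ closed_stamps (stamps s')].
have [s1 s2 s4 sG] := es; have c2 : 2 <= s.1 10.
  by case: inv => /stamping_ge2.
have [low inv' cl] : I 0 (run (For 7 2 round_cmd) s).
  apply: (@for_ind I) => //.
    by split=> //; left; rewrite s2 /= /upd /=; lia.
  move=> k s' kn e7 fr [low inv' cl].
  have es' : env s'.
    apply: env_low es low _ => q hq; apply: fr.
    by move: hq; rewrite !inE => /or3P[] /eqP->.
  have [low2 inv2 cl2 prog2] := run_round es' inv'.
  set s2' := (_, _).
  have c10 : s2'.1 10 = (run round_cmd s').1 10 by [].
  split=> //; first exact: same_low_trans low low2.
  case: cl => [lt|/cl2]; last by right.
  by case: prog2 => [lt2|]; [left; rewrite c10; lia|right].
split=> //; case: cl => //.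
by have := search_inv_le inv'; rewrite addn0 leqNgt => /negPf->.
Qed.

Lemma run_try s (x y : 'I_n) : env s -> s.1 5 = x.+1 -> s.1 6 = y.+1 -> x != y ->
  let s' := run try_cmd s in
  [/\ same_low s s', search_inv G x y (stamps s') (s'.1 10)
    & closed_stamps (stamps s')].
Proof.
move=> es s5 s6 xy; have [s1 s2 s4 sG] := es.
pose I k (s' : state) := same_low s s' /\ forall v : 'I_n, k <= v -> stamps s' v = 0.
pose cl := For 9 2 (Blk [:: Add 12 4 9; Const 13 0; Write 12 13]).
pose b := Blk [:: Add 12 4 5; Write 12 1; Const 10 2; Add 12 4 6; Write 12 10].
have [low0 clr] : I 0 (run cl s).
  apply: (@for_ind I) => //.
    by split=> // v; rewrite s2 leqNgt ltn_ord.
  move=> k t kn e fr [low st]; split.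
    move=> a aF; rewrite /= /upd /= (fr 4) // s4 e ltn_eqF ?low //.
    by rewrite addnS ltnS (leq_trans aF (leq_addr _ _)).
  move=> v kv; rewrite /stamps /= /upd /= (fr 4) // s4 e eqn_add2l eqSS.
  case: eqP => // ne; apply: st; rewrite ltn_neqAle kv andbT.
  by apply/eqP=> e'; apply: ne.
have e1 : env (run cl s) by apply: env_frame.
have c5 : (run cl s).1 5 = x.+1 by rewrite run_frame.
have c6 : (run cl s).1 6 = y.+1 by rewrite run_frame.
rewrite -[run try_cmd s]/(run (For 7 2 round_cmd) (run b (run cl s))).
move: (run cl s) low0 clr e1 c5 c6 => t low0 clr et t5 t6.
have [t1 t2 t4 tG] := et.
set w := run b t.
have w2 a : w.2 a = if a == F + y.+1 then 2 else if a == F + x.+1 then 1 else t.2 a.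
  by rewrite /w /= /upd /= t4 t5 t6 t1.
have lw : same_low t w.
  move=> a aF; rewrite w2 !ltn_eqF // addnS ltnS (leq_trans aF (leq_addr _ _)) //.
have ew : env w by apply: env_frame.
have inv : search_inv G x y (stamps w) (w.1 10).
  apply: search_inv_start => //.
  - by rewrite /stamps w2 eqn_add2l eqSS val_eqE (negPf xy) eqxx.
  - by rewrite /stamps w2 eqxx.
  - move=> v vx vy; rewrite /stamps w2 !eqn_add2l !eqSS !val_eqE (negPf vx) (negPf vy).
    by apply: clr.
have [lowr invr clr'] := run_rounds ew inv; split=> //.
exact: same_low_trans (same_low_trans low0 lw) lowr.
Qed.

(** Evidence left by a stuck search, to be refuted by [search_complete] for a suitable pair. *)
Definition pair_fails (x y : 'I_n) : Prop :=
  exists p c, [/\ search_inv G x y p c, closed_stamps p & c <> n].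

Lemma run_search s : env s -> s.1 10 < n ->
  let s' := run search_cmd s in
  [/\ same_low s s', s'.1 10 <= n,
      s'.1 10 = n -> exists x y, search_inv G x y (stamps s') n
    & s'.1 10 <> n -> forall x y : 'I_n, y < x -> pair_fails x y].
Proof.
move=> es c0; have [s1 s2 s4 sG] := es.
pose good (s' : state) := [/\ same_low s s', s'.1 10 <= n
  & s'.1 10 = n -> exists x y, search_inv G x y (stamps s') n].
pose I k (s' : state) := good s' /\
  (s'.1 10 <> n -> forall x y : 'I_n, k <= x -> y < x -> pair_fails x y).
have [[low le ok] fl] : I 0 (run search_cmd s).
  apply: (@for_ind I) => //.
    split; first by split=> //=; rewrite /upd /=; lia.
    by move=> _ x y; rewrite s2 leqNgt ltn_ord.
  move=> k s' kn e5 fr [[low le ok] fl]; rewrite s2 in kn.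
  set inner := For 6 2 _.
  have es' : env s'.
    apply: env_low es low _ => q hq; apply: fr.
    by move: hq; rewrite !inE => /or3P[] /eqP->.
  have [s1' s2' s4' sG'] := es'.
  pose J j (t : state) := good t /\ (t.1 10 <> n ->
    (forall x y : 'I_n, k < x -> y < x -> pair_fails x y) /\
    (forall y : 'I_n, j <= y -> y < k -> pair_fails (Ordinal kn) y)).
  have [[low1 le1 ok1] fl1] : J 0 (run inner s').
    apply: (@for_ind J) => //.
      split; first by split.
      move=> ne; split=> [x y|y]; first exact: fl.
      by rewrite s2' leqNgt ltn_ord.
    move=> j t jn e6 frt [[lowt let_ okt] flt]; rewrite s2' in jn.
    have et : env t.
      apply: env_low es lowt _ => q hq; rewrite -fr; last first.
        by move: hq; rewrite !inE => /or3P[] /eqP->.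
      by apply: frt; move: hq; rewrite !inE => /or3P[] /eqP->.
    have [t1 t2 t4 tG] := et.
    have e5t : t.1 5 = k.+1 by rewrite frt.
    set body := Seq _ _.
    have bE : run body t = if 0 < n - t.1 10 then
        (if 0 < k - j then run try_cmd (run (Blk [:: Defs.Sub 12 5 6])
            (run (Blk [:: Defs.Sub 12 2 10]) t))
         else run (Blk [:: Defs.Sub 12 5 6]) (run (Blk [:: Defs.Sub 12 2 10]) t))
        else run (Blk [:: Defs.Sub 12 2 10]) t.
      rewrite -[k - j]subSS -t2 -e5t -e6 -[LHS]/(run (IfP 12 (Seq (Blk [:: Defs.Sub 12 5 6])
        (IfP 12 try_cmd))) (run (Blk [:: Defs.Sub 12 2 10]) t)).
      by [].
    rewrite bE; case: ifP => cn; last first.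
      split; first by split.
      by move=> ne; exfalso; apply: ne; rewrite /= /upd /=; lia.
    have ne : t.1 10 <> n by lia.
    have [fl1 fl2] := flt ne.
    case: ifP => kj; last first.
      split; first by split.
      move=> _; split=> // y jy yk; apply: fl2 => //; lia.
    set w := run _ (run _ t).
    have ew : env w by apply: (env_low et) => // q; rewrite !inE => /or3P[] /eqP->.
    have [||| low2 inv2 cl2] := run_try (x := Ordinal kn) (y := Ordinal jn) ew.
    - by rewrite -e5t.
    - by rewrite -e6.
    - by rewrite -val_eqE /=; lia.
    set z := run try_cmd w in low2 inv2 cl2 *.
    split; first split.
    - exact: same_low_trans lowt low2.
    - exact: search_inv_le inv2.
    - by move=> zn; exists (Ordinal kn), (Ordinal jn); rewrite -[n in search_inv _ _ _ _ n]zn.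
    move=> zn; split=> // y; rewrite leq_eqVlt => /orP[/eqP jy _|]; last exact: fl2.
    exists (stamps z), (z.1 10); split=> //.
    by rewrite (_ : y = Ordinal jn) //; apply: val_inj.
  split; first by split.
  move=> ne x y kx; have [f1 f2] := fl1 ne.
  case: (ltngtP k x) kx => // [kx _|kx _]; first exact: f1.
  by rewrite (_ : x = Ordinal kn); [apply: f2|apply: val_inj].
split=> // ne x y; exact: fl.
Qed.

End SearchProgram.

(** * The output program *)

(* Register 20 holds the argument z, 21 becomes z mod 4 and 22 becomes 2 (z / 4);
   since z < 4 n, it is enough to subtract 4 at most n times. *)
Definition divmod_cmd : cmd :=
  Seq (Blk [:: Const 21 0; Add 21 21 20; Const 22 0])
    (For 23 2 (Blk [:: Const 24 3; Defs.Sub 24 21 24; Defs.Sub 24 1 24; Defs.Sub 24 1 24;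
       Defs.Sub 21 21 24; Defs.Sub 21 21 24; Defs.Sub 21 21 24; Defs.Sub 21 21 24;
       Add 22 22 24; Add 22 22 24])).

(** With truncated subtraction, [1 - (c - r)] is 1 exactly when [c <= r], and [a - (a - b)] is the
    minimum of [a] and [b]. *)
Definition parent_cmd : cmd :=
  Seq divmod_cmd
    (Blk [:: Const 25 1; Defs.Sub 26 1 20; Add 25 25 26;
       Const 26 2; Defs.Sub 26 26 21; Defs.Sub 26 1 26;
       Add 25 25 26; Add 25 25 26; Add 25 25 26;
       Const 26 3; Defs.Sub 26 26 21; Defs.Sub 26 1 26;
       Defs.Sub 25 25 26; Defs.Sub 25 25 26;
       Add 25 25 20; Defs.Sub 26 3 1; Defs.Sub 26 25 26; Defs.Sub 25 25 26]).

Definition position_cmd : cmd :=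
  Seq divmod_cmd
    (Seq (Blk [:: Const 25 1; Defs.Sub 26 1 21])
       (Seq (IfP 26 (Blk [:: Const 25 2; Add 25 25 22]))
          (Seq (Blk [:: Const 26 2; Defs.Sub 26 21 26])
             (IfP 26 (Blk [:: Const 25 3; Add 25 25 22]))))).

(** Equality of [a] and [b] is [1 - ((a - b) + (b - a))]. Two parent tests are added, then twice the
    test for the diagonal is subtracted. Off the diagonal at most one parent test succeeds, as no
    parent is smaller than its child. *)
Definition bit_blk : cmd :=
  Blk [:: Defs.Sub 28 6 1; Defs.Sub 29 28 27; Defs.Sub 30 27 28; Add 29 29 30;
          Defs.Sub 29 1 29; Defs.Sub 28 5 1; Defs.Sub 31 28 25; Defs.Sub 30 25 28;
          Add 31 31 30; Defs.Sub 31 1 31; Add 29 29 31; Defs.Sub 31 5 6;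
          Defs.Sub 30 6 5; Add 31 31 30; Defs.Sub 31 1 31; Defs.Sub 29 29 31;
          Defs.Sub 29 29 31; Defs.Sub 16 16 1].

(** The loop counters decrease, so the matrix is written backwards; register 16 points just above
    the next cell. *)
Definition cell_cmd : cmd :=
  Seq (Blk [:: Defs.Sub 20 5 1])
    (Seq parent_cmd
       (Seq (Blk [:: Const 27 0; Add 27 27 25; Defs.Sub 20 6 1])
          (Seq parent_cmd
             (Seq bit_blk
                (Blk [:: Write 16 29]))))).

Definition delta_cmd : cmd :=
  Seq (Blk [:: Defs.Sub 20 5 1])
    (Seq position_cmd
       (Seq (Blk [:: Defs.Sub 16 16 1])
          (For 9 2
             (Seq (Blk [:: Add 12 4 9; Read 12 12; Defs.Sub 13 12 25; Defs.Sub 12 25 12;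
                     Add 12 12 13; Defs.Sub 12 1 12])
                (IfP 12 (Blk [:: Defs.Sub 13 9 1; Write 16 13])))))).

(** The input graph may be overwritten: only the stamps, which lie above [F], are still needed. *)
Definition output_cmd : cmd :=
  Seq (Blk [:: Const 17 0])
    (Seq (For 5 3 (Blk [:: Add 17 17 3]))
       (Seq (Blk [:: Const 12 0; Write 12 3; Add 16 17 1])
          (Seq (For 5 3 (For 6 3 cell_cmd))
             (Seq (Blk [:: Add 16 17 1; Add 16 16 3; Const 0 0; Add 0 0 16])
                (For 5 3 delta_cmd))))).

(* Plain simplification would duplicate the register file at each step. *)
Ltac eval_reg e := let v := eval lazy -[addn subn] in e in change e with v.

Lemma run_Seq c1 c2 s : run (Seq c1 c2) s = run c2 (run c1 s).
Proof. by []. Qed.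

Lemma run_blk_mem l s : ~~ has (fun i => if i is Write _ _ then true else false) l ->
  (run (Blk l) s).2 = s.2.
Proof. by elim: l s => //= i l IH s; rewrite negb_or => /andP[+ /IH->]; case: i. Qed.

Section OutputProgram.
Variables (n m F : nat).
Hypotheses (n2 : 1 < n) (mE : m = 2 * n - 2) (FE : m * m + m < F).

Definition consts (s : state) : Prop :=
  [/\ s.1 1 = 1, s.1 2 = n, s.1 3 = m & s.1 4 = F].

Lemma consts_frame s s' : consts s ->
  (forall q, q \in [:: 1; 2; 3; 4] -> s'.1 q = s.1 q) -> consts s'.
Proof. by case=> s1 s2 s3 s4 fr; split; rewrite fr. Qed.

Lemma run_divmod s z : consts s -> s.1 20 = z -> z < m ->
  [/\ (run divmod_cmd s).1 21 = z %% 4, (run divmod_cmd s).1 22 = 2 * (z %/ 4)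
    & (run divmod_cmd s).2 = s.2].
Proof.
case=> s1 s2 s3 s4 sz zm.
pose I k (t : state) := [/\ t.2 = s.2, t.1 21 < 4 * k.+1
  & exists j, t.1 21 + 4 * j = z /\ t.1 22 = 2 * j].
rewrite /divmod_cmd; set b := Blk _; set L := For _ _ _.
rewrite -[run _ s]/(run L (run b s)).
have [e2 lt [j [e21 e22]]] : I 0 (run L (run b s)).
  apply: (@for_ind I) => //.
    split=> //; first by rewrite /= /upd /= sz; lia.
    by exists 0; rewrite /= /upd /= sz; lia.
  move=> k t kn e fr [e2 lt [j [e21 e22]]]; have t1 : t.1 1 = 1 by rewrite fr.
  set c := Blk _; have w2 : (run c t).2 = s.2 by rewrite -e2.
  have w21 : (run c t).1 21 = t.1 21 - 4 * (3 < t.1 21).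
    move: t1 {e fr e2 lt e21 e22 w2}; case: t => g h; rewrite -[(g, h).1]/g => g1.
    by eval_reg ((run c (g, h)).1 21); rewrite g1; lia.
  have w22 : (run c t).1 22 = t.1 22 + 2 * (3 < t.1 21).
    move: t1 {e fr e2 lt e21 e22 w2 w21}; case: t => g h; rewrite -[(g, h).1]/g => g1.
    by eval_reg ((run c (g, h)).1 22); rewrite g1; lia.
  move: (run c t) w2 w21 w22 => w w2 w21 w22.
  rewrite /I -[(_, _).1 21]/(w.1 21) -[(_, _).1 22]/(w.1 22) w21 w22.
  split=> //; first by lia.
  exists (j + (3 < t.1 21)).
  by case: (ltnP 3 (t.1 21)) => h /=; split; lia.
by split=> //; lia.
Qed.

Lemma run_parent s z : consts s -> s.1 20 = z -> z < m ->
  (run parent_cmd s).1 25 = caterpillar_parent m.-1 z /\ (run parent_cmd s).2 = s.2.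
Proof.
move=> cs sz zm; have [e21 e22 e2] := run_divmod cs sz zm.
rewrite /parent_cmd; set b := Blk _; rewrite -[run _ s]/(run b (run divmod_cmd s)).
have e20 : (run divmod_cmd s).1 20 = z by rewrite run_frame.
have e1 : (run divmod_cmd s).1 1 = 1 by rewrite run_frame //; case: cs.
have e3 : (run divmod_cmd s).1 3 = m by rewrite run_frame //; case: cs.
move: (run divmod_cmd s) e21 e22 e2 e20 e1 e3 => t e21 e22 e2 e20 e1 e3.
split; last by rewrite -e2.
move: e1 e20 e3 e21 {e22 e2}; case: t => g h; rewrite -[(g, h).1]/g => g1 g20 g3 g21.
eval_reg ((run b (g, h)).1 25); rewrite g1 g20 g3 g21 /caterpillar_parent.
have := ltn_pmod z (isT : 0 < 4).
by clear -zm; case: (z %% 4) => [|[|[|[|r]]]] //= _; lia.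
Qed.

Lemma run_position s z : consts s -> s.1 20 = z -> z < m ->
  (run position_cmd s).1 25 = position z /\ (run position_cmd s).2 = s.2.
Proof.
move=> cs sz zm; have [e21 e22 e2] := run_divmod cs sz zm.
have e1 : (run divmod_cmd s).1 1 = 1 by rewrite run_frame //; case: cs.
rewrite /position_cmd; set rest := Seq (Blk _) _.
rewrite -[run _ s]/(run rest (run divmod_cmd s)).
move: (run divmod_cmd s) e21 e22 e2 e1 => t e21 e22 e2 e1.
rewrite /position; have := ltn_pmod z (isT : 0 < 4); rewrite -e21.
case E: (t.1 21) => [|[|[|[|r]]]] // _.
all: move: e1 e2 e22 E; case: t {e21} => g h; rewrite -[(g, h).1]/g => g1 e2 g22 E.
all: rewrite /rest /= /upd /= !g1 !E /= ?E ?g1 /= ?g22 -?e2 ?[2 * _ + _]addnC; by split.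
Qed.

Definition tree_bit (x y : nat) : nat :=
  (x != y) && ((y == caterpillar_parent m.-1 x) || (x == caterpillar_parent m.-1 y)).

Lemma run_bit t x y : x < m -> y < m -> t.1 1 = 1 -> t.1 5 = x.+1 -> t.1 6 = y.+1 ->
    t.1 27 = caterpillar_parent m.-1 x -> t.1 25 = caterpillar_parent m.-1 y ->
  (run bit_blk t).1 29 = tree_bit x y.
Proof.
case: t => g h; rewrite -[(g, h).1]/g => xm ym g1 g5 g6 t27 p2.
eval_reg ((run bit_blk (g, h)).1 29); rewrite g1 g5 g6 p2 t27 /tree_bit.
have xr : x <= m.-1 by lia.
have yr : y <= m.-1 by lia.
have : y <= caterpillar_parent m.-1 y.
  by clear -yr; rewrite /caterpillar_parent; lia.
have : x <= caterpillar_parent m.-1 x.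
  by clear -xr; rewrite /caterpillar_parent; lia.
move: (caterpillar_parent m.-1 x) (caterpillar_parent m.-1 y) => px py hx hy.
clear -hx hy; rewrite !subn1 !succnK subSS [y.+1 - x.+1]subSS.
case: (eqVneq x y) => [e|nxy] /=; first by lia.
case: (eqVneq y px) => [e1|n1] /=; first by lia.
by case: (eqVneq x py) => [e2|n2] /=; lia.
Qed.

Lemma run_bit_addr t : t.1 1 = 1 -> (run bit_blk t).1 16 = t.1 16 - 1.
Proof.
case: t => g h; rewrite -[(g, h).1]/g => g1.
by eval_reg ((run bit_blk (g, h)).1 16); rewrite g1.
Qed.

Lemma run_cell s x y : consts s -> s.1 5 = x.+1 -> s.1 6 = y.+1 -> x < m -> y < m ->
  (run cell_cmd s).1 16 = s.1 16 - 1 /\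
  (run cell_cmd s).2 =1 upd s.2 (s.1 16 - 1) (tree_bit x y).
Proof.
move=> cs s5 s6 xm ym; rewrite /cell_cmd 5!run_Seq.
have [s1 _ _ _] := cs.
have f0 q : q != 20 -> (run (Blk [:: Defs.Sub 20 5 1]) s).1 q = s.1 q.
  by move=> q20; rewrite run_frame // inE.
have e20 : (run (Blk [:: Defs.Sub 20 5 1]) s).1 20 = x.
  by rewrite /= /upd /= s5 s1 subn1.
have em : (run (Blk [:: Defs.Sub 20 5 1]) s).2 = s.2 by rewrite run_blk_mem.
move: (run (Blk [:: Defs.Sub 20 5 1]) s) f0 e20 em => t f0 e20 em.
have ct : consts t.
  by apply: consts_frame cs _ => q; rewrite !inE => /or4P[] /eqP->; apply: f0.
have [p1 m1] := run_parent ct e20 xm.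
have f1 q : q \in [:: 1; 2; 3; 4; 5; 6; 16] -> (run parent_cmd t).1 q = s.1 q.
  move=> hq; rewrite -f0; last by apply: contraTneq hq => ->.
  by apply: run_frame; apply: contraTN hq; move: q; apply/allP.
move: (run parent_cmd t) p1 m1 f1 {f0 e20 ct} => t1 p1 m1 f1.
have f2 q : q \in [:: 1; 2; 3; 4; 5; 6; 16] ->
    (run (Blk [:: Const 27 0; Add 27 27 25; Defs.Sub 20 6 1]) t1).1 q = s.1 q.
  move=> hq; rewrite -f1 //; apply: run_frame; apply: contraTN hq.
  by move: q; apply/allP.
have e20 : (run (Blk [:: Const 27 0; Add 27 27 25; Defs.Sub 20 6 1]) t1).1 20 = y.
  by rewrite /= /upd /= !f1 // s6 s1 subn1.
have e27 : (run (Blk [:: Const 27 0; Add 27 27 25; Defs.Sub 20 6 1]) t1).1 27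
    = caterpillar_parent m.-1 x by rewrite /= /upd /= p1.
have m2 : (run (Blk [:: Const 27 0; Add 27 27 25; Defs.Sub 20 6 1]) t1).2 = s.2.
  by rewrite run_blk_mem // m1.
move: (run (Blk _) t1) f2 e20 e27 m2 {f1 p1 m1 em t} => t f1 e20 e27 em.
have ct : consts t.
  by apply: consts_frame cs _ => q; rewrite !inE => /or4P[] /eqP->; apply: f1.
have [p2 m2] := run_parent ct e20 ym.
have f2 q : q \in [:: 1; 5; 6; 16] -> (run parent_cmd t).1 q = s.1 q.
  move=> hq; rewrite -f1; last by move: q hq; apply/allP.
  by apply: run_frame; apply: contraTN hq; move: q; apply/allP.
have t27 : (run parent_cmd t).1 27 = caterpillar_parent m.-1 x by rewrite run_frame.
move: (run parent_cmd t) p2 m2 f2 t27 {f1 e20 e27 ct t1} => t2 p2 m2 f2 t27.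
have g1 : t2.1 1 = 1 by rewrite f2.
have e16 : (run bit_blk t2).1 16 = s.1 16 - 1 by rewrite run_bit_addr // f2.
have e29 : (run bit_blk t2).1 29 = tree_bit x y by apply: run_bit => //; rewrite f2.
have e2 : (run bit_blk t2).2 = s.2 by rewrite run_blk_mem // m2.
move: (run bit_blk t2) e16 e29 e2 => w e16 e29 e2.
by split=> // a; rewrite /= e16 e29 e2.
Qed.

Lemma run_matrix s : consts s -> s.1 16 = m * m + 1 ->
  let s' := run (For 5 3 (For 6 3 cell_cmd)) s in
  (forall x y, x < m -> y < m -> s'.2 (1 + x * m + y) = tree_bit x y) /\
  (forall a, a = 0 \/ m * m < a -> s'.2 a = s.2 a).
Proof.
move=> cs s16; have [s1 s2 s3 s4] := cs.
pose cell a := tree_bit ((a - 1) %/ m) ((a - 1) %% m).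
pose done_from b (t : state) := [/\ t.1 16 = b,
  (forall a, b <= a -> a <= m * m -> t.2 a = cell a)
  & (forall a, a = 0 \/ m * m < a -> t.2 a = s.2 a)].
pose I k := done_from (1 + k * m).
have [e16 ec es] : I 0 (run (For 5 3 (For 6 3 cell_cmd)) s).
  apply: (@for_ind I) => //.
    split=> //; rewrite ?s3; first by rewrite [LHS]s16 addnC.
    by move=> a h1 h2; lia.
  move=> k t km e5 fr It; rewrite s3 in km.
  have ct : consts t.
    by apply: consts_frame cs _ => q hq; apply: fr; move: hq; rewrite !inE => /or4P[] /eqP->.
  have [t1 t2 t3 t4] := ct.
  pose J j := done_from (1 + k * m + j).
  set inner := For 6 3 cell_cmd.
  suff : J 0 (run inner t) by rewrite /J addn0 => -[].
  apply: (@for_ind J) => //.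
    case: It => i1 i2 i3; have E : 1 + k * m + m = 1 + k.+1 * m by lia.
    by rewrite /J t3 E; split.
  move=> j w jm e6 frw [w16 wc ws]; rewrite t3 in jm.
  have cw : consts w.
    by apply: consts_frame ct _ => q hq; apply: frw; move: hq; rewrite !inE => /or4P[] /eqP->.
  have w5 : w.1 5 = k.+1 by rewrite frw.
  have [z16 z2] := run_cell cw w5 e6 km jm.
  rewrite w16 addnS subn1 succnK in z16 z2.
  move: (run cell_cmd w) z16 z2 => z z16 z2.
  have am : k * m + j < m * m by nia.
  split=> //.
  - move=> a ge le; rewrite [_.2]/= z2 /upd; case: eqP => [->|ne]; last by apply: wc => //; lia.
    rewrite /cell (_ : 1 + k * m + j - 1 = k * m + j); last by lia.
    rewrite divnMDl ?modnMDl; last by lia.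
    by rewrite divn_small ?modn_small ?addn0.
  - move=> a ha; rewrite [_.2]/= z2 /upd; case: eqP => [ea|_]; last exact: ws.
    by exfalso; lia.
split=> // x y xm ym; rewrite ec; try nia.
rewrite /cell (_ : 1 + x * m + y - 1 = x * m + y); last by lia.
rewrite divnMDl ?modnMDl; last by lia.
by rewrite divn_small ?modn_small ?addn0.
Qed.

Variable p : 'I_n -> nat.
Hypothesis p_inj : injective p.
Hypothesis p_surj : forall x, x < m -> exists v, p v = position x.

(** Injectivity of [p] means that a single vertex is found, and the bound on register 16 keeps the
    written cell below the stamps being scanned. *)
Lemma run_delta s x : consts s -> (forall v, stamps F s v = p v) -> s.1 5 = x.+1 -> x < m ->
    s.1 16 <= F ->
  let s' := run delta_cmd s in
  [/\ s'.1 16 = s.1 16 - 1,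
      (forall a, a != s.1 16 - 1 -> s'.2 a = s.2 a)
    & exists v : 'I_n, p v = position x /\ s'.2 (s.1 16 - 1) = v].
Proof.
move=> cs sp s5 xm lt; have [s1 _ _ _] := cs.
rewrite /delta_cmd; set b1 := Blk [:: Defs.Sub 20 5 1]; set L := For _ _ _.
rewrite 3!run_Seq.
have c1 : consts (run b1 s).
  by apply: consts_frame cs _ => q hq; apply: run_frame; move: hq; rewrite !inE => /or4P[] /eqP->.
have [||p1 m1] := @run_position (run b1 s) x c1; first by rewrite /= /upd /= s5 s1 subn1.
  by [].
have f1 q : q \in [:: 1; 2; 3; 4; 16] -> (run position_cmd (run b1 s)).1 q = s.1 q.
  by rewrite !inE => /or4P[/eqP->|/eqP->|/eqP->|/orP[]/eqP->]; rewrite run_frame // run_frame.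
move: (run position_cmd _) p1 m1 f1 => t p1 m1 f1.
have {}m1 : t.2 = s.2 by rewrite m1 run_blk_mem.
have r25 : (run (Blk [:: Defs.Sub 16 16 1]) t).1 25 = position x by rewrite run_frame.
have r16 : (run (Blk [:: Defs.Sub 16 16 1]) t).1 16 = s.1 16 - 1.
  by rewrite /= /upd /= !f1 // s1.
have r2 : (run (Blk [:: Defs.Sub 16 16 1]) t).2 = s.2 by rewrite run_blk_mem.
have cr : consts (run (Blk [:: Defs.Sub 16 16 1]) t).
  apply: consts_frame cs _ => q; rewrite !inE => hq.
  by case/or4P: hq => /eqP->; rewrite run_frame // f1.
move: (run (Blk [:: Defs.Sub 16 16 1]) t) r25 r16 r2 cr => r r25 r16 r2 cr.
clear t p1 m1 f1; have [q1 q2 q3 q4] := cr.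
set a0 := s.1 16 - 1 in r16 *.
pose I k (w : state) := (forall a, a != a0 -> w.2 a = s.2 a) /\
  (forall v : 'I_n, k <= v -> p v = position x -> w.2 a0 = v).
have [i1 i2] : I 0 (run L r).
  apply: (@for_ind I) => //.
    split=> [a _|v]; first by rewrite -r2.
    by rewrite q2 leqNgt ltn_ord.
  move=> k w kn e9 fr [i1 i2]; rewrite q2 in kn.
  set b := Blk _; set c := IfP _ _.
  rewrite run_Seq.
  have w12 : (run b w).1 12 = (p (Ordinal kn) == position x).
    have w4 : w.1 4 = F by rewrite fr.
    have w25 : w.1 25 = position x by rewrite fr.
    have w1 : w.1 1 = 1 by rewrite fr.
    have pk : w.2 (F + k.+1) = p (Ordinal kn) by rewrite -sp i1 // /a0; lia.
    move: w1 w4 w25 e9 pk; case: w {fr i1 i2} => g h.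
    rewrite -[(g, h).1]/g -[(g, h).2]/h => g1 g4 g25 g9 hk.
    eval_reg ((run b (g, h)).1 12); rewrite g1 g4 g25 g9 hk.
    by clear; case: eqP; lia.
  have w16 : (run b w).1 16 = a0 by rewrite run_frame // fr.
  have w9 : (run b w).1 9 = k.+1 by rewrite run_frame.
  have w1 : (run b w).1 1 = 1 by rewrite run_frame // fr.
  have w2 : (run b w).2 = w.2 by rewrite run_blk_mem.
  move: (run b w) w12 w16 w9 w1 w2 => z z12 z16 z9 z1 z2.
  rewrite /c /= z12; case: eqP => pe /=; last first.
    rewrite z2; split=> // v kv pv; apply: i2 => //; rewrite ltn_neqAle kv andbT.
    by apply/eqP=> e; apply: pe; rewrite -pv; congr (p _); apply: val_inj.
  rewrite /upd /= z9 z1 z16 z2 subSS subn0; split.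
    by move=> a ne /=; rewrite (negPf ne) i1.
  move=> v kv pv /=; rewrite eqxx.
  by rewrite (_ : v = Ordinal kn) //; apply: p_inj; rewrite pv.
split=> //; first by rewrite run_frame.
by have [v pv] := p_surj xm; exists v; split=> //; apply: i2.
Qed.

Lemma run_output s : consts s -> (forall v, stamps F s v = p v) ->
  let s' := run output_cmd s in
  [/\ s'.1 0 = 1 + m * m + m, s'.2 0 = m,
      (forall x y, x < m -> y < m -> s'.2 (1 + x * m + y) = tree_bit x y)
    & forall x, x < m -> exists v : 'I_n, p v = position x /\ s'.2 (1 + m * m + x) = v].
Proof.
move=> cs sp; have [s1 s2 s3 s4] := cs.
rewrite /output_cmd; set b1 := Blk [:: Const 17 0]; set L1 := For 5 3 (Blk _).
set b2 := Blk [:: Const 12 0; _; _]; set L2 := For 5 3 (For _ _ _).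
set b3 := Blk [:: Add 16 17 1; _; _; _]; set L3 := For 5 3 delta_cmd.
rewrite 5!run_Seq.
have [e17 e2] : s.1 3 * m = (run L1 (run b1 s)).1 17 + 0 * m /\ (run L1 (run b1 s)).2 = s.2.
  pose I k (t : state) := s.1 3 * m = t.1 17 + k * m /\ t.2 = s.2.
  suff : I 0 (run L1 (run b1 s)) by [].
  apply: (@for_ind I) => // k t km e5 fr [i1 i2]; split; last by [].
  by rewrite /= /upd /= (fr 3) // -[(run b1 s).1 3]/(s.1 3) s3; rewrite s3 in i1; lia.
have f1 q : q \in [:: 1; 2; 3; 4] -> (run L1 (run b1 s)).1 q = s.1 q.
  by rewrite !inE => /or4P[] /eqP->; rewrite run_frame // run_frame.
rewrite s3 addn0 in e17.
move: (run L1 _) e17 e2 f1 => t e17 e2 f1.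
have ct : consts t by apply: consts_frame cs f1.
have [t1 t2 t3 t4] := ct.
have r16 : (run b2 t).1 16 = m * m + 1 by rewrite /= /upd /= -e17 t1.
have r17 : (run b2 t).1 17 = m * m by rewrite /= /upd /= -e17.
have rm a : (run b2 t).2 a = if a == 0 then m else s.2 a.
  by rewrite /= /upd /= t3 e2.
have cr : consts (run b2 t).
  by apply: consts_frame ct _ => q; rewrite !inE => /or4P[] /eqP->.
move: (run b2 t) r16 r17 rm cr => r r16 r17 rm cr.
have [mx ml] := run_matrix cr r16; rewrite -/L2 in mx ml.
have f2 q : q \in [:: 1; 2; 3; 4; 17] -> (run L2 r).1 q = r.1 q.
  by rewrite !inE => /or4P[/eqP->|/eqP->|/eqP->|/orP[]/eqP->]; rewrite run_frame.
have c2 : consts (run L2 r).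
  apply: consts_frame cr _ => q hq; apply: f2; move: hq.
  by rewrite !inE => /or4P[] ->; rewrite ?orbT.
have e17' : (run L2 r).1 17 = m * m by rewrite f2.
move: (run L2 r) mx ml c2 e17' {f2} => w mx ml cw w17.
have [w1 w2 w3 w4] := cw.
have z0 : (run b3 w).1 0 = 1 + m * m + m by rewrite /= /upd /= w17 w1 w3; lia.
have z16 : (run b3 w).1 16 = 1 + m * m + m by rewrite /= /upd /= w17 w1 w3; lia.
have zm : (run b3 w).2 = w.2 by [].
have cz : consts (run b3 w).
  by apply: consts_frame cw _ => q; rewrite !inE => /or4P[] /eqP->.
move: (run b3 w) z0 z16 zm cz => z z0 z16 zm cz.
have zF a : m * m < a -> z.2 a = s.2 a.
  by move=> lt; rewrite zm ml ?rm; [rewrite gtn_eqF // (leq_ltn_trans _ lt) | right].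
have [y1 y2 y3 y4] := cz.
pose I k (t' : state) := [/\ t'.1 16 = 1 + m * m + k,
  (forall a, a <= m * m \/ F <= a -> t'.2 a = z.2 a)
  & forall x, k <= x -> x < m ->
     exists v : 'I_n, p v = position x /\ t'.2 (1 + m * m + x) = v].
have [_ i2 i3] : I 0 (run L3 z).
  apply: (@for_ind I) => //.
    by split=> //; rewrite y3 // => x h1 h2; lia.
  move=> k u km e5 fr [i1 i2 i3]; rewrite y3 in km.
  have cu : consts u.
    by apply: consts_frame cz _ => q hq; apply: fr; move: hq; rewrite !inE => /or4P[] /eqP->.
  have su v : stamps F u v = p v.
    by rewrite -sp /stamps i2 ?zF //; [lia | right; rewrite leq_addr].
  have [|j1 j2 j3] := run_delta cu su e5 km; first by rewrite i1; lia.
  move: (run delta_cmd u) j1 j2 j3 => w' j1 j2 j3.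
  rewrite i1 addnS subn1 succnK in j1 j2 j3.
  split; rewrite [_.2]/=.
  - by rewrite [LHS]j1.
  - by move=> a ha; rewrite j2 ?i2 //; lia.
  - move=> x; rewrite leq_eqVlt => /orP[/eqP<- //|kx xm].
    by have [v [pv ev]] := i3 x kx xm; exists v; split=> //; rewrite j2 //; lia.
have f3 : (run L3 z).1 0 = z.1 0 by rewrite run_frame.
move: (run L3 z) i2 i3 f3 => o i2 i3 o0; split=> //.
- by rewrite o0.
- by rewrite i2 ?zm ?ml ?rm //; left.
- move=> x y xm ym; rewrite i2 ?zm ?mx //; left.
  by nia.
- by move=> x xm; apply: i3.
Qed.

End OutputProgram.

(** * The algorithm *)

(** Register 4 receives [m * m + m + n + 1], which is beyond both the input and the output. With at
    most three vertices the search is skipped, the count stays 0 and the output is empty. *)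
Definition main_cmd : cmd :=
  Seq (Blk [:: Const 4 0])
    (Seq (For 5 3 (Blk [:: Add 4 4 3]))
       (Seq (Blk [:: Add 4 4 3; Add 4 4 2; Add 4 4 1; Const 0 0; Const 10 0;
                Const 12 3; Defs.Sub 12 2 12])
          (Seq (IfP 12 search_cmd)
             (Seq (Blk [:: Defs.Sub 12 2 10; Defs.Sub 12 1 12])
                (IfP 12 output_cmd))))).

Definition setup : program :=
  [:: Const 1 1; Const 4 0; Read 2 4; Add 3 2 2; Defs.Sub 3 3 1; Defs.Sub 3 3 1].

Definition pmw2_program : program := setup ++ code main_cmd 6.

Lemma main_cmd_ok : well_formed main_cmd && keeps_constants main_cmd.
Proof. by []. Qed.

Lemma allpairs_mkseq a b (g : nat -> nat -> nat) :
  [seq g (nat_of_ord x) (nat_of_ord y) | x <- enum 'I_a, y <- enum 'I_b] =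
  mkseq (fun i => g (i %/ b) (i %% b)) (a * b).
Proof.
have -> : [seq g (nat_of_ord x) (nat_of_ord y) | x <- enum 'I_a, y <- enum 'I_b] =
    [seq g x y | x <- iota 0 a, y <- iota 0 b].
  by rewrite -[iota 0 a]val_enum_ord -[iota 0 b]val_enum_ord allpairs_mapl allpairs_mapr.
elim: a => [|a IH]; first by rewrite mul0n.
rewrite -addn1 iotaD allpairs_cat IH mulnDl mul1n /mkseq iotaD map_cat; congr (_ ++ _).
rewrite /= cats0 !add0n -[in RHS](addn0 (a * b)) iotaDl -map_comp.
apply/eq_in_map => j; rewrite mem_iota add0n => /= jb.
have b0 : 0 < b by case: (b) jb.
by rewrite divnMDl // modnMDl divn_small ?modn_small ?addn0.
Qed.

Lemma size_encode_graph n (G : sgraph 'I_n) : size (encode_graph G) = (n * n).+1.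
Proof. by rewrite /= size_allpairs size_enum_ord. Qed.

Lemma nth_encode_graph n (G : sgraph 'I_n) (u v : 'I_n) :
  nth 0 (encode_graph G) (1 + u * n + v) = G u v.
Proof.
pose g x y := nat_of_bool (G (insubd u x) (insubd u y)).
have -> : encode_graph G =
    n :: [seq g (nat_of_ord x) (nat_of_ord y) | x <- enum 'I_n, y <- enum 'I_n].
  by congr (_ :: _); apply: eq_allpairs => x y; rewrite /g !valKd.
have un := ltn_ord u; have vn := ltn_ord v.
rewrite allpairs_mkseq -addnA add1n [nth _ _ _]/= nth_mkseq; last by nia.
rewrite divnMDl ?modnMDl ?divn_small ?modn_small ?addn0 //; last by lia.
by rewrite /g !valKd.
Qed.

Lemma mkseq_split (o : nat -> nat) a b : mkseq o (1 + a + b) =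
  o 0 :: mkseq (fun i => o (1 + i)) a ++ mkseq (fun i => o (1 + a + i)) b.
Proof.
rewrite /mkseq !iotaD !map_cat /= !add0n -[in LHS](addn0 (1 + a)) -{1}(addn0 1).
by rewrite !iotaDl -!map_comp.
Qed.

Lemma encode_decompositionE n m M (T : sgraph 'I_M.+1) (bit : nat -> nat -> nat)
    (delta : 'I_M.+1 -> 'I_n) (o : nat -> nat) :
    m = M.+1 -> (forall x y, T x y = bit x y :> nat) -> o 0 = m ->
    (forall x y, x < m -> y < m -> o (1 + x * m + y) = bit x y) ->
    (forall x : 'I_M.+1, o (1 + m * m + x) = delta x) ->
  encode_decomposition T delta = mkseq o (1 + m * m + m).
Proof.
move=> -> Tb o0 ob od; set m' := M.+1 in ob od *.
rewrite /encode_decomposition /encode_graph.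
have -> : [seq nat_of_bool (T x y) | x <- enum 'I_m', y <- enum 'I_m'] =
    [seq bit (nat_of_ord x) (nat_of_ord y) | x <- enum 'I_m', y <- enum 'I_m'].
  by apply: eq_allpairs => x y; rewrite Tb.
rewrite allpairs_mkseq mkseq_split o0 cat_cons; congr (_ :: _ ++ _).
  apply/eq_in_map => i; rewrite mem_iota add0n => /= im.
  rewrite -ob ?ltn_mod ?ltn_divLR //; congr o.
  by rewrite -addnA -divn_eq.
rewrite /mkseq -val_enum_ord -map_comp.
by apply/eq_map => x; rewrite /= od.
Qed.

Lemma setup_correct P w : at_pos P 0 setup ->
  exists s : state, [/\ iter 6 (step P) (init w) = at_state 6 s, s.1 1 = 1,
    s.1 2 = nth 0 w 0, s.1 3 = 2 * nth 0 w 0 - 2 & s.2 = nth 0 w].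
Proof.
move=> a; exists (run (Blk setup) (upd (fun=> 0) 0 (size w), nth 0 w)); split.
- exact: (blk_correct (upd (fun=> 0) 0 (size w), nth 0 w) a).
- by [].
- by [].
- by rewrite /= /upd /=; lia.
- by [].
Qed.

(** One of two complementary shores has at most one vertex, and its size bounds the number of
    crossing edges. *)
Lemma width_small n (G : sgraph 'I_n) (N : finType) (T : sgraph N) (delta : N -> 'I_n) :
  n < 4 -> width G T delta <= 1.
Proof.
move=> n4; apply/bigmax_leqP=> t _; apply/porosity_leP=> f fm.
set X := shore _ _ _ _; have := crossingC X fm.
have : #|crossing f X| <= #|X|.
  by apply: subset_leq_card; apply/subsetP=> v; rewrite inE => /andP[].
have : #|crossing f (~: X)| <= #|~: X|.
  by apply: subset_leq_card; apply/subsetP=> v; rewrite inE => /andP[].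
by have := cardsC X; rewrite card_ord; lia.
Qed.

(** A failed search refutes width 2 by completeness. After a successful one the caterpillar has
    width at most 2, and no decomposition has a smaller one, so output and parameter agree. *)
Lemma main_correct n (G : sgraph 'I_n) (s : state) : brace G ->
    s.1 1 = 1 -> s.1 2 = n -> s.1 3 = 2 * n - 2 -> s.2 = nth 0 (encode_graph G) ->
  let s' := run main_cmd s in
  let out := mkseq s'.2 (s'.1 0) in
  (out = [::] /\ ~ pmw_eq G 2) \/ (encodes_decomposition_of_width G 2 out /\ pmw_eq G 2).
Proof.
move=> braceG s1 s2 s3 sm; set m := 2 * n - 2 in s3.
pose F := m * m + m + n + 1.
have n0 : 0 < n by have [_ [[h _] _] _] := braceG; rewrite card_ord in h.
have nF : n * n < F by rewrite /F /m; nia.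
rewrite /main_cmd; set L1 := For 5 3 _; set b1 := Blk [:: Const 4 0].
set b2 := Blk [:: Add 4 4 3, _ & _]; set b3 := Blk [:: Defs.Sub 12 2 10; _].
rewrite 5!run_Seq.
have [e4 em] : m * m = (run L1 (run b1 s)).1 4 + 0 * m /\ (run L1 (run b1 s)).2 = s.2.
  pose I k (t : state) := m * m = t.1 4 + k * m /\ t.2 = s.2.
  suff : I 0 (run L1 (run b1 s)) by [].
  apply: (@for_ind I) => //.
    by split=> //; rewrite -[(run b1 s).1 3]/(s.1 3) s3.
  move=> k t km e5 fr [i1 i2]; split; last by [].
  by rewrite /= /upd /= (fr 3) // -[(run b1 s).1 3]/(s.1 3) s3; lia.
have f1 q : q \in [:: 1; 2; 3] -> (run L1 (run b1 s)).1 q = s.1 q.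
  by rewrite !inE => /or3P[] /eqP->; rewrite run_frame // run_frame.
move: (run L1 _) e4 em f1 => t e4 em f1; rewrite addn0 in e4.
have t1 : t.1 1 = 1 by rewrite f1.
have t2 : t.1 2 = n by rewrite f1.
have t3 : t.1 3 = m by rewrite f1.
have r4 : (run b2 t).1 4 = F by rewrite /= /upd /= -e4 t1 t2 t3.
have r10 : (run b2 t).1 10 = 0 by [].
have r0 : (run b2 t).1 0 = 0 by [].
have r12 : (run b2 t).1 12 = n - 3 by rewrite /= /upd /= t2.
have rm : (run b2 t).2 = nth 0 (encode_graph G) by rewrite run_blk_mem // em.
have f2 q : q \in [:: 1; 2; 3] -> (run b2 t).1 q = t.1 q.
  by rewrite !inE => /or3P[] /eqP->; rewrite run_frame.
move: (run b2 t) r4 r10 r0 r12 rm f2 => r r4 r10 r0 r12 rm f2.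
have r1 : r.1 1 = 1 by rewrite f2.
have r2 : r.1 2 = n by rewrite f2.
have r3 : r.1 3 = m by rewrite f2.
clear t e4 em f1 t1 t2 t3 f2.
have er : env G F r by split=> // u v; rewrite rm nth_encode_graph.
have IfE q c (u : state) : run (IfP q c) u = if 0 < u.1 q then run c u else u by [].
have fin (w : state) : w.1 1 = 1 -> w.1 2 = n -> w.1 10 < n -> w.1 0 = 0 ->
    run (IfP 12 output_cmd) (run b3 w) = run b3 w /\ (run b3 w).1 0 = 0.
  move=> w1 w2 w10 w0; split; last by rewrite run_frame.
  have w12 : (run b3 w).1 12 = 1 - (n - w.1 10) by rewrite /= /upd /= w1 w2.
  by rewrite IfE w12 (_ : (0 < 1 - (n - w.1 10)) = false) //; lia.
case: (ltnP 3 n) => n4; last first.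
  rewrite (IfE 12 search_cmd) r12 (_ : (0 < n - 3) = false); last by lia.
  left; have [|-> ->] := fin r r1 r2 _ r0; first by rewrite r10.
  split=> // -[[N [T [delta [_ e]]]] _].
  by have := @width_small n G N T delta; rewrite e; lia.
rewrite (IfE 12 search_cmd) r12 (_ : (0 < n - 3) = true); last by lia.
have [|low le ok fl] := run_search nF braceG n4 er; first by rewrite r10.
have f3 q : q \in [:: 0; 1; 2; 3; 4] -> (run search_cmd r).1 q = r.1 q.
  by rewrite !inE => /or4P[/eqP->|/eqP->|/eqP->|/orP[]/eqP->]; rewrite run_frame.
move: (run search_cmd r) low le ok fl f3 => w low le ok fl f3.
have w0 : w.1 0 = 0 by rewrite f3.
have w1 : w.1 1 = 1 by rewrite f3.
have w2 : w.1 2 = n by rewrite f3.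
have w3 : w.1 3 = m by rewrite f3.
have w4 : w.1 4 = F by rewrite f3.
have V4 : 3 < #|'I_n| by rewrite card_ord.
have [cn|cn] := eqVneq (w.1 10) n; last first.
  left; have [|-> ->] := fin w w1 w2 _ w0; first by lia.
  split=> // -[[N [T [delta [dec e]]]] _].
  have [|x [y [ne h]]] := search_complete braceG dec _ V4; first by rewrite e.
  have fail (x' y' : 'I_n) : y' < x' -> (forall p c, search_inv G x' y' p c ->
      (forall u, ~~ candidate G p u) -> c = #|'I_n|) -> False.
    move=> lt hc; have [p [c [inv cl ncn]]] := fl (elimN eqP cn) x' y' lt.
    by apply: ncn; rewrite (hc p c inv cl) card_ord.
  (* The pair given by completeness is taken in the order in which the program tried it. *)
  case: (ltngtP x y) => [lt|lt|exy].
  - by apply: (fail y x lt) => p c inv; apply: h; right.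
  - by apply: (fail x y lt) => p c inv; apply: h; left.
  - by move/val_inj: exy ne => ->; rewrite eqxx.
right; have [x0 [y0 inv]] := ok cn.
have [A [bip _]] := side_of braceG x0.
have cA := card_sides braceG bip (ltnW (ltnW V4)); have := cardsC A.
rewrite -cA card_ord addnn -mul2n => nE; set k := #|A| in nE.
pose M := 4 * k - 3; have mE : m = M.+1 by rewrite /m /M; lia.
pose p : 'I_n -> nat := stamps F w; have inv' : search_inv G x0 y0 p #|'I_n| by rewrite card_ord.
have [p_inj p_range] : injective p /\ forall v, 0 < p v <= n.
  by case: inv' => /stamping_full[]; rewrite card_ord.
(* Stamps decreased by one are an injection of ['I_n] into itself, hence a bijection, and every
   position lies between 1 and [n]. *)
have p_surj x : x < m -> exists v, p v = position x.
  move=> xm; have px : 0 < position x <= n.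
    by move: xm; rewrite /position /m => xm; do 2?[case: eqP => ?]; lia.
  have bd v : (p v).-1 < n by have := p_range v; lia.
  have gi : injective (fun v => Ordinal (bd v)).
    move=> u v [e]; apply: p_inj; have := p_range u; have := p_range v; lia.
  have [h gK hK] := injF_bij gi.
  have rx : (position x).-1 < n by lia.
  exists (h (Ordinal rx)); have /(congr1 val)/= := hK (Ordinal rx).
  by have := p_range (h (Ordinal rx)); lia.
have cb : consts n m F (run b3 w) by split; rewrite run_frame.
have sb v : stamps F (run b3 w) v = p v by rewrite /stamps run_blk_mem.
have b12 : (run b3 w).1 12 = 1 by rewrite /= /upd /= w1 w2 cn subnn.
rewrite IfE b12 [0 < 1]/=.
have [|||o0 om ob od] := run_output (n := n) (m := m) (F := F) _ _ _ p_inj p_surj cb sb.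
- by lia.
- by [].
- by rewrite /F; lia.
move: (run output_cmd _) o0 om ob od => o o0 om ob od.
(* The default [x0] never occurs, because every position is the stamp of some vertex. *)
pose delta (x : 'I_M.+1) := odflt x0 [pick v | p v == position x].
have p_delta x : p (delta x) = position x.
  rewrite /delta; case: pickP => [v /eqP//|no].
  by have [|v pv] := p_surj x; [rewrite mE|have := no v; rewrite pv eqxx].
have k2 : 1 < k by lia.
have cV : #|'I_n| = 2 * k by rewrite card_ord.
have dec := caterpillar_decomposition k2 (erefl M) cV inv' p_delta.
have wle := caterpillar_width k2 (erefl M) braceG cV inv' p_delta.
have w22 : width G (caterpillar M) delta = 2.
  by apply/eqP; rewrite eqn_leq wle (width_ge2 dec braceG V4).
split; last first.
  split; first by exists _, (caterpillar M), delta.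
  by move=> N T d dec'; apply: (width_ge2 dec' braceG V4).
exists M.+1, (caterpillar M), delta; split=> //.
rewrite o0; apply/esym; apply: (encode_decompositionE (bit := tree_bit m)) => //.
  by move=> x y; rewrite /tree_bit mE.
move=> x; have [|v [pv ->]] := od x; first by rewrite mE.
by congr nat_of_ord; apply: p_inj; rewrite pv p_delta.
Qed.

Theorem theorem10 :
  exists (P : program) (c d : nat),
    forall (n : nat) (G : sgraph 'I_n), brace G ->
      exists out : seq nat,
        [/\ returns_within P (encode_graph G)
              (c * size (encode_graph G) ^ d + c) out,
            out = [::] \/ encodes_decomposition_of_width G 2 out
          & encodes_decomposition_of_width G 2 out <-> pmw_eq G 2].
Proof.
pose K := cost_factor main_cmd; pose d := depth main_cmd.
exists pmw2_program, (6 + K * 3 ^ d), d => n G braceG.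
have [at0 at6] : at_pos pmw2_program 0 setup /\ at_pos pmw2_program 6 (code main_cmd 6).
  by apply: (@at_pos_cat _ 0 setup); exists [::], [::]; rewrite cats0.
have [s [e6 s1 s2 s3 sm]] := setup_correct (encode_graph G) at0.
have /andP[wf kc] := main_cmd_ok.
(* The bound covers both loop registers, [n] and [2 * n - 2]. *)
have [||t tle te] := compile_correct (B := 2 * n) at6 wf kc s1.
- by rewrite s2 /=; lia.
- by rewrite s3 /=; lia.
have := main_correct braceG s1 s2 s3 sm.
move: (run main_cmd s) te => s' te res; exists (mkseq s'.2 (s'.1 0)).
split.
- exists (6 + t); split.
  + rewrite size_encode_graph; apply: leq_trans (leq_add (leqnn 6) tle) _.
    have := cost_poly (2 * n) main_cmd; rewrite -/K -/d => cp.
    (* The input consists of [n * n + 1] numbers, and [2 * n + 1] is at most three times as large;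
       hence the factor [3 ^ d]. *)
    have le : (2 * n).+1 ^ d <= 3 ^ d * (n * n).+1 ^ d.
      have mono a b e : a <= b -> a ^ e <= b ^ e.
        by move=> ab; case: e => // e; rewrite leq_exp2r.
      by rewrite -expnMn; apply: mono; nia.
    have : cost (2 * n) main_cmd <= K * 3 ^ d * (n * n).+1 ^ d.
      by rewrite -mulnA; apply: leq_trans cp _; rewrite leq_mul2l le orbT.
    by rewrite mulnDl; lia.
  + by rewrite (reach_trans e6 te) /halted /pmw2_program size_cat size_code leqnn.
  + by rewrite (reach_trans e6 te).
- by case: res => [[-> _]|[h _]]; [left|right].
- case: res => [[-> npm]|[h pm]]; split=> //.
  (* The empty list encodes nothing, since an encoding begins with the number of nodes. *)
  by case=> m [T [delta [_ _]]].
Qed.
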